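(* Let $X\sim\mathrm{IP}(\mu;\delta,\beta,\gamma)$ with $\delta\le 0$, fix a positive integer $n$, and let $g\in\mathcal{H}^{M,n}(X)$, where either $M\ge n$ is an integer or $M=\infty$. For every non-negative integer $m$ with $m\le M$ let \[ S_{m,n}(g)=\sum_{i=1}^{m}a_i\,\mathbb{E}^2\big[q^i(X)g^{(i)}(X)\big]+\sum_{i=1}^{n}(-1)^{i-1}b_i\,\mathbb{E}\big[q^{i}(X)\big(g^{(i)}(X)\big)^2\big], \] \[ a_i=\frac{\binom{m}{i}\prod_{j=m+i}^{m+n+i-1}(1-j\delta)}{(m+n)_i\,\mathbb{E}[q^i(X)]\Big(\prod_{j=i-1}^{2i-2}(1-j\delta)\Big)\prod_{j=m}^{m+n-1}(1-j\delta)},\qquad b_i=\frac{\binom{n}{i}}{(m+n)_i\prod_{j=m}^{m+i-1}(1-j\delta)} \] (the first sum being zero if $m=0$). Then for all integers $m_1,m_2$ with $0\le m_1<m_2\le M$, \[ \big|\mathrm{Var}\,g(X)-S_{m_1,n}(g)\big|\ge \zeta_{m_1,m_2,n}(\delta)\,\big|\mathrm{Var}\,g(X)-S_{m_2,n}(g)\big|, \qquad \zeta_{m_1,m_2,n}(\delta)=\frac{(m_2+n)_n\prod_{j=m_2}^{m_2+n-1}(1-j\delta)}{(m_1+n)_n\prod_{j=m_1}^{m_1+n-1}(1-j\delta)}>1, \] with equality if and only if $g$ is a polynomial of degree at most $n+m_1$ on the support of $X$.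
   Context: A random variable $X$ with density $f$ and finite mean $\mu=\mathbb{E}X$ belongs to the integrated Pearson family, written $X\sim\mathrm{IP}(\mu;\delta,\beta,\gamma)$, if there is a quadratic polynomial $q(x)=\delta x^2+\beta x+\gamma$ (with $|\delta|+|\beta|+|\gamma|>0$) such that $\int_{-\infty}^{x}(\mu-t)f(t)\,dt=q(x)f(x)$ for all $x\in\mathbb{R}$. Let $J(X)=(\alpha,\omega)$ denote the support of $X$. For $x\in\mathbb{R}$ and $k\in\mathbb{N}$, $(x)_k=x(x-1)\cdots(x-k+1)$ with $(x)_0=1$. For non-negative integers $m,n$ with $\ell=\max\{m,n\}$ and $\mathbb{E}|X|^{2\ell}<\infty$, $\mathcal{H}^{m,n}(X)$ is the class of Borel functions $g:(\alpha,\omega)\to\mathbb{R}$ such that: $g\in C^{\ell-1}(\alpha,\omega)$ and $g^{(\ell-1)}$ is absolutely continuous on $(\alpha,\omega)$ with a.s. derivative $g^{(\ell)}$; $\mathbb{E}[q^n(X)(g^{(n)}(X))^2]<\infty$; and $\mathbb{E}[q^i(X)|g^{(i)}(X)|]<\infty$ for $i=n+1,\dots,m$ (if any). Also $\mathcal{H}^{\infty,n}(X)=\bigcap_{m\ge 0}\mathcal{H}^{m,n}(X)$. Empty products equal $1$, and $\mathbb{E}^2[Y]$ means $(\mathbb{E}Y)^2$. *)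

(* Defs.v *)
From HB Require Import structures.
From mathcomp Require Import all_boot all_order all_algebra.
From mathcomp Require Import all_classical all_reals all_analysis.
Set Implicit Arguments. Unset Strict Implicit. Unset Printing Implicit Defensive.
Import Order.TTheory GRing.Theory Num.Theory.
Local Open Scope classical_set_scope.
Local Open Scope ring_scope.

Section IPDefs.
Variable R : realType.
Local Notation leb := (@lebesgue_measure R).

Definition qpoly (d b c : R) (x : R) : R := d * x ^+ 2 + b * x + c.

Definition is_density (f : R -> R) : Prop :=
  measurable_fun setT f /\ (forall x, 0 <= f x) /\
  leb.-integrable setT (EFin \o f) /\ Rintegral leb setT f = 1.

Definition IP (f : R -> R) (mu d b c : R) : Prop :=
  is_density f /\
  leb.-integrable setT (EFin \o (fun t => t * f t)) /\
  Rintegral leb setT (fun t => t * f t) = mu /\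
  0 < `|d| + `|b| + `|c| /\
  forall x : R, Rintegral leb [set t | t <= x] (fun t => (mu - t) * f t)
                = qpoly d b c x * f x.

Definition Jset (a w : \bar R) : set R :=
  [set x : R | (a < x%:E)%E /\ (x%:E < w)%E].

Definition support_is (f : R -> R) (a w : \bar R) : Prop :=
  (a < w)%E /\ forall x : R, 0 < f x <-> Jset a w x.

Definition Ex (f : R -> R) (a w : \bar R) (h : R -> R) : R :=
  Rintegral leb (Jset a w) (fun x => h x * f x).

Definition Var (f : R -> R) (a w : \bar R) (g : R -> R) : R :=
  Ex f a w (fun x => g x ^+ 2) - (Ex f a w g) ^+ 2.

Definition AC_on (a b : R) (h : R -> R) : Prop :=
  forall e : R, 0 < e -> exists2 del : R, 0 < del &
    forall (k : nat) (u v : nat -> R),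
      (forall i, (i < k)%N -> [/\ a <= u i, u i <= v i & v i <= b]) ->
      (forall i, (i.+1 < k)%N -> v i <= u i.+1) ->
      \sum_(i < k) (v i - u i) < del ->
      \sum_(i < k) `|h (v i) - h (u i)| < e.

Definition AC_open (J : set R) (h : R -> R) : Prop :=
  forall a b, J a -> J b -> AC_on a b h.

(* g \in H^{m,n}(X); Dg i is (a version of) the i-th derivative g^(i) *)
Definition inH (f : R -> R) (a w : \bar R) (d b c : R) (m n : nat)
    (g : R -> R) (Dg : nat -> R -> R) : Prop :=
  let l := maxn m n in
  let J := Jset a w in
  let q := qpoly d b c in
  leb.-integrable setT (EFin \o (fun x => `|x| ^+ (2 * l) * f x)) /\
  (forall x, J x -> Dg 0%N x = g x) /\
  (forall i, (i.+1 < l)%N -> forall x, J x -> is_derive x 1 (Dg i) (Dg i.+1 x)) /\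
  AC_open J (Dg l.-1) /\
  {ae leb, forall x, J x -> is_derive x 1 (Dg l.-1) (Dg l x)} /\
  measurable_fun J (Dg l) /\
  leb.-integrable J (EFin \o (fun x => q x ^+ n * Dg n x ^+ 2 * f x)) /\
  (forall i, (n < i <= m)%N ->
     leb.-integrable J (EFin \o (fun x => q x ^+ i * `|Dg i x| * f x))).

(* M in N or M = infinity (None) *)
Definition inHM (f : R -> R) (a w : \bar R) (d b c : R) (M : option nat) (n : nat)
    (g : R -> R) (Dg : nat -> R -> R) : Prop :=
  match M with
  | Some M' => inH f a w d b c M' n g Dg
  | None => forall m, inH f a w d b c m n g Dg
  end.

Definition leM (m : nat) (M : option nat) : bool :=
  match M with Some M' => (m <= M')%N | None => true end.

Definition pd (d : R) (lo hi : nat) : R := \prod_(lo <= j < hi) (1 - j%:R * d).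

Definition acoef (f : R -> R) (a w : \bar R) (d b c : R) (m n i : nat) : R :=
  ('C(m, i))%:R * pd d (m + i) (m + n + i) /
  (((m + n) ^_ i)%:R * Ex f a w (fun x => qpoly d b c x ^+ i)
    * pd d i.-1 (2 * i).-1 * pd d m (m + n)).

Definition bcoef (d : R) (m n i : nat) : R :=
  ('C(n, i))%:R / (((m + n) ^_ i)%:R * pd d m (m + i)).

Definition Smn (f : R -> R) (a w : \bar R) (d b c : R) (m n : nat)
    (Dg : nat -> R -> R) : R :=
  \sum_(1 <= i < m.+1) acoef f a w d b c m n i *
      (Ex f a w (fun x => qpoly d b c x ^+ i * Dg i x)) ^+ 2
  + \sum_(1 <= i < n.+1) (-1) ^+ i.-1 * bcoef d m n i *
      Ex f a w (fun x => qpoly d b c x ^+ i * Dg i x ^+ 2).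

Definition zeta (d : R) (m1 m2 n : nat) : R :=
  (((m2 + n) ^_ n)%:R * pd d m2 (m2 + n)) / (((m1 + n) ^_ n)%:R * pd d m1 (m1 + n)).

End IPDefs.

(* Main.v *)
(** Let f_j = q^j f and l = X - mu. Differentiating the defining identity gives
    (q f)' = - l f, and each f_j satisfies an equation of the same form with
    l_j = l - j q'. The Rodrigues polynomials P_{j,k} of f_j are orthogonal for f_j and
    P_{j,k}' is a multiple of P_{j+1,k-1}. Integrating by parts, the Fourier coefficients of
    g^(i) with respect to f_i are those of g shifted by i, so that, e_k being the normalised
    squared coefficients of g and lam_k = k (1 - (k - 1) delta),
      E[q^i (g^(i))^2] = sum_{k<N} prod_{t<i} (lam_k - lam_t) e_k + rem_i(N).
    A Poincaré inequality on the orthogonal complement of the polynomials of degree < k,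
    whose constant tends to 0 as k grows, gives rem_i(N) -> 0 for i < n; density of the
    polynomials is not used. By Newton interpolation at lam_0, lam_1, ..., the coefficient
    of e_k in Var g - S_{m,n} is prod_{m<j<=m+n} (1 - lam_k / lam_j) for k > m and 0
    otherwise. After multiplication by (-1)^n prod_{m<j<=m+n} lam_j these coefficients are
    nonnegative and nonincreasing in m, while that of rem_n becomes independent of m. The
    two sides can thus be compared term by term, and they are equal exactly when e_k = 0
    for all k > m_1 + n. *)

(* The sign of delta enters in three places: q grows at most linearly, which gives moments of all
   orders; the slopes 1 - 2 j delta of the l_j stay positive, so each q^j f is again a Pearson
   weight; and lam is strictly increasing.

   The obstacle is integrability. Square integrability of the derivatives is given only at level n,
   and above n only E[q^i |g^(i)|] is finite. Boundary terms q f u are therefore shown to vanish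
   from integrability alone: if |q f u| stayed above a constant near an end, the integral of |l u f|
   = |q f u| |(q f)'| / (q f) could not be small there, since q f tends to 0. Descending one level
   from n preserves square integrability; descending one level above n gains a power of sqrt(1 +
   x^2), which is what pairing with a Rodrigues polynomial of the matching degree requires.

   The Poincaré inequality comes from duality: solving h = l v - q v' moves the orthogonality
   conditions on h to v, one fewer of them and for the weight q f, so that induction on their number
   applies. *)
From mathcomp Require Import all_boot all_order all_algebra.
From mathcomp Require Import all_classical all_reals all_analysis.
From mathcomp Require Import measurable_realfun zify ring lra.
Import Order.TTheory GRing.Theory Num.Theory.
Import numFieldNormedType.Exports.
Require Import Defs.
Local Open Scope classical_set_scope.
Local Open Scope ring_scope.
Set Implicit Arguments. Unset Strict Implicit. Unset Printing Implicit Defensive.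

(** * Integrals of real functions *)

Section Integrals.
Context {R : realType}.
Notation leb := (@lebesgue_measure R).
Notation itg D h := (Rintegral (@lebesgue_measure R) D h).
Implicit Types (D E : set R) (h k : R -> R).

Definition L1 D h := leb.-integrable D (EFin \o h).

Lemma L1_meas D h : L1 D h -> measurable_fun D h.
Proof. by move=> /integrableP[/measurable_EFinP]. Qed.

Lemma L1_ext D h k : measurable D -> (forall x, D x -> h x = k x) ->
  L1 D h -> L1 D k.
Proof.
move=> mD hk; apply: eq_integrable => // x; rewrite inE => Dx /=.
by rewrite hk.
Qed.

Lemma L1_dom D h k : measurable D -> measurable_fun D h ->
  (forall x, D x -> `|h x| <= k x) -> L1 D k -> L1 D h.
Proof.
move=> mD mh hk; apply: le_integrable => //; first exact/measurable_EFinP.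
move=> x Dx /=; rewrite lee_fin; apply: le_trans (hk x Dx) _; exact: ler_norm.
Qed.

Lemma L1D D h k : measurable D -> L1 D h -> L1 D k ->
  L1 D (fun x => h x + k x).
Proof. by move=> mD Lh Lk; apply: integrableD Lh Lk. Qed.

Lemma L1B D h k : measurable D -> L1 D h -> L1 D k ->
  L1 D (fun x => h x - k x).
Proof. by move=> mD Lh Lk; apply: integrableB Lh Lk. Qed.

Lemma L1Z D h (r : R) : measurable D -> L1 D h -> L1 D (fun x => r * h x).
Proof. by move=> mD Lh; apply: integrableZl Lh. Qed.

Lemma L1N D h : measurable D -> L1 D h -> L1 D (fun x => - h x).
Proof. by move=> mD Lh; apply: integrableN Lh. Qed.

Lemma L1_norm D h : L1 D h -> L1 D (fun x => `|h x|).
Proof. exact: integrable_norm. Qed.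

Lemma L1_sub D E h : measurable D -> measurable E -> E `<=` D ->
  L1 D h -> L1 E h.
Proof. by move=> mD mE ED; apply: integrableS. Qed.

Lemma L1_sum D (I : Type) (s : seq I) (P : pred I) (h : I -> R -> R) :
  measurable D -> (forall i, P i -> L1 D (h i)) ->
  L1 D (fun x => \sum_(i <- s | P i) h i x).
Proof.
move=> mD Lh; have := @integrable_sum _ _ _ leb D mD _ s P (fun i => EFin \o h i) Lh.
apply: eq_integrable => // x _ /=; exact: sumEFin.
Qed.

Lemma itg_ext D h k : (forall x, D x -> h x = k x) -> itg D h = itg D k.
Proof. by move=> hk; apply: eq_Rintegral => x; rewrite inE; apply: hk. Qed.

Lemma itgD D h k : measurable D -> L1 D h -> L1 D k ->
  itg D (fun x => h x + k x) = itg D h + itg D k.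
Proof. by move=> mD Lh Lk; have := @RintegralD _ _ _ leb D h k mD Lh Lk. Qed.

Lemma itgB D h k : measurable D -> L1 D h -> L1 D k ->
  itg D (fun x => h x - k x) = itg D h - itg D k.
Proof. by move=> mD Lh Lk; have := @RintegralB _ _ _ leb D h k mD Lh Lk. Qed.

Lemma itgZ D h r : measurable D -> L1 D h ->
  itg D (fun x => r * h x) = r * itg D h.
Proof. by move=> mD Lh; have := @RintegralZl _ _ _ leb D h r mD Lh. Qed.

Lemma itgN D h : measurable D -> L1 D h ->
  itg D (fun x => - h x) = - itg D h.
Proof.
move=> mD Lh; rewrite -mulN1r -itgZ //; apply: itg_ext => x _.
by rewrite mulN1r.
Qed.

Lemma itg_ge0 D h : (forall x, D x -> 0 <= h x) -> 0 <= itg D h.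
Proof. by move=> h0; have := @Rintegral_ge0 _ _ _ leb D h h0. Qed.

Lemma itg_le D h k : measurable D -> L1 D h -> L1 D k ->
  (forall x, D x -> h x <= k x) -> itg D h <= itg D k.
Proof. by move=> mD Lh Lk hk; have := @le_Rintegral _ _ _ leb D h k mD Lh Lk hk. Qed.

Lemma itg_norm D h : measurable D -> L1 D h ->
  `|itg D h| <= itg D (fun x => `|h x|).
Proof. by move=> mD Lh; have := @le_normr_Rintegral _ _ _ leb D h mD Lh. Qed.

Lemma itg_sum D (I : Type) (s : seq I) (P : pred I) (h : I -> R -> R) :
  measurable D -> (forall i, P i -> L1 D (h i)) ->
  itg D (fun x => \sum_(i <- s | P i) h i x) = \sum_(i <- s | P i) itg D (h i).
Proof.
move=> mD Lh; elim: s => [|i s IH].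
  rewrite big_nil (@itg_ext _ _ (fun=> 0)); last by move=> x _; rewrite big_nil.
  by have := @Rintegral_cst _ _ _ leb D mD 0; rewrite mul0r.
rewrite big_cons; case: (boolP (P i)) => Pi; last first.
  by rewrite -IH; apply: itg_ext => x _; rewrite big_cons (negbTE Pi).
rewrite -IH -itgD //; first by apply: itg_ext => x _; rewrite big_cons Pi.
  exact: Lh.
exact: L1_sum.
Qed.

Lemma itg_setU D E h : measurable D -> measurable E ->
  (forall x, D x -> E x -> False) -> L1 (D `|` E) h ->
  itg (D `|` E) h = itg D h + itg E h.
Proof.
move=> mD mE DE Lh; have := @Rintegral_setU _ _ _ leb D E h mD mE Lh; apply.
by apply/disj_setPS => x [/DE].
Qed.

Lemma itg_setD D E h : measurable D -> measurable E -> E `<=` D -> L1 D h ->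
  itg D h = itg E h + itg (D `\` E) h.
Proof.
move=> mD mE ED Lh; rewrite -itg_setU //.
- by rewrite setDUK.
- exact: measurableD.
- by move=> x Ex [].
- by rewrite setDUK.
Qed.

Lemma itg_subset D E h : measurable D -> measurable E -> E `<=` D -> L1 D h ->
  (forall x, D x -> 0 <= h x) -> itg E h <= itg D h.
Proof.
move=> mD mE ED Lh h0; rewrite (itg_setD mD mE ED Lh) lerDl.
by apply: itg_ge0 => x [/h0].
Qed.

Lemma mseg (x y : R) : measurable `[x, y]%classic.
Proof. exact: measurable_itv. Qed.

Lemma itg_chasles (x y z : R) h : x <= y -> y <= z -> L1 `[x, z] h ->
  itg `[x, z] h = itg `[x, y] h + itg `[y, z] h.
Proof.
move=> xy yz Lh.
rewrite -(@Rintegral_itv_obnd_cbnd _ y); last first.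
  apply: L1_sub Lh => //; apply: subset_itv; rewrite bnd_simp //.
rewrite -(@Rintegral_itvB _ h (BLeft x) (BRight z) y) ?bnd_simp //.
by rewrite addrC subrK.
Qed.

Lemma itg_seg1 (x : R) h : itg `[x, x] h = 0.
Proof. by rewrite set_itv1 Rintegral_set1. Qed.

Lemma leb_seg (x y : R) : x <= y -> leb `[x, y]%classic = (y - x)%:E.
Proof.
move=> xy; rewrite lebesgue_measure_itv /= lte_fin.
by case: ltgtP xy => // ->; rewrite subrr.
Qed.

Lemma itg_seg_cst (x y r : R) : x <= y -> itg `[x, y] (fun=> r) = r * (y - x).
Proof.
move=> xy; have := @Rintegral_cst _ _ _ leb _ (mseg x y) r.
by move=> ->; exact: (congr1 (fun e => r * fine e) (leb_seg xy)).
Qed.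

Lemma L1_seg_cst (x y r : R) : L1 `[x, y] (fun=> r).
Proof.
apply: measurable_bounded_integrable => //.
  have [xy|yx] := leP x y; first by apply: le_lt_trans (ltry (y - x)); rewrite -leb_seg.
  rewrite set_itv_ge ?bnd_simp -?ltNge //.
  have e0 : leb set0 = 0%E by apply: measure0.
  by apply: le_lt_trans (ltry (0 : R)); rewrite -[leLHS]/(leb set0) e0.
by exists `|r|; split=> // M rM t _ /=; apply: ltW.
Qed.

Lemma L1_seg_cont (x y : R) h : {within `[x, y], continuous h} -> L1 `[x, y] h.
Proof. by move=> ch; apply: continuous_compact_integrable => //; exact: segment_compact. Qed.

Lemma L1_mul_bounded D h k (M : R) : measurable D -> measurable_fun D k ->
  (forall x, D x -> `|k x| <= M) -> L1 D h -> L1 D (fun x => k x * h x).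
Proof.
move=> mD mk kM Lh; apply: (@L1_dom _ _ (fun x => M * `|h x|)) => //.
- exact: measurable_funM mk (L1_meas Lh).
- by move=> x Dx; rewrite normrM ler_wpM2r // kM.
- exact: L1Z (L1_norm Lh).
Qed.

End Integrals.
Notation itg D h := (Rintegral (@lebesgue_measure _) D h).

Lemma archi_nat {R : realType} (x : R) : exists n : nat, x < n%:R.
Proof. by exists (Num.Def.trunc x).+1; exact: truncnS_gt. Qed.

Lemma EFin_itg {R : realType} (D : set R) h : measurable D -> L1 D h ->
  (itg D h)%:E = (\int[@lebesgue_measure R]_(x in D) (h x)%:E)%E.
Proof.
move=> mD Lh; rewrite /Rintegral fineK //.
by have := @integrable_fin_num _ (measurableTypeR R) R lebesgue_measure D mD _ Lh.
Qed.

(** * Exhaustion of an open interval *)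

Section Exhaustion.
Context {R : realType} (a w : \bar R).
Local Notation J := (Jset a w).

Lemma Jconv x y z : J x -> J y -> x <= z -> z <= y -> J z.
Proof.
move=> [ax _] [_ yw] xz zy; split.
  by apply: lt_le_trans ax _; rewrite lee_fin.
by apply: le_lt_trans yw; rewrite lee_fin.
Qed.

Lemma Jseg x y : J x -> J y -> `[x, y] `<=` J.
Proof.
by move=> Jx Jy z; rewrite /= in_itv /= => /andP[xz zy]; apply: Jconv Jx Jy xz zy.
Qed.

Lemma openJ : open J.
Proof.
rewrite (_ : J = [set x : R | (a < x%:E)%E] `&` [set x : R | (x%:E < w)%E]) //.
apply: openI.
- case: a => [r| |].
  + by under eq_set do rewrite lte_fin; exact: open_gt.
  + rewrite (_ : mkset _ = set0) ?open0 //.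
    by apply/seteqP; split=> x //=; rewrite ltNge leey.
  + rewrite (_ : mkset _ = setT); first exact: openT.
    by apply/seteqP; split=> x //= _; exact: ltNyr.
- case: w => [r| |].
  + by under eq_set do rewrite lte_fin; exact: open_lt.
  + rewrite (_ : mkset _ = setT); first exact: openT.
    by apply/seteqP; split=> x //= _; exact: ltry.
  + rewrite (_ : mkset _ = set0) ?open0 //.
    by apply/seteqP; split=> x //=; rewrite ltNge leNye.
Qed.

Lemma mJ : measurable J.
Proof. exact: open_measurable openJ. Qed.

Lemma Jnbhs x : J x -> nbhs x J.
Proof. by move=> Jx; apply: open_nbhs_nbhs; split=> //; exact: openJ. Qed.

Lemma J_ball x : J x -> exists2 r : R, 0 < r & forall y, `|y - x| <= r -> J y.
Proof.
move=> /Jnbhs/nbhs_ballP[r /= r0 rJ]; exists (r / 2); first by rewrite divr_gt0.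
move=> y yx; apply: rJ; rewrite /ball /= distrC; lra.
Qed.

End Exhaustion.
Arguments mJ {R a w}.
Arguments openJ {R a w}.

Section Exhaustion2.
Context {R : realType}.
Notation leb := (@lebesgue_measure R).

Lemma J_left (a w : \bar R) x0 : Jset a w x0 -> exists2 al : nat -> R,
  (forall n, Jset a w (al n) /\ al n.+1 <= al n <= x0) &
  forall x, Jset a w x -> exists n, al n <= x.
Proof.
move=> Jx0; case: a Jx0 => [r| |] [ax0 x0w] //; rewrite ?lte_fin // in ax0.
- pose al n : R := r + (x0 - r) / n.+1%:R.
  have alr n : r < al n by rewrite /al ltrDl divr_gt0 // subr_gt0.
  have aln n : al n.+1 <= al n.
    rewrite /al lerD2l ler_wpM2l ?subr_ge0 ?(ltW ax0) //.
    by rewrite lef_pV2 ?posrE // ler_nat.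
  have alx n : al n <= x0.
    elim: n => [|n IH]; first by rewrite /al divr1 addrC subrK.
    exact: le_trans (aln n) IH.
  exists al => [n|x [rx _]].
    split; last by rewrite aln alx.
    split; first by rewrite lte_fin.
    by apply: le_lt_trans x0w; rewrite lee_fin.
  rewrite lte_fin in rx.
  have [n xn] := archi_nat ((x0 - r) / (x - r)); exists n.
  have n0 : (0 : R) < n.+1%:R by [].
  rewrite /al addrC -lerBrDr ler_pdivrMr // mulrC -ler_pdivrMr ?subr_gt0 //.
  by apply: le_trans (ltW xn) _; rewrite ler_nat.
- pose al n : R := x0 - n%:R.
  exists al => [n|x _].
    have n0 : (0 : R) <= n%:R by [].
    split; last by rewrite /al mulrSr; lra.
    split; first exact: ltNyr.
    by apply: le_lt_trans x0w; rewrite lee_fin /al; lra.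
  by have [n xn] := archi_nat (x0 - x); exists n; rewrite /al; lra.
Qed.

Lemma J_right (a w : \bar R) x0 : Jset a w x0 -> exists2 om : nat -> R,
  (forall n, Jset a w (om n) /\ x0 <= om n <= om n.+1) &
  forall x, Jset a w x -> exists n, x <= om n.
Proof.
have neg x : Jset a w x <-> Jset (- w) (- a) (- x).
  by split=> -[h1 h2]; split; [move: h2|move: h1|move: h2|move: h1];
    rewrite EFinN lteN2.
move/neg/J_left => [al ale alx]; exists (fun n => - al n) => [n|x /neg/alx[n xn]].
  have [J1 /andP[l1 l2]] := ale n; split; first by apply/neg; rewrite opprK.
  by apply/andP; split; lra.
by exists n; lra.
Qed.

Section Tail.
Variables (a w : \bar R).
Local Notation J := (Jset a w).

(** Eventually, as x decreases to a and y increases to w inside J. Finite and infinite ends are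
    treated alike. *)
Definition evJ (P : R -> R -> Prop) := exists x0 y0, [/\ J x0, J y0, x0 <= y0 &
  forall x y, J x -> J y -> x <= x0 -> y0 <= y -> P x y].

Lemma evJ_and P Q : evJ P -> evJ Q -> evJ (fun x y => P x y /\ Q x y).
Proof.
move=> [x1 [y1 [Jx1 Jy1 xy1 P1]]] [x2 [y2 [Jx2 Jy2 xy2 Q2]]].
have Jmin : J (Num.min x1 x2) by rewrite minElt; case: ifP.
have Jmax : J (Num.max y1 y2) by rewrite maxElt; case: ifP.
exists (Num.min x1 x2), (Num.max y1 y2); split=> //.
  by rewrite ge_min le_max xy1.
move=> x y Jx Jy; rewrite le_min ge_max => /andP[h1 h2] /andP[h3 h4].
by split; [apply: P1|apply: Q2].
Qed.

Lemma evJ_impl (P Q : R -> R -> Prop) :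
  (forall x y, J x -> J y -> x <= y -> P x y -> Q x y) -> evJ P -> evJ Q.
Proof.
move=> PQ [x0 [y0 [Jx Jy xy H]]]; exists x0, y0; split=> // x y Jx' Jy' xx yy.
apply: PQ => //; last exact: H.
exact: le_trans xx (le_trans xy yy).
Qed.

Lemma evJ_ex (P : R -> R -> Prop) : evJ P -> exists x y, [/\ J x, J y, x <= y & P x y].
Proof. by move=> [x [y [Jx Jy xy H]]]; exists x, y; split=> //; apply: H. Qed.

Lemma evJ_in x0 y0 : J x0 -> J y0 -> evJ (fun x y => x <= x0 /\ y0 <= y).
Proof.
move=> Jx0 Jy0; exists (Num.min x0 y0), (Num.max x0 y0); split.
- by rewrite minElt; case: ifP.
- by rewrite maxElt; case: ifP.
- by rewrite ge_min !le_max lexx.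
- by move=> x y _ _; rewrite le_min ge_max => /andP[-> _] /andP[_ ->].
Qed.

Lemma exhaust_cvg (x0 : R) (h : R -> R) : J x0 -> measurable_fun J h ->
  (forall x, J x -> 0 <= h x) ->
  exists al om : nat -> R,
  [/\ forall n, J (al n) /\ J (om n), forall n, al n <= x0 <= om n &
    (\int[leb]_(x in `[al n, om n]) (h x)%:E @[n --> \oo] -->
     \int[leb]_(x in J) (h x)%:E)%E].
Proof.
move=> Jx0 mh h0.
have [al ale alx] := J_left Jx0; have [om ome omx] := J_right Jx0.
have Jal n : J (al n) by case: (ale n).
have Jom n : J (om n) by case: (ome n).
exists al, om; split=> [n|n|].
- by split.
- by have [_ /andP[_ ->]] := ale n; have [_ /andP[-> _]] := ome n.
have mal : {homo al : m n / (m <= n)%N >-> n <= m}.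
  by apply: homo_leq => [//|y x z xy yz|n]; [exact: le_trans yz xy|
     have [_ /andP[-> _]] := ale n].
have mom : {homo om : m n / (m <= n)%N >-> m <= n}.
  by apply: homo_leq => [//|y x z xy yz|n]; [exact: le_trans xy yz|
     have [_ /andP[_ ->]] := ome n].
have -> : J = \bigcup_n `[al n, om n]%classic.
  apply/seteqP; split=> x.
    move=> Jx; have [n1 h1] := alx _ Jx; have [n2 h2] := omx _ Jx.
    exists (maxn n1 n2) => //=; rewrite in_itv /=; apply/andP; split.
      by apply: le_trans h1; apply: mal; rewrite leq_maxl.
    by apply: le_trans h2 _; apply: mom; rewrite leq_maxr.
  by move=> [n _]; apply: Jseg.
have := @ge0_nondecreasing_set_cvg_integral _ (measurableTypeR R) R (fun n => `[al n, om n]%classic)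
    (EFin \o h) leb; apply.
- move=> m n mn; rewrite subsetEset; apply: subset_itv; rewrite bnd_simp.
    exact: mal.
  exact: mom.
- by move=> i; exact: measurable_itv.
- move=> i; apply/measurable_EFinP; apply: measurable_funS mh; first exact: mJ.
  exact: Jseg.
- by move=> i x xi; rewrite lee_fin; apply: h0; apply: Jseg xi.
Qed.

(** Monotone convergence along segments exhausting J. New integrability facts over J start from
    here: a bound on compact segments, uniform in the segment, is enough. *)
Lemma L1_exhaust (x0 : R) (h : R -> R) (A : R) : J x0 -> measurable_fun J h ->
  (forall x, J x -> 0 <= h x) ->
  (forall x y, J x -> J y -> x <= y -> L1 `[x, y] h) ->
  (forall x y, J x -> J y -> x <= x0 -> x0 <= y -> itg `[x, y] h <= A) ->
  L1 J h /\ itg J h <= A.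
Proof.
move=> Jx0 mh h0 Lh hA.
have [al [om [Jao x0ao cv]]] := exhaust_cvg Jx0 mh h0.
have lA : (\int[leb]_(x in J) (h x)%:E <= A%:E)%E.
  rewrite -(cvg_lim _ cv) //; apply: lime_le; first by apply/cvg_ex; exists (\int[leb]_(x in J) (h x)%:E)%E.
  apply: nearW => n; have [Ja Jo] := Jao n; have /andP[ax xo] := x0ao n.
  have Ln := Lh _ _ Ja Jo (le_trans ax xo).
  have := hA _ _ Ja Jo ax xo; by rewrite -lee_fin EFin_itg.
have LJ : L1 J h.
  apply/integrableP; split; first exact/measurable_EFinP.
  apply: le_lt_trans (ltry A); apply: le_trans lA; rewrite le_eqVlt; apply/orP; left; apply/eqP.
  by apply: eq_integral => x; rewrite inE => Jx; rewrite /= ger0_norm //; exact: h0.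
by split=> //; rewrite -lee_fin EFin_itg //; exact: mJ.
Qed.

Lemma L1_tail (h : R -> R) (e : R) : J !=set0 -> L1 J h -> 0 < e ->
  evJ (fun x y => itg (J `\` `[x, y]) (fun t => `|h t|) < e).
Proof.
move=> [x0 Jx0] Lh e0; have Ln := L1_norm Lh.
have mh := L1_meas Ln.
have [al [om [Jao x0ao cv]]] := exhaust_cvg Jx0 mh (fun x _ => normr_ge0 (h x)).
have cvf : (fun n => itg `[al n, om n] (fun t => `|h t|)) @ \oo --> itg J (fun t => `|h t|).
  by rewrite -(EFin_itg mJ Ln) in cv; exact (fine_cvg cv).
move/cvgrPdist_lt: cvf => /(_ _ e0) [n _ /(_ n (leqnn n))] /= ne.
have [Ja Jo] := Jao n; have /andP[ax xo] := x0ao n.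
exists (al n), (om n); split=> //; first exact: le_trans ax xo.
move=> x y Jx Jy xa oy.
have sub : `[al n, om n]%classic `<=` J by apply: Jseg.
have := itg_setD mJ (mseg (al n) (om n)) sub Ln => E.
have mD x' y' : measurable (J `\` `[x', y']) by apply: measurableD => //; exact: mJ.
apply: le_lt_trans (_ : itg (J `\` `[al n, om n]) (fun t => `|h t|) < e).
  apply: itg_subset => //.
  - apply: subset_trans (_ : J `\` `[al n, om n]%classic `<=` _) => // t [Jt nt]; split=> // H.
    by apply: nt; move: H; rewrite /= !in_itv /= => /andP[? ?]; apply/andP; split; lra.
  - by apply: L1_sub Ln; [exact: mJ| |move=> t []].
move: ne; rewrite E addrAC subrr add0r ger0_norm //.
by apply: itg_ge0.
Qed.

Lemma L1_tail_diff (h : R -> R) (e : R) : J !=set0 -> L1 J h -> 0 < e ->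
  evJ (fun x y => `|itg J h - itg `[x, y] h| < e).
Proof.
move=> J0 Lh e0; have [x0 [y0 [Jx0 Jy0 xy0 H]]] := L1_tail J0 Lh e0.
exists x0, y0; split=> // x y Jx Jy xx yy.
have mD : measurable (J `\` `[x, y]) by apply: measurableD => //; exact: mJ.
rewrite (itg_setD mJ (mseg x y) (Jseg Jx Jy) Lh) addrAC subrr add0r.
apply: le_lt_trans (H _ _ Jx Jy xx yy).
by apply: itg_norm => //; exact: (L1_sub mJ mD (@subDsetl _ _ _) Lh).
Qed.

Lemma itg_eq_evJ (h : R -> R) (c : R) : J !=set0 -> L1 J h ->
  (forall e, 0 < e -> evJ (fun x y => `|itg `[x, y] h - c| <= e)) -> itg J h = c.
Proof.
move=> J0 Lh H; apply/eqP; rewrite -subr_eq0 -normr_le0; apply/ler_addgt0Pr => e e0.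
rewrite add0r; have e2 : 0 < e / 2 by lra.
have [x [y [Jx Jy xy [h1 h2]]]] := evJ_ex (evJ_and (L1_tail_diff J0 Lh e2) (H _ e2)).
have := ler_normD (itg J h - itg `[x, y] h) (itg `[x, y] h - c).
by rewrite addrA subrK; lra.
Qed.

End Tail.
End Exhaustion2.

(** * Absolutely continuous functions *)

Section RealInduction.
Context {R : realType}.

(** The supremum of the points of [s, t] satisfying P satisfies P by the step from the left, and the
    step to the right forbids it to lie below t. *)
Lemma real_induction (s t : R) (P : R -> Prop) : s <= t -> P s ->
  (forall x, s <= x <= t -> exists2 r, 0 < r &
     (forall y, s <= y -> y <= x -> x - y < r -> P y -> P x) /\
     (forall z, x <= z -> z <= t -> z - x < r -> P x -> P z)) -> P t.
Proof.
move=> st Ps loc.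
pose S := [set x | s <= x <= t /\ P x].
have supS : has_sup S.
  by split; [exists s; split; rewrite ?lexx|exists t => x [/andP[]]].
have sS : s <= sup S by apply: ub_le_sup; [case: supS|split; rewrite ?lexx].
have St : sup S <= t by apply: ge_sup; [case: supS|move=> x [/andP[]]].
have [r r0 [lf rt]] := loc _ (introT andP (conj sS St)).
have [x [[/andP[sx xt] Px] xS]] := sup_adherent r0 supS.
have xleS : x <= sup S by apply: ub_le_sup; [case: supS|split; rewrite ?sx].
have PS : P (sup S) by apply: (lf x) => //; lra.
have [->//|neq] := eqVneq t (sup S).
have {neq St}St : sup S < t by rewrite lt_neqAle eq_sym neq.
pose z := Num.min t (sup S + r / 2).
have Sz : sup S < z by rewrite /z lt_min St; lra.
have zS : z - sup S < r by have : z <= sup S + r / 2 := ltac:(by rewrite /z ge_min lexx orbT); lra.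
have Pz : P z by apply: rt => //; [exact: ltW|rewrite /z ge_min lexx].
have : z <= sup S.
  apply: ub_le_sup; [by case: supS|split=> //; apply/andP; split; last by rewrite /z ge_min lexx].
  exact: le_trans sS (ltW Sz).
by rewrite leNgt Sz.
Qed.

End RealInduction.

Section ZeroDerivative.
Context {R : realType}.
Notation leb := (@lebesgue_measure R).

Lemma is_derive0_near (F : R -> R) (x e : R) : is_derive x 1 F 0 -> 0 < e ->
  exists2 r, 0 < r & forall y, `|y - x| < r -> `|F y - F x| <= e * `|y - x|.
Proof.
move=> [dF F0] e0.
have cv : (fun h => h^-1 *: ((F \o shift x) (h *: 1) - F x)) @ 0^' --> 'D_1 F x.
  by exact: dF.
rewrite F0 in cv.
move/cvgrPdist_le : cv => /(_ e e0) /nbhs_ballP[r /= r0 H].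
exists r => // y yx; have [->|nxy] := eqVneq y x; first by rewrite !subrr normr0 mulr0.
have yx0 : y - x != 0 by rewrite subr_eq0.
have := H (y - x); rewrite /ball /= !sub0r normrN => /(_ yx yx0).
rewrite normrN /shift /= [(y - x) *: 1]mulr1 subrK normrM normfV.
by rewrite mulrC ler_pdivrMr ?normr_gt0.
Qed.

Lemma setI_seg_add (U : set R) (s y z : R) : measurable U ->
  s <= y -> y <= z -> `[y, z] `<=` U ->
  fine (leb (U `&` `[s, y])) + (z - y) <= fine (leb (U `&` `[s, z])).
Proof.
move=> mU sy yz yzU.
have fin x : s <= x -> leb (U `&` `[s, x]) \is a fin_num.
  move=> sx; rewrite ge0_fin_numE ?measure_ge0 //.
  apply: le_lt_trans (ltry (x - s)); rewrite -leb_seg //.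
  by apply: le_measure; rewrite ?inE; [exact: measurableI|exact: mseg|exact: subIsetr].
have mD : measurable `]y, z] by [].
have e : leb `]y, z] = (z - y)%:E.
  by rewrite lebesgue_measure_itv /= lte_fin; case: ltgtP yz => // ->; rewrite subrr.
rewrite -lee_fin EFinD !fineK ?fin //; last exact: le_trans sy yz.
rewrite -e -measureU //; last 2 first.
- exact: measurableI.
- apply/seteqP; split=> // x [[_]] /=; rewrite !in_itv /= => /andP[_ h1] /andP[h2 _].
  by move: (lt_le_trans h2 h1); rewrite ltxx.
apply: le_measure; rewrite ?inE; [| exact: measurableI|].
  by apply: measurableU => //; exact: measurableI.
move=> x [[Ux]|] /=; rewrite !in_itv /=.
  by move=> /andP[sx xy]; split=> //; rewrite sx (le_trans xy yz).
move=> /andP[yx xz]; split; first by apply: yzU; rewrite /= in_itv /= xz ltW.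
by rewrite xz (le_trans sy (ltW yx)).
Qed.

Lemma setI_seg_mono (U : set R) (s y z : R) : measurable U ->
  s <= y -> y <= z ->
  fine (leb (U `&` `[s, y])) <= fine (leb (U `&` `[s, z])).
Proof.
move=> mU sy yz.
have fin x : s <= x -> leb (U `&` `[s, x]) \is a fin_num.
  move=> sx; rewrite ge0_fin_numE ?measure_ge0 //.
  apply: le_lt_trans (ltry (x - s)); rewrite -leb_seg //.
  by apply: le_measure; rewrite ?inE; [exact: measurableI|exact: mseg|exact: subIsetr].
rewrite fine_le ?fin //; first exact: le_trans sy yz.
apply: le_measure; rewrite ?inE; [exact: measurableI|exact: measurableI|].
by apply: setIS; apply: subset_itvl; rewrite bnd_simp.
Qed.

(** Bookkeeping for an induction along [s, x]: the variation of F is split into a part of slope at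
    most e and the increments over finitely many successive intervals, whose total length is at most
    the measure of U in [s, x]. *)
Definition chainU (U : set R) (F : R -> R) (e s x : R) := exists (k : nat) (u v : nat -> R),
  [/\ forall i, (i < k)%N -> [/\ s <= u i, u i <= v i & v i <= x],
      forall i, (i.+1 < k)%N -> v i <= u i.+1,
      \sum_(i < k) (v i - u i) <= fine (leb (U `&` `[s, x])) &
      `|F x - F s| <= e * (x - s) + \sum_(i < k) `|F (v i) - F (u i)|].

Lemma chainU_good (U : set R) (F : R -> R) (e s y z : R) : measurable U -> s <= y -> y <= z ->
  `|F z - F y| <= e * (z - y) -> chainU U F e s y -> chainU U F e s z.
Proof.
move=> mU sy yz Fzy [k [u [v [h1 h2 h3 h4]]]]; exists k, u, v; split=> //.
- by move=> i /h1[? ? ?]; split=> //; exact: le_trans yz.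
- exact: le_trans h3 (setI_seg_mono mU sy yz).
- by have := ler_normD (F z - F y) (F y - F s); rewrite addrA subrK; lra.
Qed.

Lemma chainU_bad (U : set R) (F : R -> R) (e s y z : R) :
  measurable U -> 0 <= e -> s <= y -> y <= z ->
  `[y, z] `<=` U -> chainU U F e s y -> chainU U F e s z.
Proof.
move=> mU e0 sy yz yzU [k [u [v [h1 h2 h3 h4]]]].
exists k.+1, (fun i => if (i < k)%N then u i else y), (fun i => if (i < k)%N then v i else z).
split.
- move=> i ik; case: ifP => [/h1[? ? ?]|_]; split=> //; exact: le_trans yz.
- move=> i ik; rewrite ltnS in ik; rewrite ik; case: ifP => [/h2 //|_].
  by have [] := h1 i ik.
- rewrite big_ord_recr /= ltnn; apply: le_trans (setI_seg_add mU sy yz yzU).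
  rewrite lerD2r; apply: le_trans h3.
  by rewrite le_eqVlt; apply/orP; left; apply/eqP; apply: eq_bigr => i _; rewrite ltn_ord.
- rewrite big_ord_recr /= ltnn.
  rewrite (eq_bigr (fun i : 'I_k => `|F (v i) - F (u i)|)); last by move=> i _; rewrite ltn_ord.
  have := ler_normD (F z - F y) (F y - F s); rewrite addrA subrK.
  have : e * (y - s) <= e * (z - s) by rewrite ler_wpM2l // lerD2r.
  lra.
Qed.

(** Real induction takes the place of a covering theorem. The exceptional set lies in an open U of
    small measure. At a point outside U the slope of F is locally at most e; at a point of U the
    chain is prolonged by an interval inside U. Absolute continuity then controls the chain. *)
Lemma AC_der0 (F : R -> R) (s t : R) : s <= t -> AC_on s t F ->
  {ae leb, forall x, s <= x <= t -> is_derive x 1 F 0} -> F t = F s.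
Proof.
move=> st ACF [N [mN N0 bad]].
apply/eqP; rewrite -subr_eq0 -normr_le0; apply/ler_addgt0Pr => e0 e0_gt0.
rewrite add0r.
(* The part of slope e contributes at most e * (t - s) and the chain at most e, together e0. *)
pose e := e0 / (t - s + 1).
have ts : 0 < t - s + 1 by lra.
have e_gt0 : 0 < e by rewrite divr_gt0.
have [del del0 Hdel] := ACF _ e_gt0.
have [U [oU NU mUN]] : exists U : set R, [/\ open U, N `<=` U & (leb (U `\` N) < del%:E)%E].
  by apply: lebesgue_regularity_outer => //; rewrite -[ltLHS]/(leb N) N0 ltry.
have mU : measurable U by apply: open_measurable.
have Udel x : s <= x -> fine (leb (U `&` `[s, x])) < del.
  move=> sx; have le1 : (leb (U `&` `[s, x]) <= leb (U `\` N))%E.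
    have -> : leb (U `\` N) = (leb (U `\` N) + leb N)%E by rewrite N0 adde0.
    rewrite -measureU //; [|exact: measurableD|by rewrite setDKI].
    rewrite setUC setDUK //.
    by apply: le_measure; rewrite ?inE; [exact: measurableI|exact: mU|exact: subIsetl].
  have lt1 := le_lt_trans le1 mUN.
  by rewrite -lte_fin fineK // ge0_fin_numE ?measure_ge0 //; exact: lt_trans lt1 (ltry _).
have : chainU U F e s t.
  apply: (@real_induction _ s t) => //.
    exists 0%N, (fun=> 0), (fun=> 0); split=> //.
    - by rewrite big_ord0 fine_ge0.
    - by rewrite big_ord0 !subrr normr0 mulr0 addr0.
  move=> x /andP[sx xt]; have [Ux|nUx] := pselect (U x).
    have [r r0 rU] : exists2 r, 0 < r & forall y, `|y - x| < r -> U y.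
      have /nbhs_ballP[r /= r0 rU] : nbhs x U by apply: open_nbhs_nbhs; split.
      by exists r => // y yx; apply: rU; rewrite /ball /= distrC.
    exists r => //; split=> [y sy yx xyr|z xz zt zxr].
      apply: chainU_bad => //; first exact: ltW.
      by move=> p /=; rewrite in_itv /= => /andP[? ?]; apply: rU; rewrite ltr_norml; lra.
    apply: chainU_bad => //; first exact: ltW.
    by move=> p /=; rewrite in_itv /= => /andP[? ?]; apply: rU; rewrite ltr_norml; lra.
  have dx : is_derive x 1 F 0.
    by apply: contrapT => ndx; apply: nUx; apply: NU; apply: bad => /= H; apply/ndx/H/andP.
  have [r r0 rF] := is_derive0_near dx e_gt0.
  exists r => //; split=> [y sy yx xyr|z xz zt zxr].
    apply: chainU_good => //; have := rF y; rewrite distrC (distrC (F y)).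
    by rewrite ger0_norm ?subr_ge0 //; apply.
  by apply: chainU_good => //; have := rF z; rewrite ger0_norm ?subr_ge0 //; apply.
move=> [k [u [v [h1 h2 h3 h4]]]].
have := Hdel k u v h1 h2 (le_lt_trans h3 (Udel t st)).
have : e * (t - s + 1) = e0 by rewrite /e divfK // gt_eqF.
rewrite mulrDr mulr1; lra.
Qed.

End ZeroDerivative.

Section DerivRules.
Context {R : realType}.
Implicit Types (F G : R -> R) (x : R).

Lemma isD_cst (k : R) x : is_derive x 1 (fun=> k) 0.
Proof. exact: is_derive_cst. Qed.

Lemma isD_id x : is_derive x 1 (fun y : R => y) 1.
Proof. exact: is_derive_id. Qed.

Lemma isD_D F G x f' g' : is_derive x 1 F f' -> is_derive x 1 G g' ->
  is_derive x 1 (fun y => F y + G y) (f' + g').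
Proof. by move=> dF dG; apply: is_deriveD. Qed.

Lemma isD_M F G x f' g' : is_derive x 1 F f' -> is_derive x 1 G g' ->
  is_derive x 1 (fun y => F y * G y) (f' * G x + F x * g').
Proof.
move=> dF dG; have dFG := is_deriveM dF dG.
apply: is_derive_eq; rewrite /GRing.scale /=; ring.
Qed.

Lemma isD_X F n x f' : is_derive x 1 F f' ->
  is_derive x 1 (fun y => F y ^+ n) (n%:R * F x ^+ n.-1 * f').
Proof. by move=> dF; have := is_deriveX n dF; rewrite exprfctE. Qed.

Lemma isD_V F x f' : F x != 0 -> is_derive x 1 F f' ->
  is_derive x 1 (fun y => (F y)^-1) (- f' / F x ^+ 2).
Proof.
move=> F0 dF; have dV := is_deriveV F0 dF.
by apply: is_derive_eq; rewrite /GRing.scale /= mulrC; field.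
Qed.

Lemma isD_cont F x f' : is_derive x 1 F f' -> {for x, continuous F}.
Proof.
by move=> [dF _]; apply: differentiable_continuous; apply/derivable1_diffP.
Qed.

Lemma isD_near F G x f' : (\forall y \near x, F y = G y) ->
  is_derive x 1 F f' -> is_derive x 1 G f'.
Proof. by move=> FG dF; apply: near_eq_is_derive dF. Qed.

Lemma isD_poly (p : {poly R}) x : is_derive x 1 (fun y => p.[y]) (p^`()).[x].
Proof. by have := is_derive_poly p x. Qed.

End DerivRules.

(** * Continuity and local absolute continuity on J *)

Section ACcalc.
Context {R : realType} (a w : \bar R).
Local Notation J := (Jset a w).
Implicit Types (F G phi psi : R -> R).

Definition contJ F := forall x, J x -> {for x, continuous F}.

Lemma contJ_within F x y : contJ F -> J x -> J y -> {within `[x, y], continuous F}.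
Proof.
move=> cF Jx Jy; apply: continuous_in_subspaceT => z; rewrite inE => zxy.
exact: cF (Jseg Jx Jy zxy).
Qed.

Lemma contJ_meas F : contJ F -> measurable_fun J F.
Proof.
move=> cF; apply: subspace_continuous_measurable_fun; first exact: mJ.
by apply: continuous_in_subspaceT => z; rewrite inE => /cF.
Qed.

Lemma contJ_L1 F x y : contJ F -> J x -> J y -> L1 `[x, y] F.
Proof. by move=> cF Jx Jy; apply: L1_seg_cont; exact: contJ_within. Qed.

Lemma contJ_bnd F x y : contJ F -> J x -> J y ->
  exists2 A, 0 <= A & forall z, x <= z <= y -> `|F z| <= A.
Proof.
move=> cF Jx Jy; have [xy|yx] := leP x y; last first.
  by exists 0 => // z /andP[xz zy]; have := le_trans xz zy; lra.
have [||c _ Hc] := @EVT_max R (fun z => `|F z|) x y => //.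
  move=> z; apply: continuous_comp; first exact: contJ_within.
  exact: norm_continuous.
by exists `|F c| => // z zxy; apply: Hc; rewrite in_itv.
Qed.

Lemma contJ_M F G : contJ F -> contJ G -> contJ (fun x => F x * G x).
Proof. by move=> cF cG x Jx; apply: continuousM; [exact: cF|exact: cG]. Qed.

Lemma contJ_D F G : contJ F -> contJ G -> contJ (fun x => F x + G x).
Proof. by move=> cF cG x Jx; apply: continuousD; [exact: cF|exact: cG]. Qed.

Lemma contJ_B F G : contJ F -> contJ G -> contJ (fun x => F x - G x).
Proof. by move=> cF cG x Jx; apply: continuousB; [exact: cF|exact: cG]. Qed.

Lemma contJ_V F : (forall x, J x -> F x != 0) -> contJ F -> contJ (fun x => (F x)^-1).
Proof. by move=> F0 cF x Jx; apply: continuousV; [exact: F0|exact: cF]. Qed.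

Lemma contJ_X F n : contJ F -> contJ (fun x => F x ^+ n).
Proof.
move=> cF x Jx.
by apply: (@continuous_comp _ _ _ F (fun y => y ^+ n)); [exact: cF|exact: exprn_continuous].
Qed.

Lemma contJ_poly (p : {poly R}) : contJ (fun x => p.[x]).
Proof. by move=> x _; apply: isD_cont (isD_poly p x). Qed.

Lemma contJ_ext F G : (forall x, J x -> F x = G x) -> contJ F -> contJ G.
Proof.
move=> FG cF x Jx; change (G @ x --> G x); rewrite -(FG x Jx).
have cFx := cF x Jx.
apply: cvg_trans cFx; apply: near_eq_cvg.
by near=> y; apply: FG; near: y; exact: Jnbhs.
Unshelve. all: by end_near. Qed.

Lemma AC_unif F s t e : AC_on s t F -> 0 < e ->
  exists2 del, 0 < del & forall x y, s <= x -> x <= y -> y <= t -> y - x < del ->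
    `|F y - F x| < e.
Proof.
move=> /(_ e) H e0; have [del d0 {}H] := H e0; exists del => // x y sx xy yt yx.
have := H 1%N (fun=> x) (fun=> y); rewrite !big_ord1; apply=> //.
Qed.

Lemma AC_cont F : AC_open J F -> contJ F.
Proof.
move=> acF x Jx; have [r r0 rJ] := J_ball Jx.
have J1 : J (x - r) by apply: rJ; rewrite ler_norml; lra.
have J2 : J (x + r) by apply: rJ; rewrite ler_norml; lra.
apply/cvgrPdist_lt => e e0; have [del d0 H] := AC_unif (acF _ _ J1 J2) e0.
near=> y.
have yr : `|x - y| < r by near: y; exact: cvgr_dist_lt.
have yd : `|x - y| < del by near: y; exact: cvgr_dist_lt.
move: yr yd; rewrite !ltr_norml => /andP[r1 r2] /andP[d1 d2].
rewrite -ltr_norml; have [xy|yx] := leP x y; first by rewrite distrC; apply: H => //; lra.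
by apply: H; lra.
Unshelve. all: by end_near. Qed.

Lemma AC_openD F G : AC_open J F -> AC_open J G -> AC_open J (fun x => F x + G x).
Proof.
move=> aF aG s t Js Jt e e0; have e2 : 0 < e / 2 by lra.
have [d1 d10 H1] := aF s t Js Jt _ e2; have [d2 d20 H2] := aG s t Js Jt _ e2.
exists (Num.min d1 d2); first by rewrite lt_min d10.
move=> k u v h1 h2; rewrite lt_min => /andP[l1 l2].
have := H1 k u v h1 h2 l1; have := H2 k u v h1 h2 l2.
suff : \sum_(i < k) `|F (v i) + G (v i) - (F (u i) + G (u i))| <=
  \sum_(i < k) `|F (v i) - F (u i)| + \sum_(i < k) `|G (v i) - G (u i)| by lra.
rewrite -big_split /=; apply: ler_sum => i _.
by rewrite opprD addrACA; exact: ler_normD.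
Qed.

Lemma AC_openM F G : AC_open J F -> AC_open J G -> AC_open J (fun x => F x * G x).
Proof.
move=> aF aG s t Js Jt e e0.
have [A A0 FA] := contJ_bnd (AC_cont aF) Js Jt.
have [B B0 GB] := contJ_bnd (AC_cont aG) Js Jt.
have AB : 0 < A + B + 1 by lra.
have e2 : 0 < e / 2 / (A + B + 1) by rewrite divr_gt0 //; lra.
have [d1 d10 H1] := aF s t Js Jt _ e2; have [d2 d20 H2] := aG s t Js Jt _ e2.
exists (Num.min d1 d2); first by rewrite lt_min d10.
move=> k u v h1 h2; rewrite lt_min => /andP[l1 l2].
have := H1 k u v h1 h2 l1; have := H2 k u v h1 h2 l2.
rewrite !ltr_pdivlMr // => h3 h4.
suff : \sum_(i < k) `|F (v i) * G (v i) - F (u i) * G (u i)| <=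
  (\sum_(i < k) `|F (v i) - F (u i)|) * (A + B + 1) +
  (\sum_(i < k) `|G (v i) - G (u i)|) * (A + B + 1) by lra.
rewrite !mulr_suml -big_split /=; apply: ler_sum => i _.
have [su uv vt] := h1 i (ltn_ord i).
have -> : F (v i) * G (v i) - F (u i) * G (u i) =
  (F (v i) - F (u i)) * G (v i) + (G (v i) - G (u i)) * F (u i) by ring.
apply: le_trans (ler_normD _ _) _; rewrite !normrM.
have Fu : `|F (u i)| <= A by apply: FA; rewrite su (le_trans uv vt).
have Gv : `|G (v i)| <= B by apply: GB; rewrite vt (le_trans su uv).
by apply: lerD; rewrite ler_wpM2l //; lra.
Qed.

Lemma AC_openC1 F phi : (forall x, J x -> is_derive x 1 F (phi x)) -> contJ phi ->
  AC_open J F.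
Proof.
move=> dF cphi s t Js Jt e e0.
have [A A0 HA] := contJ_bnd cphi Js Jt.
have A1 : 0 < A + 1 by lra.
exists (e / (A + 1)); first by rewrite divr_gt0.
move=> k u v h1 h2; rewrite ltr_pdivlMr // => h3.
apply: le_lt_trans h3; rewrite mulr_suml; apply: ler_sum => i _.
have [su uv vt] := h1 i (ltn_ord i).
have [->|nuv] := eqVneq (u i) (v i); first by rewrite !subrr normr0 mul0r.
have {}uv : u i < v i by rewrite lt_neqAle nuv.
have Juv z : u i <= z <= v i -> J z.
  move=> /andP[uz zv].
  by apply: (Jconv Js Jt); [exact: le_trans su uz|exact: le_trans zv vt].
have [||c cuv ->] := @MVT R F phi (u i) (v i) uv.
- move=> x; rewrite in_itv /= => /andP[ux xv]; apply: dF; apply: Juv.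
  by rewrite !ltW.
- apply: continuous_in_subspaceT => x; rewrite inE /= in_itv /= => /Juv Jx; exact: isD_cont (dF _ Jx).
have uv0 : 0 <= v i - u i by lra.
rewrite normrM (ger0_norm uv0) [leRHS]mulrC; apply: ler_wpM2r => //.
move: cuv; rewrite in_itv /= => /andP[uc cv].
have := HA c; rewrite (le_trans su (ltW uc)) (le_trans (ltW cv) vt) => /(_ isT).
lra.
Qed.

End ACcalc.

(** * Primitives of locally integrable functions *)

Section Primitive.
Context {R : realType} (a w : \bar R).
Notation leb := (@lebesgue_measure R).
Local Notation J := (Jset a w).
Implicit Types (F G phi psi h : R -> R).

Definition Lloc phi := forall x y, J x -> J y -> L1 `[x, y] phi.

Definition prim (x0 : R) phi (x : R) :=
  if x0 <= x then itg `[x0, x] phi else - itg `[x, x0] phi.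

Lemma prim_diff x0 phi x y : J x0 -> Lloc phi -> J x -> J y -> x <= y ->
  prim x0 phi y - prim x0 phi x = itg `[x, y] phi.
Proof.
move=> J0 Lp Jx Jy xy; rewrite /prim.
have [x0x|xx0] := leP x0 x; have [x0y|yx0] := leP x0 y.
- by rewrite (itg_chasles x0x xy (Lp _ _ J0 Jy)); lra.
- by have := le_trans x0x xy; lra.
- by rewrite opprK addrC -(itg_chasles (ltW xx0) x0y (Lp _ _ Jx Jy)).
- by rewrite (itg_chasles xy (ltW yx0) (Lp _ _ Jx J0)); lra.
Qed.

(** Absolute continuity of the integral speaks of one measurable set; this gathers a chain of
    segments, possibly sharing endpoints, into such a set. *)
Lemma union_segs (k : nat) (u v : nat -> R) (s t : R) h : s <= t -> L1 `[s, t] h ->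
  (forall x, 0 <= h x) ->
  (forall i, (i < k)%N -> [/\ s <= u i, u i <= v i & v i <= t]) ->
  (forall i, (i.+1 < k)%N -> v i <= u i.+1) ->
  exists E : set R, [/\ measurable E, E `<=` `[s, t],
    (leb E <= (\sum_(i < k) (v i - u i))%:E)%E &
    \sum_(i < k) itg `[u i, v i] h <= itg E h].
Proof.
elim: k t => [|k IH] t st Lh h0 h1 h2.
  exists set0; split=> //; first by rewrite big_ord0; have -> : leb set0 = 0%E by exact: measure0.
  by rewrite big_ord0; apply: itg_ge0.
have [sk kv vt] := h1 k (ltnSn k).
have vk i : (i < k)%N -> v i <= u k.
  move=> ik; have [d dk] : exists d, (i + d.+1 = k)%N.
    by exists (k - i).-1; rewrite prednK ?subn_gt0 // subnKC // ltnW.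
  elim: d i ik dk => [|d IHd] i ik dk; first by rewrite -dk addn1; apply: h2; rewrite -dk addn1.
  have ik2 : (i.+1 < k)%N by rewrite -dk addnS ltnS -addn1 leq_add2l.
  apply: le_trans (IHd i.+1 _ _) => //; last by rewrite -dk addSnnS.
  apply: le_trans (h2 i _) _; first exact: ltnW.
  by have [] := h1 i.+1 (ltnW ik2).
have L1k : L1 `[s, u k] h.
  by apply: L1_sub Lh => //; apply: subset_itvl; rewrite bnd_simp (le_trans kv).
have [||E [mE sE lE iE]] := IH (u k) sk L1k h0.
- by move=> i ik; have [? ? ?] := h1 i (ltnW ik); split=> //; exact: vk.
- by move=> i ik; apply: h2; exact: ltnW.
have sub1 : `[u k, v k]%classic `<=` `[s, t] by apply: subset_itv; rewrite bnd_simp.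
have sub2 : E `<=` `[s, t].
  apply: subset_trans sE _; apply: subset_itvl; rewrite bnd_simp; exact: le_trans vt.
have sub3 : E `|` `[u k, v k] `<=` `[s, t] by rewrite subUset.
have mU : measurable (E `|` `[u k, v k]) by apply: measurableU.
exists (E `|` `[u k, v k]); split=> //.
  rewrite big_ord_recr /= EFinD -leb_seg //.
  have mE2 : (leb (E `|` `[u k, v k]) <= leb E + leb `[u k, v k])%E by apply: measureU2.
  by apply: le_trans mE2 _; exact: leeD.
rewrite big_ord_recr /=.
have L1e : L1 `[u k, v k] h by apply: L1_sub Lh.
have E1 : itg `]u k, v k] h = itg `[u k, v k] h.
  apply: Rintegral_itv_obnd_cbnd; apply: L1_sub L1e => //.
  by apply: subset_itvr; rewrite bnd_simp.
(* The half-open segment is disjoint from E, whose points are at most [u k]. *)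
rewrite -E1; apply: le_trans (_ : _ <= itg (E `|` `]u k, v k]) h) _.
  rewrite itg_setU //; first by rewrite lerD2r.
    move=> x /sE /=; rewrite !in_itv /= => /andP[_ xu] /andP[ux _].
    by have := lt_le_trans ux xu; rewrite ltxx.
  apply: (L1_sub (D := `[s, t])) Lh => //; first exact: measurableU.
  rewrite subUset; split=> //; apply: subset_trans sub1.
  by apply: subset_itvr; rewrite bnd_simp.
apply: itg_subset => //; first exact: measurableU.
  by apply: setUS; apply: subset_itvr; rewrite bnd_simp.
exact: L1_sub Lh.
Qed.

Lemma AC_prim x0 phi : J x0 -> Lloc phi -> AC_open J (prim x0 phi).
Proof.
move=> J0 Lp s t Js Jt e e0.
have [st|ts] := leP s t; last first.
  exists 1 => // k u v h1 h2 _; case: k h1 h2 => [|k] h1 h2; first by rewrite big_ord0.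
  by have [? ? ?] := h1 0%N isT; lra.
have Lst := Lp s t Js Jt.
have LT : L1 setT (phi \_ `[s, t]).
  rewrite /L1 -restrict_EFin; have := @integrable_restrict _ (measurableTypeR R) R leb
    `[s, t]%classic (mseg s t) setT measurableT (EFin \o phi).
  by rewrite setTI => <-.
have [d [d0 Hd]] := integral_normr_continuous LT e0.
exists d => // k u v h1 h2 h3.
have Ln : L1 `[s, t] (fun x => `|(phi \_ `[s, t]) x|).
  by apply: L1_norm; apply: L1_sub LT.
have [E [mE sE lE iE]] := union_segs st Ln (fun x => normr_ge0 _) h1 h2.
have lEd : (leb E < d%:E)%E by apply: le_lt_trans lE _; rewrite lte_fin.
apply: le_lt_trans (Hd E mE lEd); apply: le_trans iE.
apply: ler_sum => i _; have [su uv vt] := h1 i (ltn_ord i).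
have Ju : J (u i) by apply: (Jconv Js Jt) => //; exact: le_trans vt.
have Jv : J (v i) by apply: (Jconv Js Jt) => //; exact: le_trans su _.
rewrite prim_diff // (@itg_ext _ _ (fun x => `|(phi \_ `[s, t]) x|) (fun x => `|phi x|)).
  exact: itg_norm (mseg _ _) (Lp _ _ Ju Jv).
move=> x xuv; rewrite patchE mem_set //; apply: subset_itv xuv; rewrite bnd_simp //.
Qed.

End Primitive.

(** * Almost everywhere derivatives and the fundamental theorem of calculus *)

Section ACD.
Context {R : realType} (a w : \bar R).
Notation leb := (@lebesgue_measure R).
Local Notation J := (Jset a w).
Implicit Types (F G phi psi h : R -> R).

Definition aeJ (P : R -> Prop) := {ae leb, forall x, J x -> P x}.

Lemma aeJ_and P Q : aeJ P -> aeJ Q -> aeJ (fun x => P x /\ Q x).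
Proof.
move=> aP aQ; have aPQ := @negligibleU _ (measurableTypeR R) R leb _ _ aP aQ.
apply: negligibleS aPQ => x /= /not_implyP[Jx /not_andP[nP|nQ]]; [left|right] => H.
  exact/nP/H.
exact/nQ/H.
Qed.

Lemma aeJ_imp (P Q : R -> Prop) : (forall x, J x -> P x -> Q x) -> aeJ P -> aeJ Q.
Proof.
move=> PQ aP; apply: negligibleS aP => x /= /not_implyP[Jx nQ] H.
exact/nQ/PQ/H.
Qed.

Lemma aeJ_all (P : R -> Prop) : (forall x, J x -> P x) -> aeJ P.
Proof. by move=> JP; apply: aeW. Qed.

(** Lebesgue differentiation for phi cut off to [s, t]: the integral of the cut-off from s differs
    from [prim x0 phi] by a constant on the segment. *)
Lemma ae_prim_seg x0 phi s t : J x0 -> Lloc a w phi -> J s -> J t ->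
  {ae leb, forall x, s < x < t -> is_derive x 1 (prim x0 phi) (phi x)}.
Proof.
move=> J0 Lp Js Jt.
have Lst := Lp s t Js Jt.
pose g := phi \_ `[s, t].
have LT : L1 setT g.
  rewrite /L1 -restrict_EFin; have := @integrable_restrict _ (measurableTypeR R) R leb
    `[s, t]%classic (mseg s t) setT measurableT (EFin \o phi).
  by rewrite setTI => <-.
have Ly y : leb.-integrable [set` Interval (BLeft s) (BRight y)] (EFin \o g).
  exact: L1_sub LT.
have locg : locally_integrable [set: R] g by exact: integrable_locally Lst.
have := FTC1 Ly locg; apply: filterS; first exact: (ae_filter_ringOfSetsType leb).
move=> x H /andP[sx xt]; have [|dG Gx] := H; first by rewrite /= lte_fin.

have Jx y : s < y -> y < t -> J y by move=> sy yt; apply: (Jconv Js Jt); exact: ltW.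
pose G y := itg `[s, y] g.
have dG' : is_derive x 1 G (phi x).
  apply: DeriveDef; first exact: dG.
  by rewrite -derive1E Gx /g patchE mem_set //= in_itv /= !ltW.
have dG2 : is_derive x 1 (fun y => G y + prim x0 phi s) (phi x).
  by have := isD_D dG' (isD_cst (prim x0 phi s) x); rewrite addr0.
apply: isD_near dG2; near=> y.
have y1 : `|x - y| < x - s by near: y; apply: cvgr_dist_lt => //; rewrite subr_gt0.
have y2 : `|x - y| < t - x by near: y; apply: cvgr_dist_lt => //; rewrite subr_gt0.
move: y1 y2; rewrite !ltr_norml => /andP[_ y1] /andP[y2 _].
have sy : s < y by lra.
have yt : y < t by lra.
rewrite /G (@itg_ext _ _ _ phi).
  by rewrite -(prim_diff J0 Lp Js (Jx y sy yt) (ltW sy)) subrK.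
move=> z /=; rewrite in_itv /= => /andP[sz zy]; rewrite /g patchE mem_set //= in_itv /= sz.
exact: le_trans zy (ltW yt).
Unshelve. all: by end_near. Qed.

(** Countably many segments exhaust J, so the exceptional sets have a negligible union. *)
Lemma ae_prim x0 phi : J x0 -> Lloc a w phi ->
  aeJ (fun x => is_derive x 1 (prim x0 phi) (phi x)).
Proof.
move=> J0 Lp; have [al ale alx] := J_left J0; have [om ome omx] := J_right J0.
have Jal n : J (al n) by case: (ale n).
have Jom n : J (om n) by case: (ome n).
have N n m := ae_prim_seg J0 Lp (Jal n) (Jom m).
pose B n m := ~` [set x | al n < x < om m -> is_derive x 1 (prim x0 phi) (phi x)].
have NB : leb.-negligible (\bigcup_n \bigcup_m B n m).
  apply: (@negligible_bigcup _ (measurableTypeR R) R leb) => n.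
  by apply: (@negligible_bigcup _ (measurableTypeR R) R leb) => m; exact: N.
apply: negligibleS NB => x /= /not_implyP[Jx nd].
have [r r0 rJ] := J_ball Jx.
have J1 : J (x - r) by apply: rJ; rewrite ler_norml; lra.
have J2 : J (x + r) by apply: rJ; rewrite ler_norml; lra.
have [n nx] := alx _ J1; have [m mx] := omx _ J2.
exists n => //; exists m => //=; apply/not_implyP; split=> //.
by apply/andP; split; lra.
Qed.

(** The form of differentiability used for integration by parts. It is stable under sums and
    products, satisfies the fundamental theorem ([ACD_FTC]), and also covers the top derivative of
    g, which exists only almost everywhere. *)
Definition ACD F phi := [/\ AC_open J F, aeJ (fun x => is_derive x 1 F (phi x)),
  measurable_fun J phi & Lloc a w phi].

Lemma ACD_cont F phi : ACD F phi -> contJ a w F.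
Proof. by case=> + _ _ _; exact: AC_cont. Qed.

Lemma ACD_C1 F phi : (forall x, J x -> is_derive x 1 F (phi x)) -> contJ a w phi ->
  ACD F phi.
Proof.
move=> dF cphi; split; first exact: AC_openC1 dF cphi.
- exact: aeJ_all.
- exact: contJ_meas.
- by move=> x y Jx Jy; exact: (contJ_L1 cphi Jx Jy).
Qed.

Lemma ACD_prim x0 phi : J x0 -> measurable_fun J phi -> Lloc a w phi ->
  ACD (prim x0 phi) phi.
Proof. by move=> J0 mp Lp; split=> //; [exact: AC_prim|exact: ae_prim]. Qed.

Lemma Lloc_contM F phi : contJ a w F -> measurable_fun J phi -> Lloc a w phi ->
  Lloc a w (fun x => F x * phi x).
Proof.
move=> cF mp Lp x y Jx Jy; have [A A0 HA] := contJ_bnd cF Jx Jy.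
apply: (@L1_mul_bounded _ _ _ _ A) => //; last exact: Lp.
- apply: measurable_funS (contJ_meas cF); [exact: mJ|exact: Jseg].
Qed.

Lemma ACD_M F G phi psi : ACD F phi -> ACD G psi ->
  ACD (fun x => F x * G x) (fun x => phi x * G x + F x * psi x).
Proof.
move=> AF AG; have cF := ACD_cont AF; have cG := ACD_cont AG.
case: AF => aF dF mF LF; case: AG => aG dG mG LG; split.
- exact: AC_openM.
- by apply: aeJ_imp (aeJ_and dF dG) => x Jx [h1 h2]; exact: isD_M.
- have m1 := contJ_meas cF; have m2 := contJ_meas cG.
  by apply: measurable_funD; apply: measurable_funM.
- move=> x y Jx Jy; apply: L1D => //.
    apply: (L1_ext (h := fun x => G x * phi x)) => //; first by move=> z _; rewrite mulrC.
    exact: Lloc_contM.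
  exact: Lloc_contM.
Qed.

Lemma ACD_D F G phi psi : ACD F phi -> ACD G psi ->
  ACD (fun x => F x + G x) (fun x => phi x + psi x).
Proof.
move=> [aF dF mF LF] [aG dG mG LG]; split.
- exact: AC_openD.
- by apply: aeJ_imp (aeJ_and dF dG) => x Jx [h1 h2]; exact: isD_D.
- exact: measurable_funD.
- by move=> x y Jx Jy; exact: (L1D (mseg x y) (LF _ _ Jx Jy) (LG _ _ Jx Jy)).
Qed.

Lemma ACD_ext F G phi psi : (forall x, F x = G x) -> (forall x, J x -> phi x = psi x) ->
  ACD F phi -> ACD G psi.
Proof.
move=> /funext -> pp [aG dG mG LG]; split=> //.
- by apply: aeJ_imp dG => x Jx; rewrite pp.
- by apply: eq_measurable_fun mG => x; rewrite inE => /pp.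
- move=> x y Jx Jy; apply: L1_ext (LG _ _ Jx Jy) => // z zxy; apply: pp; exact: Jseg zxy.
Qed.

Lemma ACD_cst (k : R) : ACD (fun=> k) (fun=> 0).
Proof.
have d x : J x -> is_derive x 1 (fun=> k) 0 by move=> _; exact: isD_cst.
have c : contJ a w (fun=> 0) by move=> x _; exact: cst_continuous.
exact: (ACD_C1 d c).
Qed.

Lemma ACD_Z (k : R) F phi : ACD F phi -> ACD (fun x => k * F x) (fun x => k * phi x).
Proof.
by move=> AF; apply: ACD_ext (ACD_M (ACD_cst k) AF) => // x _; rewrite mul0r add0r.
Qed.

Lemma ACD_B F G phi psi : ACD F phi -> ACD G psi ->
  ACD (fun x => F x - G x) (fun x => phi x - psi x).
Proof.
by move=> AF AG; apply: ACD_ext (ACD_D AF (ACD_Z (-1) AG)) => x; rewrite ?mulN1r.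
Qed.

Lemma ACD_poly (p : {poly R}) : ACD (fun x => p.[x]) (fun x => (p^`()).[x]).
Proof. by apply: ACD_C1 => [x _|]; [exact: isD_poly|exact: contJ_poly]. Qed.

(** The difference of F and the primitive of phi is absolutely continuous with derivative 0 almost
    everywhere, so [AC_der0] applies. *)
Lemma ACD_FTC F phi x y : ACD F phi -> J x -> J y -> x <= y ->
  itg `[x, y] phi = F y - F x.
Proof.
move=> AF Jx Jy xy; have [aF dF mF LF] := AF.
have [aH dH _ _] := ACD_B AF (ACD_prim Jx mF LF).
have E : F y - prim x phi y = F x - prim x phi x.
  apply: (@AC_der0 _ (fun z => F z - prim x phi z) x y) => //; first exact: aH.
  apply: negligibleS dH => z /= /not_implyP[/andP[xz zy] nd] H.
  by apply: nd; rewrite -[0](subrr (phi z)); apply: H; exact: Jconv Jx Jy xz zy.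
have := prim_diff Jx LF Jx Jy xy; lra.
Qed.

End ACD.

(** * Pearson weights *)

Section Growth.
Context {R : realType}.

(** A smooth substitute for 1 + |x|, so that its powers can be differentiated when they serve as
    weights. *)
Definition rr (x : R) : R := Num.sqrt (1 + x ^+ 2).

Lemma rr_sqr x : rr x ^+ 2 = 1 + x ^+ 2.
Proof. by rewrite sqr_sqrtr // addr_ge0 // sqr_ge0. Qed.

Lemma rr_ge1 x : 1 <= rr x.
Proof. by rewrite -[leLHS]sqrtr1 ler_sqrt ?ler_wpDr ?sqr_ge0 // addr_ge0 ?sqr_ge0. Qed.

Lemma rr_gt0 x : 0 < rr x.
Proof. exact: lt_le_trans (rr_ge1 x). Qed.

Lemma rr_ge_norm x : `|x| <= rr x.
Proof. by rewrite -sqrtr_sqr ler_sqrt ?addr_ge0 ?sqr_ge0 // lerDr. Qed.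

Lemma rr_le x : rr x <= 1 + `|x|.
Proof.
have x0 := normr_ge0 x.
have h : rr x ^+ 2 <= (1 + `|x|) ^+ 2.
  rewrite rr_sqr -[x ^+ 2](real_normK (num_real x)) sqrrD expr1n mul1r mulr2n; lra.
by move: h; rewrite ler_pXn2r // nnegrE ?addr_ge0 // ltW // rr_gt0.
Qed.

Lemma rrX_gt0 s x : 0 < rr x ^+ s.
Proof. by rewrite exprn_gt0 // rr_gt0. Qed.

Lemma isD_rr (x : R) : is_derive x 1 rr (x / rr x).
Proof.
have p0 : 0 < 1 + x ^+ 2 by rewrite ltr_pwDl ?sqr_ge0.
have d1 : is_derive x 1 (fun y : R => 1 + y ^+ 2) (2 * x).
  have := isD_D (isD_cst (1 : R) x) (isD_X 2 (isD_id x)).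
  by rewrite add0r /= expr1 mulr1.
have d2 := is_derive1_sqrt p0.
have := @is_derive1_comp _ Num.sqrt (fun y : R => 1 + y ^+ 2) x _ _ d2 d1.
suff -> : (2 * Num.sqrt (1 + x ^+ 2))^-1 * (2 * x) = x / rr x by [].
rewrite -/(rr x); field; by rewrite gt_eqF ?rr_gt0.
Qed.

Lemma horner_growth (p : {poly R}) :
  exists2 C, 0 <= C & forall x, `|p.[x]| <= C * rr x ^+ (size p).-1.
Proof.
exists (\sum_(i < size p) `|p`_i|); first exact: sumr_ge0.
move=> x; rewrite horner_coef mulr_suml; apply: le_trans (ler_norm_sum _ _ _) _.
apply: ler_sum => i _; rewrite normrM ler_wpM2l // normrX.
apply: le_trans (_ : rr x ^+ i <= _); first by apply: lerXn2r; rewrite ?nnegrE ?rr_ge_norm // ltW // rr_gt0.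
by rewrite ler_weXn2l ?rr_ge1 // -ltnS prednK // (leq_ltn_trans _ (ltn_ord i)).
Qed.

Lemma horner_growthW (p : {poly R}) s : (size p <= s.+1)%N ->
  exists2 C, 0 <= C & forall x, `|p.[x]| <= C * rr x ^+ s.
Proof.
move=> ps; have [C C0 HC] := horner_growth p; exists C => // x.
apply: le_trans (HC x) _; rewrite ler_wpM2l // ler_weXn2l ?rr_ge1 //.
by case: (size p) ps.
Qed.

End Growth.

(** * Vanishing of boundary terms *)

Section Weights.
Context {R : realType} (a w : \bar R) (q : {poly R}).
Local Notation J := (Jset a w).
Implicit Types (f u : R -> R) (l : {poly R}) (B m : R).

(* A weight satisfying the Pearson equation (q f)' = - l f with l = B (X - m). *)
Record PW0 f l B m : Prop := {
  pw_q : forall x, J x -> 0 < q.[x];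
  pw_pos : forall x, J x -> 0 < f x;
  pw_cont : contJ a w f;
  pw_der : forall x, J x -> is_derive x 1 (fun y => q.[y] * f y) (- (l.[x] * f x));
  pw_lp : l = B *: ('X - m%:P);
  pw_B : 0 < B;
  pw_m : J m;
  pw_end : forall e, 0 < e -> evJ a w (fun x y => q.[x] * f x <= e /\ q.[y] * f y <= e) }.

Lemma pw_l f l B m : PW0 f l B m -> forall x, l.[x] = B * (x - m).
Proof. by move=> /pw_lp -> x; rewrite hornerZ hornerXsubC. Qed.

Lemma contJ_rrX s : contJ a w (fun x => rr x ^+ s).
Proof. by apply: contJ_X => x _; exact: isD_cont (isD_rr x). Qed.

Lemma L1_tail2 (h : R -> R) e : J !=set0 -> L1 J h -> 0 < e ->
  evJ a w (fun x y => forall s t, J s -> J t -> s <= t -> t <= x \/ y <= s ->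
    itg `[s, t] (fun z => `|h z|) < e).
Proof.
move=> J0 Lh e0; have := L1_tail J0 Lh e0; apply: evJ_impl => x y Jx Jy xy H s t Js Jt st.
have Lst : L1 `[s, t] (fun z => `|h z|).
  by apply: L1_norm; apply: L1_sub Lh => //; [exact: mJ|exact: Jseg].
have mD : measurable (J `\` `[x, y]) by apply: measurableD => //; exact: mJ.
have LD : L1 (J `\` `[x, y]) (fun z => `|h z|).
  by apply: L1_norm; exact: (L1_sub mJ mD (@subDsetl _ _ _) Lh).
case=> [tx|ys].
- rewrite -(@Rintegral_itv_bndo_bndc _ (BLeft s) t); last first.
    by apply: L1_sub Lst => //; apply: subset_itvl; rewrite bnd_simp.
  apply: le_lt_trans H; apply: itg_subset => // z /=; rewrite in_itv /= => /andP[sz zt].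
  split; first exact: Jconv Js Jt sz (ltW zt).
  by rewrite in_itv /= => /andP[xz _]; have := lt_le_trans zt tx; lra.
- rewrite -(@Rintegral_itv_obnd_cbnd _ s (BRight t)); last first.
    by apply: L1_sub Lst => //; apply: subset_itvr; rewrite bnd_simp.
  apply: le_lt_trans H; apply: itg_subset => // z /=; rewrite in_itv /= => /andP[sz zt].
  split; first exact: Jconv Js Jt (ltW sz) zt.
  by rewrite in_itv /= => /andP[_ zy]; have := le_lt_trans ys sz; lra.
Qed.

Section OneWeight.
Variables (f : R -> R) (l : {poly R}) (B m : R).
Hypothesis W : PW0 f l B m.
Local Notation P x := (q.[x] * f x).

Let J0 : J !=set0. Proof. by exists m; exact: (pw_m W). Qed.

Lemma pw_P_gt0 x : J x -> 0 < P x.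
Proof. by move=> Jx; rewrite mulr_gt0 ?(pw_q W) ?(pw_pos W). Qed.

Lemma pw_lf_cont : contJ a w (fun x => - (l.[x] * f x)).
Proof.
have := contJ_M (@contJ_poly R a w (-1)%:P) (contJ_M (@contJ_poly R a w l) (pw_cont W)).
by apply: contJ_ext => x _; rewrite hornerC mulN1r.
Qed.

Lemma ACD_P : ACD a w (fun x => P x) (fun x => - (l.[x] * f x)).
Proof. exact: ACD_C1 (pw_der W) pw_lf_cont. Qed.

(** P' = - l f and l has the sign of x - m, so P is unimodal with mode m. *)
Lemma pw_noninc x y : J x -> J y -> m <= x -> x <= y -> P y <= P x.
Proof.
move=> Jx Jy mx xy; rewrite -subr_le0 -(ACD_FTC ACD_P Jx Jy xy) -oppr_ge0.
rewrite -itgN //; last by case: ACD_P => _ _ _; apply.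
apply: itg_ge0 => z zxy; have Jz := Jseg Jx Jy zxy; move: zxy.
rewrite /= in_itv /= opprK => /andP[xz _].
have : m <= z by exact: le_trans xz.
rewrite (pw_l W) => mz; have B0 := ltW (pw_B W); have f0 := ltW (pw_pos W Jz).
by rewrite !mulr_ge0 // subr_ge0.
Qed.

Lemma pw_nondec x y : J x -> J y -> y <= m -> x <= y -> P x <= P y.
Proof.
move=> Jx Jy ym xy; rewrite -subr_ge0 -(ACD_FTC ACD_P Jx Jy xy).
apply: itg_ge0 => z zxy; have Jz := Jseg Jx Jy zxy; move: zxy.
rewrite /= in_itv /= => /andP[_ zy].
have : z <= m by exact: le_trans ym.
rewrite (pw_l W) => zm; have B0 := ltW (pw_B W); have f0 := ltW (pw_pos W Jz).
by rewrite oppr_ge0 mulr_le0_ge0 // mulr_ge0_le0 // subr_le0.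
Qed.

(* On a stretch where P = q f drops by half, a primitive F = P u of size c forces
   the integral of |l u f| = |F| |P'| / P to be at least c / 2. *)
Lemma one_sided u phi e y z Pm : ACD a w (fun x => P x * u x) phi ->
  J y -> J z -> y <= z -> 0 < e ->
  (forall t, y <= t <= z -> P t <= Pm) -> Pm / 2 <= `|P z - P y| ->
  itg `[y, z] (fun t => `|phi t|) < e ->
  L1 `[y, z] (fun t => l.[t] * u t * f t) ->
  itg `[y, z] (fun t => `|l.[t] * u t * f t|) < e ->
  forall p, y <= p <= z -> `|P p * u p| <= 4 * e.
Proof.
move=> AF Jy Jz yz e0 PPm hlf hphi Lg hg p /andP[yp pz].
have Jt t : y <= t <= z -> J t by move=> /andP[]; exact: Jconv.
have Jp := Jt p (introT andP (conj yp pz)).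
rewrite leNgt; apply/negP => Fp.
have Lphi s t : J s -> J t -> L1 `[s, t] phi by case: AF => _ _ _; exact.
have dF s t : y <= s -> s <= t -> t <= z -> `|P t * u t - P s * u s| <= e.
  move=> ys st tz.
  have Js : J s by apply: Jt; rewrite ys (le_trans st).
  have Jt' : J t by apply: Jt; rewrite tz (le_trans ys).
  rewrite -(ACD_FTC AF Js Jt' st); apply: le_trans (itg_norm (mseg _ _) (Lphi _ _ Js Jt')) _.
  apply/ltW/(le_lt_trans _ hphi); apply: itg_subset => //.
    by apply: subset_itv; rewrite bnd_simp.
  exact: L1_norm (Lphi _ _ Jy Jz).
(* On this stretch [P u] moves by at most e, so 4 e at p leaves 3 e everywhere; with the factor 1 /
   2 from the drop of P, the integral is at least 3 e / 2, which exceeds e. *)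
have F3 t : y <= t <= z -> 3 * e <= `|P t * u t|.
  move=> /andP[yt tz]; have [pt|tp] := leP p t.
    have := dF p t yp pt tz; have := ler_normB (P t * u t) (P t * u t - P p * u p).
    by rewrite opprB addrC subrK; lra.
  have := dF t p yt (ltW tp) pz; have := ler_normD (P t * u t) (P p * u p - P t * u t).
  by rewrite addrC subrK; lra.
have Pm0 : 0 < Pm.
  by apply: lt_le_trans (PPm y _); [exact: pw_P_gt0|rewrite lexx yz].
have LlP : L1 `[y, z] (fun t => - (l.[t] * f t)) by case: ACD_P => _ _ _; apply.
have I1 : Pm / 2 <= itg `[y, z] (fun t => `|- (l.[t] * f t)|).
  apply: le_trans hlf _; rewrite -(ACD_FTC ACD_P Jy Jz yz); exact: itg_norm.
have I2 : 3 * e / Pm * itg `[y, z] (fun t => `|- (l.[t] * f t)|) <=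
    itg `[y, z] (fun t => `|l.[t] * u t * f t|).
  rewrite -itgZ //; last exact: L1_norm.
  apply: itg_le => //; [exact: L1Z (L1_norm LlP)|exact: L1_norm|].
  move=> t tyz; have Jt1 := Jseg Jy Jz tyz; move: tyz; rewrite /= in_itv /= => tyz.
  have := F3 t tyz; have := PPm t tyz; have Pt := pw_P_gt0 Jt1.
  have ft := pw_pos W Jt1.
  have -> : `|P t * u t| = P t * `|u t| by rewrite normrM gtr0_norm.
  move=> h1 h2; rewrite normrN !(normrM _ (f t)) (normrM l.[t]) (gtr0_norm ft).
  have -> : `|l.[t]| * `|u t| * f t = (P t * `|u t|) * ((P t)^-1 * (`|l.[t]| * f t)).
    by rewrite [RHS]mulrACA mulrV ?unitfE ?gt_eqF // mul1r; ring.
  rewrite -[leLHS]mulrA; apply: ler_pM => //; first by rewrite mulr_ge0 // ltW.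
    by rewrite !mulr_ge0 ?invr_ge0 // ltW.
  by apply: ler_wpM2r; [rewrite mulr_ge0 // ltW|rewrite lef_pV2 ?posrE].
have I3 : 3 * e / Pm * (Pm / 2) <= 3 * e / Pm * itg `[y, z] (fun t => `|- (l.[t] * f t)|).
  apply: ler_wpM2l => //; apply: divr_ge0; last exact: ltW.
  by apply: mulr_ge0 => //; exact: ltW.
have : 3 * e / Pm * (Pm / 2) = 3 / 2 * e by field; rewrite gt_eqF.
lra.
Qed.

(** Only the tails of the integrals of phi and of l u f are used. Beyond m on either side P is
    monotone and tends to 0, so a stretch going out from any point reaches half the value of P
    there, and [one_sided] applies to it with both tails below e / 4. *)
Lemma vanish u phi : ACD a w (fun x => P x * u x) phi -> L1 J phi ->
  L1 J (fun x => l.[x] * u x * f x) ->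
  forall e, 0 < e -> evJ a w (fun x y => `|P x * u x| <= e /\ `|P y * u y| <= e).
Proof.
move=> AF Lphi Lg e e0; have e4 : 0 < e / 4 by rewrite divr_gt0.
have := evJ_and (evJ_in (pw_m W) (pw_m W)) (evJ_and (L1_tail2 J0 Lphi e4) (L1_tail2 J0 Lg e4)).
apply: evJ_impl => x y Jx Jy xy [[xm my] [T1 T2]].
have -> : e = 4 * (e / 4) by rewrite mulrC divfK.
split.
(* z is chosen so far out that P has fallen to half of its maximum P x over [z, x]. *)
- have P2 : 0 < P x / 2 by rewrite divr_gt0 ?pw_P_gt0.
  have [z [_ [Jz _ _ [[zx _] [Pz _]]]]] := evJ_ex (evJ_and (evJ_in Jx Jx) (pw_end W P2)).
  apply: (one_sided (y := z) (z := x) (Pm := P x) AF) => //.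
  + move=> t /andP[zt tx]; apply: pw_nondec => //; exact: Jconv Jz Jx zt tx.
  + by rewrite ger0_norm; lra.
  + by apply: T1 => //; left.
  + by apply: L1_sub Lg => //; [exact: mJ|exact: Jseg].
  + by apply: T2 => //; left.
  + by rewrite lexx zx.
- have P2 : 0 < P y / 2 by rewrite divr_gt0 ?pw_P_gt0.
  have [_ [z [_ Jz _ [[_ yz] [_ Pz]]]]] := evJ_ex (evJ_and (evJ_in Jy Jy) (pw_end W P2)).
  apply: (one_sided (y := y) (z := z) (Pm := P y) AF) => //.
  + move=> t /andP[yt tz]; apply: pw_noninc => //; exact: Jconv Jy Jz yt tz.
  + by rewrite distrC ger0_norm; lra.
  + by apply: T1 => //; right.
  + by apply: L1_sub Lg => //; [exact: mJ|exact: Jseg].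
  + by apply: T2 => //; right.
  + by rewrite lexx yz.
Qed.

Lemma itg_vanish u phi : ACD a w (fun x => P x * u x) phi -> L1 J phi ->
  L1 J (fun x => l.[x] * u x * f x) -> itg J phi = 0.
Proof.
move=> AF Lphi Lg; apply: (itg_eq_evJ J0 Lphi) => e e0.
have e2 : 0 < e / 2 by rewrite divr_gt0.
have := vanish AF Lphi Lg e2; apply: evJ_impl => x y Jx Jy xy [h1 h2].
rewrite subr0 (ACD_FTC AF Jx Jy xy).
by have := ler_normB (P y * u y) (P x * u x); lra.
Qed.

End OneWeight.
End Weights.

(** * Weighted integrability *)

Section Chain.
Context {R : realType} (a w : \bar R) (q : {poly R}) (Cq : R).
Local Notation J := (Jset a w).
Hypothesis qC : forall x, J x -> q.[x] <= Cq * rr x.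
Implicit Types (f u K H : R -> R) (l : {poly R}) (B m : R).

(** [rr] and |l| both grow linearly, so |l| absorbs [rr] away from the zero m of l; near m a
    continuity bound suffices. *)
Lemma rr_absorb f l B m K : PW0 a w q f l B m -> contJ a w K ->
  (forall x, J x -> 0 <= l.[x] * K x) ->
  exists C1 C2, [/\ 0 <= C1, 0 <= C2 &
    forall x, J x -> rr x * `|K x| <= C1 + C2 * (l.[x] * K x)].
Proof.
move=> W cK lK; have [eta eta0 etaJ] := J_ball (pw_m W).
have J1 : J (m - eta) by apply: etaJ; rewrite ler_norml; lra.
have J2 : J (m + eta) by apply: etaJ; rewrite ler_norml; lra.
have cr : contJ a w (fun x => rr x) by move=> x _; exact: isD_cont (isD_rr x).
have [C1 C10 HC1] := contJ_bnd (contJ_M cr cK) J1 J2.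
(* From rr x <= 1 + |m| + |x - m|, where 1 + |m| <= ((1 + |m|) / eta) |x - m| as soon as |x - m| >
   eta. *)
pose C := ((1 + `|m|) / eta + 1) / B.
have B0 := pw_B W.
have C0 : 0 <= C.
  apply: divr_ge0; last exact: ltW.
  by apply: addr_ge0 => //; apply: divr_ge0; [exact: addr_ge0|exact: ltW].
exists C1, C; split=> // x Jx; have [near|far] := leP `|x - m| eta.
  have := HC1 x; rewrite normrM (gtr0_norm (rr_gt0 x)).
  have -> : m - eta <= x <= m + eta by move: near; rewrite ler_norml; lra.
  move=> /(_ isT) h; apply: le_trans h _; rewrite lerDl; apply: mulr_ge0 => //; exact: lK.
apply: le_trans (_ : C * (l.[x] * K x) <= _); last by rewrite lerDr.
rewrite -[l.[x] * K x](ger0_norm (lK x Jx)) normrM (pw_l W) normrM (gtr0_norm B0).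
rewrite !mulrA; apply: ler_wpM2r => //.
have -> : C * B * `|x - m| = ((1 + `|m|) / eta) * `|x - m| + `|x - m|.
  by rewrite /C divfK ?gt_eqF // mulrDl mul1r.
have h1 : 1 + `|m| <= (1 + `|m|) / eta * `|x - m|.
  rewrite -[leLHS]mulr1 -mulrA ler_wpM2l ?addr_ge0 // mulrC ler_pdivlMr // mul1r.
  exact: ltW.
have := rr_le x; have := ler_normD (x - m) m; rewrite subrK; lra.
Qed.

Lemma isD_rrX s (x : R) :
  is_derive x 1 (fun y => rr y ^+ s) (s%:R * rr x ^+ s.-1 * (x / rr x)).
Proof. exact: isD_X (isD_rr x). Qed.

Lemma contJ_rrX' s : contJ a w (fun x => s%:R * rr x ^+ s.-1 * (x / rr x)).
Proof.
have r0 x : J x -> rr x != 0 by move=> _; rewrite gt_eqF ?rr_gt0.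
have c1 : contJ a w (fun x => x / rr x).
  apply: contJ_M; first by move=> x _; exact: cvg_id.
  by apply: contJ_V => // x _; exact: isD_cont (isD_rr x).
apply: contJ_M c1; apply: contJ_M; last exact: contJ_rrX.
by move=> x _; exact: cst_continuous.
Qed.

(* Integrating ((q f) r^s K)' = - r^s l K f + q f (r^s H + (r^s)' K) over [x, y], both
   boundary terms have the favourable sign since K has the sign of l. *)
Lemma weighted_L1_core f l B m s K H T : PW0 a w q f l B m ->
  L1 J (fun x => rr x ^+ s * f x) -> ACD a w K H -> (forall x, J x -> 0 <= H x) ->
  (forall x, J x -> 0 <= l.[x] * K x) -> K m = 0 ->
  L1 J (fun x => q.[x] * rr x ^+ s * H x * f x) ->
  L1 J T -> (forall x, J x -> q.[x] * f x * (s%:R * rr x ^+ s.-1 * (x / rr x) * K x) <= T x) ->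
  L1 J (fun x => rr x ^+ s.+1 * `|K x| * f x).
Proof.
move=> W Ms AK H0 lK Km LH LT hT; have cK := ACD_cont AK.
have cf := pw_cont W.
have cq := @contJ_poly _ a w q; have cl := @contJ_poly _ a w l.
have cr := @contJ_rrX _ a w s.
pose h1 x := rr x ^+ s * (l.[x] * K x) * f x.
pose h2 x := q.[x] * f x * (s%:R * rr x ^+ s.-1 * (x / rr x) * K x).
pose h3 x := q.[x] * rr x ^+ s * H x * f x.
have c1 : contJ a w h1 by apply: contJ_M cf; apply: contJ_M cr _; exact: contJ_M.
have c2 : contJ a w h2 by apply: contJ_M; [exact: contJ_M|exact: contJ_M (@contJ_rrX' s) cK].
have h1_ge0 x : J x -> 0 <= h1 x.
  move=> Jx; rewrite /h1; apply: mulr_ge0; last exact: ltW (pw_pos W Jx).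
  by apply: mulr_ge0; [exact: ltW (rrX_gt0 _ _)|exact: lK].
have Ar : ACD a w (fun x => rr x ^+ s) (fun x => s%:R * rr x ^+ s.-1 * (x / rr x)).
  by apply: ACD_C1 (@contJ_rrX' s) => x _; exact: isD_rrX.
have AG := ACD_M (ACD_P W) (ACD_M Ar AK).
have L1h3 x y : J x -> J y -> L1 `[x, y] h3.
  by move=> Jx Jy; apply: L1_sub LH => //; [exact: mJ|exact: Jseg].
have L1h2 x y : J x -> J y -> L1 `[x, y] h2 by move=> Jx Jy; exact: contJ_L1 c2 Jx Jy.
have L1h1 x y : J x -> J y -> L1 `[x, y] h1 by move=> Jx Jy; exact: contJ_L1 c1 Jx Jy.
have sgn z : J z -> (m <= z -> 0 <= K z) /\ (z <= m -> K z <= 0).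
  move=> Jz; have := lK z Jz; rewrite (pw_l W) -mulrA (pmulr_rge0 _ (pw_B W)) => lKz.
  split=> mz; have [e|ne] := eqVneq z m; rewrite ?e ?Km //.
    by rewrite -(pmulr_rge0 (K z) (_ : 0 < z - m)) // subr_gt0 lt_neqAle eq_sym ne.
  by rewrite -(nmulr_rge0 (K z) (_ : z - m < 0)) // subr_lt0 lt_neqAle ne.
have bnd x y : J x -> J y -> x <= m -> m <= y ->
    itg `[x, y] h1 <= itg J (fun t => `|T t|) + itg J h3.
  move=> Jx Jy xm my; have xy := le_trans xm my.
  have E : itg `[x, y] h1 = itg `[x, y] h2 + itg `[x, y] h3 -
      (q.[y] * f y * (rr y ^+ s * K y) - q.[x] * f x * (rr x ^+ s * K x)).
    rewrite -(ACD_FTC AG Jx Jy xy).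
    have -> : itg `[x, y] (fun z => - (l.[z] * f z) * (rr z ^+ s * K z) + q.[z] * f z *
        (s%:R * rr z ^+ s.-1 * (z / rr z) * K z + rr z ^+ s * H z)) =
        itg `[x, y] (fun z => h2 z + h3 z - h1 z).
      by apply: itg_ext => z _; rewrite /h1 /h2 /h3; ring.
    rewrite itgB //; [rewrite itgD //; [ring|exact: L1h2|exact: L1h3]| |exact: L1h1].
    by apply: L1D => //; [exact: L1h2|exact: L1h3].
  have G1 : 0 <= q.[y] * f y * (rr y ^+ s * K y).
    apply: mulr_ge0; first exact: ltW (pw_P_gt0 W Jy).
    by apply: mulr_ge0; [exact: ltW (rrX_gt0 _ _)|exact: (sgn y Jy).1].
  have G2 : q.[x] * f x * (rr x ^+ s * K x) <= 0.
    apply: mulr_ge0_le0; first exact: ltW (pw_P_gt0 W Jx).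
    by apply: mulr_ge0_le0; [exact: ltW (rrX_gt0 _ _)|exact: (sgn x Jx).2].
  have I2 : itg `[x, y] h2 <= itg J (fun t => `|T t|).
    apply: le_trans (_ : itg `[x, y] (fun t => `|T t|) <= _).
      apply: itg_le => //; first exact: L1h2.
        by apply: L1_norm; apply: L1_sub LT => //; [exact: mJ|exact: Jseg].
      move=> t /(Jseg Jx Jy) Jt; apply: le_trans (hT t Jt) (ler_norm _).
    by apply: itg_subset => //; [exact: mJ|exact: Jseg|exact: L1_norm].
  have I3 : itg `[x, y] h3 <= itg J h3.
    apply: itg_subset => //; [exact: mJ|exact: Jseg|].
    move=> t Jt; rewrite /h3; apply: mulr_ge0; last exact: ltW (pw_pos W Jt).
    apply: mulr_ge0; last exact: H0.
    by apply: mulr_ge0; [exact: ltW (pw_q W Jt)|exact: ltW (rrX_gt0 _ _)].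
  lra.
have [Lh1 _] := L1_exhaust (pw_m W) (contJ_meas c1) h1_ge0
  (fun x y Jx Jy _ => L1h1 x y Jx Jy) bnd.
have [C1 [C2 [C10 C20 HC]]] := rr_absorb W cK lK.
apply: (L1_dom (k := fun x => C1 * (rr x ^+ s * f x) + C2 * h1 x)).
- exact: mJ.
- have cn : contJ a w (fun x => `|K x|).
    by move=> x Jx; apply: continuous_comp; [exact: cK|exact: norm_continuous].
  by apply: contJ_meas; apply: contJ_M cf; apply: contJ_M cn; exact: contJ_rrX.
- move=> x Jx; have f0 := ltW (pw_pos W Jx); have r0 := ltW (rrX_gt0 s x).
  have r1 := ltW (rrX_gt0 s.+1 x).
  rewrite ger0_norm ?mulr_ge0 // exprS.
  have -> : C1 * (rr x ^+ s * f x) + C2 * h1 x =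
      (C1 + C2 * (l.[x] * K x)) * rr x ^+ s * f x by rewrite /h1; ring.
  have -> : rr x * rr x ^+ s * `|K x| * f x = rr x * `|K x| * rr x ^+ s * f x by ring.
  by do 2 (apply: ler_wpM2r => //); exact: HC.
- by apply: L1D; [exact: mJ|exact: L1Z mJ _|exact: L1Z mJ _].
Qed.

(** Induction on s. Since q <= Cq r, the term of [weighted_L1_core] containing (r^s)' is at most s
    Cq r^s |K| f, which is integrable by the case s - 1. *)
Lemma weighted_L1_step f l B m s K H : PW0 a w q f l B m ->
  L1 J (fun x => rr x ^+ s * f x) -> ACD a w K H -> (forall x, J x -> 0 <= H x) ->
  (forall x, J x -> 0 <= l.[x] * K x) -> K m = 0 ->
  L1 J (fun x => q.[x] * rr x ^+ s * H x * f x) ->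
  L1 J (fun x => rr x ^+ s.+1 * `|K x| * f x).
Proof.
move=> W + AK H0 lK Km.
have mf := contJ_meas (pw_cont W).
have mr t : measurable_fun J (fun x => rr x ^+ t) by exact: contJ_meas (@contJ_rrX _ a w t).
have mq : measurable_fun J (fun x => q.[x]) := contJ_meas (@contJ_poly _ a w q).
have mH : measurable_fun J H by case: AK.
elim: s => [|s IH] Ms LH.
  apply: (weighted_L1_core W Ms AK H0 lK Km LH (T := fun=> 0)).
    by apply: (L1_dom (k := fun x => rr x ^+ 0 * f x)) => //; [exact: mJ|
      move=> x Jx; rewrite normr0 expr0 mul1r; exact: ltW (pw_pos W Jx)].
  by move=> x _; rewrite !mul0r mulr0.
have rle x : rr x ^+ s <= rr x ^+ s.+1 by rewrite ler_weXn2l // rr_ge1.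
have Ms' : L1 J (fun x => rr x ^+ s * f x).
  apply: L1_dom Ms; [exact: mJ|exact: measurable_funM|].
  move=> x Jx; have f0 := ltW (pw_pos W Jx); have r0 := ltW (rrX_gt0 s x).
  by rewrite ger0_norm ?mulr_ge0 //; apply: ler_wpM2r => //; exact: rle.
have LH' : L1 J (fun x => q.[x] * rr x ^+ s * H x * f x).
  apply: L1_dom LH; first exact: mJ.
    by apply: measurable_funM => //; apply: measurable_funM => //; exact: measurable_funM.
  move=> x Jx; have f0 := ltW (pw_pos W Jx); have r0 := ltW (rrX_gt0 s x).
  have q0 := ltW (pw_q W Jx); have h0 := H0 x Jx.
  rewrite ger0_norm ?mulr_ge0 //; do 2 (apply: ler_wpM2r => //).
  by apply: ler_wpM2l => //; exact: rle.
have LK := IH Ms' LH'.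
apply: (weighted_L1_core W Ms AK H0 lK Km LH
  (T := fun x => s.+1%:R * Cq * (rr x ^+ s.+1 * `|K x| * f x))).
  exact: L1Z mJ LK.
move=> x Jx; have f0 := ltW (pw_pos W Jx); have q0 := ltW (pw_q W Jx).
have r0 := ltW (rrX_gt0 s x); have rx := rr_gt0 x.
have -> : q.[x] * f x * (s.+1%:R * rr x ^+ s.+1.-1 * (x / rr x) * K x) =
  (s.+1%:R * (rr x ^+ s) * f x) * (q.[x] * (x * K x / rr x)) by rewrite /=; ring.
have -> : s.+1%:R * Cq * (rr x ^+ s.+1 * `|K x| * f x) =
  (s.+1%:R * (rr x ^+ s) * f x) * (Cq * rr x * `|K x|) by rewrite exprS; ring.
apply: ler_wpM2l; first by rewrite !mulr_ge0.
apply: le_trans (_ : q.[x] * `|K x| <= _); last by apply: ler_wpM2r => //; exact: qC.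
apply: ler_wpM2l => //; rewrite ler_pdivrMr // mulrC.
apply: le_trans (ler_norm _) _; rewrite normrM; apply: ler_wpM2l => //; exact: rr_ge_norm.
Qed.

(** With K = l and H = B, [weighted_L1_step] turns the moments of order s and s + 1 into a bound on
    r^(s+1) |l| f, that is, into the moment of order s + 2. *)
Lemma moments f l B m : PW0 a w q f l B m -> L1 J f -> L1 J (fun x => rr x * f x) ->
  forall s, L1 J (fun x => rr x ^+ s * f x).
Proof.
move=> W L0 L1'.
suff H s : L1 J (fun x => rr x ^+ s * f x) /\ L1 J (fun x => rr x ^+ s.+1 * f x).
  by move=> s; case: (H s).
elim: s => [|s [IH1 IH2]].
  split; first by apply: L1_ext L0 => [|x _]; [exact: mJ|rewrite expr0 mul1r].
  by apply: L1_ext L1' => [|x _]; [exact: mJ|rewrite expr1].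
split=> //.
have B0 := pw_B W.
have mf := contJ_meas (pw_cont W).
have mr t : measurable_fun J (fun x => rr x ^+ t) by exact: contJ_meas (@contJ_rrX _ a w t).
have mq : measurable_fun J (fun x => q.[x]) := contJ_meas (@contJ_poly _ a w q).
have AK : ACD a w (fun x => l.[x]) (fun=> B).
  have d x : J x -> is_derive x 1 (fun y => l.[y]) B.
    move=> _; have -> : B = (l^`()).[x].
      by rewrite (pw_lp W) derivZ derivXsubC hornerZ hornerC mulr1.
    exact: isD_poly.
  apply: ACD_C1 d _; move=> x _; exact: cst_continuous.
have Lq : L1 J (fun x => q.[x] * rr x ^+ s * B * f x).
  apply: (L1_dom (k := fun x => Cq * B * (rr x ^+ s.+1 * f x))) => //.
  - exact: mJ.
  - apply: measurable_funM => //; apply: measurable_funM => //; exact: measurable_funM.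
  - move=> x Jx; have f0 := ltW (pw_pos W Jx); have q0 := ltW (pw_q W Jx).
    have r0 := ltW (rrX_gt0 s x); have B0' := ltW B0.
    rewrite ger0_norm ?mulr_ge0 //.
    have -> : Cq * B * (rr x ^+ s.+1 * f x) = Cq * rr x * rr x ^+ s * B * f x.
      by rewrite exprS; ring.
    by do 3 (apply: ler_wpM2r => //); exact: qC.
  - exact: L1Z mJ IH2.
have LK := weighted_L1_step W IH1 AK (fun _ _ => ltW B0) _ _ Lq.
have {}LK : L1 J (fun x => rr x ^+ s.+1 * `|l.[x]| * f x).
  apply: LK; last by rewrite (pw_l W) subrr mulr0.
  by move=> x _; rewrite -expr2 sqr_ge0.
apply: (L1_dom (k := fun x => (1 + `|m|) * (rr x ^+ s.+1 * f x) +
    B^-1 * (rr x ^+ s.+1 * `|l.[x]| * f x))).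
- exact: mJ.
- exact: measurable_funM.
- move=> x Jx; have f0 := ltW (pw_pos W Jx).
  have r0 := ltW (rrX_gt0 s.+1 x); have r1 := ltW (rr_gt0 x).
  rewrite ger0_norm ?mulr_ge0 // exprS.
  have -> : (1 + `|m|) * (rr x ^+ s.+1 * f x) + B^-1 * (rr x ^+ s.+1 * `|l.[x]| * f x) =
     (1 + `|m| + B^-1 * `|l.[x]|) * rr x ^+ s.+1 * f x by ring.
  do 2 (apply: ler_wpM2r => //); rewrite (pw_l W) normrM (gtr0_norm B0).
  rewrite mulKf ?gt_eqF //.
  by have := rr_le x; have := ler_normD (x - m) m; rewrite subrK; lra.
- by apply: L1D => //; [exact: mJ|exact: L1Z mJ _|exact: L1Z mJ _].
Qed.

Record PW f l B m : Prop := {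
  pw0 :> PW0 a w q f l B m;
  pw_mom : forall s, L1 J (fun x => rr x ^+ s * f x) }.

Lemma L1_poly f l B m (p : {poly R}) : PW f l B m -> L1 J (fun x => p.[x] * f x).
Proof.
move=> W; have [C C0 HC] := horner_growth p.
apply: (L1_dom (k := fun x => C * (rr x ^+ (size p).-1 * f x))).
- exact: mJ.
- by apply: measurable_funM; apply: contJ_meas; [exact: contJ_poly|exact: pw_cont W].
- move=> x Jx; have f0 := ltW (pw_pos W Jx).
  by rewrite normrM (ger0_norm f0) mulrA; apply: ler_wpM2r.
- exact: L1Z mJ (pw_mom W _).
Qed.

Lemma L1_rr_poly f l B m (p : {poly R}) s : PW f l B m ->
  L1 J (fun x => rr x ^+ s * (p.[x] * f x)).
Proof.
move=> W; have [C C0 HC] := horner_growth p.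
apply: (L1_dom (k := fun x => C * (rr x ^+ (s + (size p).-1) * f x))).
- exact: mJ.
- apply: measurable_funM; first exact: contJ_meas (@contJ_rrX _ a w s).
  by apply: measurable_funM; apply: contJ_meas; [exact: contJ_poly|exact: pw_cont W].
- move=> x Jx; have f0 := ltW (pw_pos W Jx).
  rewrite !normrM (ger0_norm f0) (ger0_norm (ltW (rrX_gt0 _ _))) exprD.
  have -> : C * (rr x ^+ s * rr x ^+ (size p).-1 * f x) =
    rr x ^+ s * (C * rr x ^+ (size p).-1 * f x) by ring.
  by apply: ler_wpM2l; [exact: ltW (rrX_gt0 _ _)|apply: ler_wpM2r].
- exact: L1Z mJ (pw_mom W _).
Qed.

(** (q (q f))' = q' q f - q l f = - (l - q') q f, and the slope B - D of l - q' is positive because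
    D <= 0. *)
Lemma PW_next f l B m (D E : R) : q^`() = D *: 'X + E%:P -> D <= 0 -> PW f l B m ->
  exists m', PW (fun x => q.[x] * f x) (l - q^`()) (B - D) m'.
Proof.
move=> qDE D0 W; have B0 := pw_B W.
have B'0 : 0 < B - D by lra.
pose m' := (B * m + E) / (B - D); exists m'.
have l'E : l - q^`() = (B - D) *: ('X - m'%:P).
  rewrite (pw_lp W) qDE; apply/polyP => i.
  rewrite !(coefB, coefN, coefD, coefZ, coefX, coefC).
  have e : (B - D) * m' = B * m + E by rewrite /m' mulrC divfK ?gt_eqF.
  by case: i => [|[|i]] /=; lra.
have dP1 x : J x -> is_derive x 1 (fun y => q.[y] * (q.[y] * f y))
    (- ((l - q^`()).[x] * (q.[x] * f x))).
  move=> Jx; have := isD_M (isD_poly q x) (pw_der W Jx).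
  by congr is_derive; rewrite hornerD hornerN; ring.
have cP1 : contJ a w (fun x => - ((l - q^`()).[x] * (q.[x] * f x))).
  have c := contJ_M (@contJ_poly _ a w (-1)%:P) (contJ_M (@contJ_poly _ a w (l - q^`()))
     (contJ_M (@contJ_poly _ a w q) (pw_cont W))).
  by apply: contJ_ext c => x _; rewrite hornerC mulN1r.
have AP1 := ACD_C1 dP1 cP1.
(* Written as P u with u = q, the function q (q f) is a boundary term at the level of f, so [vanish]
   gives its limits at the ends. *)
have AP2 : ACD a w (fun x => q.[x] * f x * q.[x]) (fun x => - ((l - q^`()).[x] * (q.[x] * f x))).
  by apply: ACD_ext AP1 => // x; rewrite mulrC.
have ends e : 0 < e -> evJ a w (fun x y => q.[x] * (q.[x] * f x) <= e /\ q.[y] * (q.[y] * f y) <= e).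
  move=> e0.
  have L1a : L1 J (fun x => - ((l - q^`()).[x] * (q.[x] * f x))).
    apply: L1_ext (L1_poly (- ((l - q^`()) * q)) W) => [|x _]; first exact: mJ.
    by rewrite hornerN hornerM; ring.
  have L1b : L1 J (fun x => l.[x] * q.[x] * f x).
    apply: L1_ext (L1_poly (l * q) W) => [|x _]; first exact: mJ.
    by rewrite hornerM.
  apply: evJ_impl (vanish W AP2 L1a L1b e0) => x y Jx Jy _ [h1 h2].
  by rewrite ![q.[_] * (_ * _)]mulrC; split; apply: le_trans (ler_norm _) _.
have P1pos x : J x -> 0 < q.[x] * (q.[x] * f x).
  by move=> Jx; rewrite mulr_gt0 ?(pw_q W) // (pw_P_gt0 W).
have l'x x : (l - q^`()).[x] = (B - D) * (x - m') by rewrite l'E hornerZ hornerXsubC.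
have Jm := pw_m W.
(* If m' lay outside J, then q (q f) would be monotone on J while tending to 0 at both ends,
   contradicting its positive value at m. *)
have Jm' : J m'.
  apply: contrapT => nJ.
  have e0 : 0 < q.[m] * (q.[m] * f m) / 2 by rewrite divr_gt0 ?P1pos.
  have [x [y [Jx Jy xy [[xm my] [h1 h2]]]]] := evJ_ex (evJ_and (evJ_in Jm Jm) (ends _ e0)).
  have P0 := P1pos _ Jm.
  have [m'm|mm'] := leP m' m.
    have above z : J z -> m' <= z.
      move=> Jz; rewrite leNgt; apply/negP => zm; apply: nJ; exact: Jconv Jz Jm (ltW zm) m'm.
    have := ACD_FTC AP1 Jx Jm xm.
    suff : 0 <= itg `[x, m] (fun z => - - ((l - q^`()).[z] * (q.[z] * f z))).
      by rewrite itgN //; [lra|case: AP1 => _ _ _; apply].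
    apply: itg_ge0 => z zxy; have Jz := Jseg Jx Jm zxy; rewrite opprK l'x.
    by apply: mulr_ge0; [apply: mulr_ge0; [exact: ltW|rewrite subr_ge0 above]|exact: ltW (pw_P_gt0 W Jz)].
  have below z : J z -> z <= m'.
    move=> Jz; rewrite leNgt; apply/negP => zm; apply: nJ; exact: Jconv Jm Jz (ltW mm') (ltW zm).
  have := ACD_FTC AP1 Jm Jy my.
  suff : 0 <= itg `[m, y] (fun z => - ((l - q^`()).[z] * (q.[z] * f z))) by lra.
  apply: itg_ge0 => z zxy; have Jz := Jseg Jm Jy zxy; rewrite l'x oppr_ge0.
  apply: mulr_le0_ge0; last exact: ltW (pw_P_gt0 W Jz).
  by apply: mulr_ge0_le0; [exact: ltW|rewrite subr_le0 below].
split; first split=> //.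
- exact: pw_q W.
- by move=> x Jx; exact (pw_P_gt0 W Jx).
- by apply: contJ_M (pw_cont W); exact: contJ_poly.
- by move=> s; exact: L1_rr_poly W.
Qed.

End Chain.

(** * The Cauchy-Schwarz inequality *)

Section CauchySchwarz.
Context {R : realType}.
Implicit Types (D : set R) (al be ga : R -> R).

Lemma discr_le (A B C : R) : 0 <= C -> (forall t, 0 <= A - 2 * t * B + t ^+ 2 * C) ->
  B ^+ 2 <= A * C.
Proof.
move=> C0 H; have [C00|nC] := eqVneq C 0.
  rewrite C00 mulr0 in H *; have [->|nB] := eqVneq B 0; first by rewrite expr0n.
  have := H ((A + 1) / (2 * B)); suff -> : 2 * ((A + 1) / (2 * B)) * B = A + 1 by rewrite mulr0; lra.
  by field.
have {nC}C0 : 0 < C by rewrite lt_neqAle eq_sym nC.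
have := H (B / C); have -> : A - 2 * (B / C) * B + (B / C) ^+ 2 * C = (A * C - B ^+ 2) / C.
  by field; rewrite gt_eqF.
by rewrite pmulr_lge0 ?invr_gt0 // subr_ge0.
Qed.

(** The hypothesis is a pointwise nonnegative quadratic in t rather than a product of two functions,
    so that the weight may be distributed freely among the three integrands. *)
Lemma CS D al be ga : measurable D -> L1 D al -> L1 D be -> L1 D ga ->
  (forall x, D x -> 0 <= ga x) ->
  (forall x t, D x -> 0 <= al x - 2 * t * be x + t ^+ 2 * ga x) ->
  (itg D be) ^+ 2 <= itg D al * itg D ga.
Proof.
move=> mD La Lb Lc g0 H; apply: discr_le; first exact: itg_ge0.
move=> t; rewrite -(itgZ (t ^+ 2)) // -(itgZ (2 * t)) // -itgB //; last exact: L1Z.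
rewrite -itgD //; [|apply: L1B => //; exact: L1Z|exact: L1Z].
by apply: itg_ge0 => x Dx; exact: H.
Qed.

Lemma CS_seg (x y : R) (h : R -> R) : x <= y -> L1 `[x, y] h ->
  L1 `[x, y] (fun t => h t ^+ 2) ->
  (itg `[x, y] h) ^+ 2 <= (y - x) * itg `[x, y] (fun t => h t ^+ 2).
Proof.
move=> xy Lh Lh2; rewrite mulrC.
have -> : y - x = itg `[x, y] (fun=> 1) by rewrite itg_seg_cst // mul1r.
apply: CS => //; first exact: L1_seg_cst.
by move=> t s _; rewrite [leRHS](_ : _ = (h t - s) ^+ 2); [exact: sqr_ge0|ring].
Qed.

End CauchySchwarz.

(** * Integration by parts and descent of integrability by one level *)

Section Chain2.
Context {R : realType} (a w : \bar R) (q : {poly R}) (Cq : R).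
Local Notation J := (Jset a w).
Hypothesis qC : forall x, J x -> q.[x] <= Cq * rr x.
Implicit Types (f g h k u K H : R -> R) (l p : {poly R}) (B m : R).

Lemma L1_mulL2 f h k : measurable_fun J f -> measurable_fun J h -> measurable_fun J k ->
  (forall x, J x -> 0 <= f x) ->
  L1 J (fun x => h x ^+ 2 * f x) -> L1 J (fun x => k x ^+ 2 * f x) ->
  L1 J (fun x => h x * k x * f x).
Proof.
move=> mf mh mk f0 Lh Lk.
apply: (L1_dom (k := fun x => h x ^+ 2 * f x + k x ^+ 2 * f x)).
- exact: mJ.
- by apply: measurable_funM => //; exact: measurable_funM.
- move=> x Jx; rewrite normrM (ger0_norm (f0 x Jx)) -mulrDl.
  apply: ler_wpM2r; first exact: f0.
  rewrite normrM -(real_normK (num_real (h x))) -(real_normK (num_real (k x))).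
  have := sqr_ge0 (`|h x| - `|k x|); have := mulr_ge0 (normr_ge0 (h x)) (normr_ge0 (k x)).
  rewrite sqrrB mulr2n; lra.
- exact: (L1D mJ Lh Lk).
Qed.

Lemma L1_mulL2_poly f l B m h p : PW a w q f l B m -> measurable_fun J h ->
  L1 J (fun x => h x ^+ 2 * f x) -> L1 J (fun x => h x * p.[x] * f x).
Proof.
move=> W mh Lh; apply: L1_mulL2 => //.
- exact: contJ_meas (pw_cont W).
- exact: contJ_meas (@contJ_poly _ a w p).
- by move=> x Jx; exact: ltW (pw_pos W Jx).
- apply: L1_ext (L1_poly (p ^+ 2) W) => [|x _]; first exact: mJ.
  by rewrite horner_exp.
Qed.

(** p |-> l p - q p' is adjoint to differentiation between the weights f and q f. The boundary term
    q f u p is removed by [itg_vanish], applied to u p. *)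
Lemma ibp f l B m u du p : PW0 a w q f l B m -> ACD a w u du ->
  L1 J (fun x => u x * (l * p - q * p^`()).[x] * f x) ->
  L1 J (fun x => u x * (l * p).[x] * f x) ->
  L1 J (fun x => du x * p.[x] * (q.[x] * f x)) ->
  itg J (fun x => u x * (l * p - q * p^`()).[x] * f x) =
  itg J (fun x => du x * p.[x] * (q.[x] * f x)).
Proof.
move=> W Au L1a L1b L1c.
have AF := ACD_M (ACD_P W) (ACD_M Au (ACD_poly a w p)).
have Lphi : L1 J (fun x => du x * p.[x] * (q.[x] * f x) -
    u x * (l * p - q * p^`()).[x] * f x) by exact: (L1B mJ).
have AF' : ACD a w (fun x => q.[x] * f x * (u x * p.[x])) (fun x => du x * p.[x] * (q.[x] * f x) -
    u x * (l * p - q * p^`()).[x] * f x).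
  by apply: ACD_ext AF => // x Jx; rewrite hornerD hornerN !hornerM; ring.
have Lg : L1 J (fun x => l.[x] * (u x * p.[x]) * f x).
  by apply: L1_ext L1b => [|x _]; [exact: mJ|rewrite hornerM; ring].
have := itg_vanish W AF' Lphi Lg; rewrite (itgB mJ L1c L1a) => /eqP.
by rewrite subr_eq0 => /eqP.
Qed.

(** A primitive from m of a nonnegative function has the sign of x - m, hence of l: this is the sign
    condition of [weighted_L1_step]. *)
Lemma lprim_ge0 f l B m H x : PW0 a w q f l B m -> Lloc a w H ->
  (forall y, J y -> 0 <= H y) -> J x -> 0 <= l.[x] * prim m H x.
Proof.
move=> W LH H0 Jx; have Jm := pw_m W; rewrite (pw_l W) /prim.
have [mx|xm] := leP m x.
  apply: mulr_ge0; first by rewrite mulr_ge0 ?subr_ge0 // ltW // (pw_B W).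
  by apply: itg_ge0 => z /(Jseg Jm Jx)/H0.
rewrite mulrN -mulNr -mulrN opprB; apply: mulr_ge0.
  by rewrite mulr_ge0 ?subr_ge0 ?(ltW xm) // ltW // (pw_B W).
by apply: itg_ge0 => z /(Jseg Jx Jm)/H0.
Qed.

Lemma prim0 (m : R) H : prim m H m = 0.
Proof. by rewrite /prim lexx itg_seg1. Qed.

(** |u| is at most |u m| + |K| for K the primitive of |du| from m, to which [weighted_L1_step]
    applies. Going down one level gains one power of [rr]. *)
Lemma chain_L1 f l B m u du s : PW a w q f l B m -> ACD a w u du ->
  L1 J (fun x => rr x ^+ s * `|du x| * (q.[x] * f x)) ->
  L1 J (fun x => rr x ^+ s.+1 * `|u x| * f x).
Proof.
move=> W Au LH; have Jm := pw_m W; have [_ _ mdu Ldu] := Au.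
have cu := ACD_cont Au.
have mH : measurable_fun J (fun x => `|du x|) by exact: measurableT_comp.
have LlH : Lloc a w (fun x => `|du x|) by move=> x y Jx Jy; exact: L1_norm (Ldu _ _ Jx Jy).
pose K := prim m (fun x => `|du x|).
have AK : ACD a w K _ := ACD_prim Jm mH LlH.
have LH' : L1 J (fun x => q.[x] * rr x ^+ s * `|du x| * f x).
  by apply: L1_ext LH => [|x _]; [exact: mJ|ring].
have LK := weighted_L1_step qC W (pw_mom W s) AK (fun x _ => normr_ge0 (du x))
  (fun x Jx => lprim_ge0 W LlH (fun y _ => normr_ge0 (du y)) Jx) (prim0 _ _) LH'.
have ub x : J x -> `|u x| <= `|u m| + `|K x|.
  move=> Jx; rewrite /K /prim; have [mx|xm] := leP m x.
    have := ACD_FTC Au Jm Jx mx; have := itg_norm (mseg m x) (Ldu _ _ Jm Jx).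
    move=> h1 h2; rewrite h2 in h1.
    have := ler_normD (u x - u m) (u m); rewrite subrK.
    have := ler_norm (itg `[m, x] (fun x => `|du x|)); lra.
  have := ACD_FTC Au Jx Jm (ltW xm); have := itg_norm (mseg x m) (Ldu _ _ Jx Jm).
  move=> h1 h2; rewrite h2 in h1.
  have := ler_normB (u m) (u m - u x); rewrite opprB addrC subrK normrN.
  have := ler_norm (itg `[x, m] (fun x => `|du x|)); lra.
apply: (L1_dom (k := fun x => `|u m| * (rr x ^+ s.+1 * f x) +
  rr x ^+ s.+1 * `|K x| * f x)).
- exact: mJ.
- have cn : contJ a w (fun x => `|u x|).
    by move=> x Jx; apply: continuous_comp; [exact: cu|exact: norm_continuous].
  by apply: contJ_meas; apply: contJ_M (pw_cont W); apply: contJ_M cn; exact: contJ_rrX.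
- move=> x Jx; have f0 := ltW (pw_pos W Jx); have r0 := ltW (rrX_gt0 s.+1 x).
  rewrite (@ger0_norm _ (rr x ^+ s.+1 * `|u x| * f x)) ?mulr_ge0 //.
  rewrite [leRHS](_ : _ = rr x ^+ s.+1 * (`|u m| + `|K x|) * f x); last by ring.
  by apply: ler_wpM2r => //; apply: ler_wpM2l => //; exact: ub.
- by apply: (L1D mJ) LK; exact: (L1Z _ mJ (pw_mom W s.+1)).
Qed.

(** With K the primitive of du^2 from m, Cauchy-Schwarz gives (u x - u m)^2 <= |x - m| |K x|. The
    power of [rr] gained by [weighted_L1_step] at s = 0 compensates the factor |x - m|. *)
Lemma chain_L2 f l B m u du : PW a w q f l B m -> ACD a w u du ->
  L1 J (fun x => du x ^+ 2 * (q.[x] * f x)) ->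
  L1 J (fun x => u x ^+ 2 * f x).
Proof.
move=> W Au LH; have Jm := pw_m W; have [_ _ mdu Ldu] := Au.
have cu := ACD_cont Au; have cf := pw_cont W.
have cP : contJ a w (fun x => q.[x] * f x) by apply: contJ_M cf; exact: contJ_poly.
have P0 x : J x -> q.[x] * f x != 0 by move=> Jx; rewrite gt_eqF // (pw_P_gt0 W).
have mH : measurable_fun J (fun x => du x ^+ 2) by exact: measurable_funX.
have LlH : Lloc a w (fun x => du x ^+ 2).
  have L x y : J x -> J y -> L1 `[x, y] (fun x => du x ^+ 2 * (q.[x] * f x)).
    by move=> Jx Jy; apply: L1_sub LH => //; [exact: mJ|exact: Jseg].
  move=> x y Jx Jy.
  apply: L1_ext (Lloc_contM (contJ_V P0 cP) (L1_meas LH) L Jx Jy) => // z zxy.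
  by rewrite mulrC mulfK // P0 //; exact: Jseg zxy.
pose K := prim m (fun x => du x ^+ 2).
have AK : ACD a w K _ := ACD_prim Jm mH LlH.
have LH' : L1 J (fun x => q.[x] * rr x ^+ 0 * du x ^+ 2 * f x).
  by apply: L1_ext LH => [|x _]; [exact: mJ|rewrite expr0; ring].
have LK := weighted_L1_step qC W (pw_mom W 0) AK (fun x _ => sqr_ge0 (du x))
  (fun x Jx => lprim_ge0 W LlH (fun y _ => sqr_ge0 (du y)) Jx) (prim0 _ _) LH'.
have ub x : J x -> (u x - u m) ^+ 2 <= `|x - m| * `|K x|.
  move=> Jx; rewrite /K /prim; have [mx|xm] := leP m x.
    rewrite -(ACD_FTC Au Jm Jx mx) (@ger0_norm _ (x - m)) ?subr_ge0 //.
    apply: le_trans (CS_seg mx (Ldu _ _ Jm Jx) (LlH _ _ Jm Jx)) _.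
    by apply: ler_wpM2l; [rewrite subr_ge0|exact: ler_norm].
  have -> : (u x - u m) ^+ 2 = (u m - u x) ^+ 2 by ring.
  rewrite -(ACD_FTC Au Jx Jm (ltW xm)) normrN (distrC x m) (@ger0_norm _ (m - x)) ?subr_ge0 ?(ltW xm) //.
  apply: le_trans (CS_seg (ltW xm) (Ldu _ _ Jx Jm) (LlH _ _ Jx Jm)) _.
  by apply: ler_wpM2l; [rewrite subr_ge0 ltW|exact: ler_norm].
apply: (L1_dom (k := fun x => 2 * (u m) ^+ 2 * (rr x ^+ 0 * f x) +
  2 * (1 + `|m|) * (rr x ^+ 1 * `|K x| * f x))).
- exact: mJ.
- by apply: contJ_meas; apply: contJ_M cf; exact: contJ_X.
- move=> x Jx; have f0 := ltW (pw_pos W Jx); have r0 := rr_ge1 x.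
  have h0 : 0 <= u x ^+ 2 * f x by apply: mulr_ge0 => //; exact: sqr_ge0.
  rewrite (ger0_norm h0).
  rewrite [leRHS](_ : _ = (2 * (u m) ^+ 2 + 2 * ((1 + `|m|) * rr x * `|K x|)) * f x); last first.
    by rewrite ?expr0 ?expr1; ring.
  apply: ler_wpM2r => //.
  have h1 : `|x - m| * `|K x| <= (1 + `|m|) * rr x * `|K x|.
    apply: ler_wpM2r => //; have := ler_normB x m; have := rr_ge_norm x.
    have := mulr_ge0 (normr_ge0 m) (_ : 0 <= rr x - 1); rewrite subr_ge0 => /(_ r0).
    by rewrite mulrBr mulrDl mul1r mulr1; lra.
  (* The square yields u^2 <= 2 (u - u m)^2 + 2 (u m)^2. *)
  have := ub x Jx; have := sqr_ge0 (u x - 2 * u m).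
  have -> : (u x - 2 * u m) ^+ 2 = 2 * (u x - u m) ^+ 2 - u x ^+ 2 + 2 * u m ^+ 2 by ring.
  lra.
- exact (L1D mJ (L1Z _ mJ (pw_mom W 0)) (L1Z _ mJ LK)).
Qed.

End Chain2.

(** * Poincaré inequality *)

Section RodriguesPoly.
Context {R : realType} (q : {poly R}).
Implicit Types (l : {poly R}) (B D : R).

(* The Rodrigues polynomials of the weight f: PP k l = (-1)^k (q^k f)^(k) / f. *)
Fixpoint PP (k : nat) (l : {poly R}) : {poly R} :=
  if k is k'.+1 then l * PP k' (l - q^`()) - q * (PP k' (l - q^`()))^`() else 1.

(** Minus the eigenvalue of y |-> q y'' - l y' on polynomials of degree k, where l' = B and q'' =
    D. *)
Definition Lam B D (k : nat) : R := k%:R * B - 'C(k, 2)%:R * D.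

Lemma LamS B D k : Lam B D k.+1 = B + Lam (B - D) D k.
Proof. by rewrite /Lam binS bin1 natrD mulrSr; ring. Qed.

Lemma Lam_gt0 B D k : 0 < B -> D <= 0 -> 0 < Lam B D k.+1.
Proof.
move=> B0 D0; rewrite /Lam; apply: ltr_wpDr; last by rewrite mulr_gt0.
by rewrite -mulrN mulr_ge0 // oppr_ge0.
Qed.

(** With p = [PP k.+1 (l - q')], the derivative of l p - q p' is B p + (l - q') p' - q p''. By
    induction p' is L times a polynomial s for which (l - q') s - q s' = p, so the total is (B + L)
    p. *)
Lemma deriv_PP D l B k : q^`()^`() = D%:P -> l^`() = B%:P ->
  (PP k.+1 l)^`() = Lam B D k.+1 *: PP k (l - q^`()).
Proof.
move=> qD; elim: k l B => [|k IH] l B lB.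
  rewrite /= mulr1 derivC mulr0 subr0 lB /Lam mul1r mul0r subr0.
  by rewrite alg_polyC.
have l'B : (l - q^`())^`() = (B - D)%:P by rewrite derivB lB qD polyCB.
rewrite LamS; have IHk := IH _ _ l'B.
have E2 : PP k.+2 l = l * PP k.+1 (l - q^`()) - q * (PP k.+1 (l - q^`()))^`() by [].
have E1 : PP k.+1 (l - q^`()) = (l - q^`()) * PP k (l - q^`() - q^`()) -
  q * (PP k (l - q^`() - q^`()))^`() by [].
move: E1 E2 IHk.
move: (Lam (B - D) D k.+1) (PP k.+2 l) (PP k.+1 (l - q^`())) (PP k (l - q^`() - q^`())) => L r p s E1 -> IHk.
rewrite derivB !derivM lB IHk derivZ scalerDl -!mul_polyC.
transitivity (B%:P * p + L%:P * ((l - q^`()) * s - q * s^`())).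
  by ring.
by rewrite -E1.
Qed.

End RodriguesPoly.

(** * The equation h = l v - q v' for a centred function h *)

Section Adjoint.
Context {R : realType} (a w : \bar R) (q : {poly R}).
Local Notation J := (Jset a w).
Variables (f : R -> R) (l : {poly R}) (B m : R) (h dh : R -> R).
Hypothesis W : PW a w q f l B m.
Hypothesis Ah : ACD a w h dh.
Hypothesis Lh2 : L1 J (fun x => h x ^+ 2 * f x).
Hypothesis h_centred : itg J (fun x => h x * f x) = 0.
Local Notation P x := (q.[x] * f x).

Let Jm : J m := pw_m W.
Let J0 : J !=set0. Proof. by exists m. Qed.
Let ch : contJ a w h := ACD_cont Ah.
Let cf : contJ a w f := pw_cont W.
Let P0 x : J x -> 0 < P x. Proof. by move=> Jx; exact (pw_P_gt0 W Jx). Qed.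
Let f0 x : J x -> 0 < f x. Proof. by move=> Jx; exact (pw_pos W Jx). Qed.
Let chf : contJ a w (fun x => h x * f x). Proof. exact: contJ_M. Qed.
Let Lhf : L1 J (fun x => h x * f x).
Proof.
apply: L1_ext (L1_mulL2_poly 1 W (contJ_meas ch) Lh2) => [|x _]; first exact: mJ.
by rewrite hornerC mulr1.
Qed.
Let Lf : L1 J f.
Proof. by apply: L1_ext (L1_poly 1 W) => [|x _]; [exact: mJ|rewrite hornerC mul1r]. Qed.
Let Lloc_hf : Lloc a w (fun x => h x * f x).
Proof. by move=> x y Jx Jy; exact: contJ_L1 chf Jx Jy. Qed.
Let ch2f : contJ a w (fun x => h x ^+ 2 * f x).
Proof. by apply: contJ_M cf; exact: contJ_X. Qed.

(** The constant that makes [Vf] tend to 0 at the left end. *)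
Definition tailint := itg (J `&` [set z | z <= m]) (fun x => h x * f x).

(* V x is the integral of h f over ]x, w[, and also minus the integral over ]a, x[. *)
Definition Vf x := -1 * (prim m (fun x => h x * f x) x + tailint).
(** The solution v of l v - q v' = h, equivalently (q f v)' = - h f, whose boundary values q f v are
    0. *)
Definition vf x := Vf x * (P x)^-1.
Definition dvf x := -1 * (h x * f x + 0) * (P x)^-1 + Vf x * (l.[x] * f x / P x ^+ 2).

Lemma ACD_Vf : ACD a w Vf (fun x => -1 * (h x * f x + 0)).
Proof. exact: ACD_Z (ACD_D (ACD_prim Jm (contJ_meas chf) Lloc_hf) (ACD_cst _ _ _)). Qed.

Lemma ACD_vf : ACD a w vf dvf.
Proof.
apply: ACD_M ACD_Vf _; apply: ACD_C1 => [x Jx|].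
  have := isD_V _ (pw_der W Jx); rewrite opprK; apply.
  by rewrite gt_eqF ?P0.
have cP : contJ a w (fun x => P x) by apply: contJ_M cf; exact: contJ_poly.
apply: contJ_M; first by apply: contJ_M cf; exact: contJ_poly.
apply: contJ_V; last exact: contJ_X.
by move=> x Jx; rewrite expf_neq0 // gt_eqF ?P0.
Qed.

Lemma q_dvf x : J x -> q.[x] * dvf x = l.[x] * vf x - h x.
Proof.
move=> Jx; rewrite /dvf /vf; field.
by rewrite !gt_eqF ?f0 ?(pw_q W).
Qed.

Lemma Vf_vf x : J x -> Vf x = P x * vf x.
Proof. by move=> Jx; rewrite /vf mulrC divfK // gt_eqF ?P0. Qed.

Lemma contJ_dvf : contJ a w dvf.
Proof.
have cq := @contJ_poly _ a w q; have cl := @contJ_poly _ a w l.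
have cv : contJ a w vf := ACD_cont ACD_vf.
have c : contJ a w (fun x => (q.[x])^-1 * (l.[x] * vf x - h x)).
  apply: contJ_M; last by apply: contJ_B ch; exact: contJ_M.
  by apply: contJ_V cq => x Jx; rewrite gt_eqF ?(pw_q W).
apply: contJ_ext c => x Jx; rewrite -(q_dvf Jx) mulKf // gt_eqF ?(pw_q W) //.
Qed.

(** At the left end this is the choice of [tailint]; at the right end it is the centring of h. *)
Lemma Vf_end e : 0 < e -> evJ a w (fun x y => `|Vf x| <= e /\ `|Vf y| <= e).
Proof.
move=> e0; have e2 : 0 < e / 2 by rewrite divr_gt0.
have := evJ_and (evJ_in Jm Jm) (evJ_and (L1_tail J0 Lhf e2) (L1_tail_diff J0 Lhf e2)).
apply: evJ_impl => x y Jx Jy xy [[xm my] [T1 T2]].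
have mA : measurable (J `&` [set z | z <= m]).
  apply: measurableI; first exact: mJ.
  rewrite (_ : [set z | z <= m] = `]-oo, m]%classic); first exact: measurable_itv.
  by apply/seteqP; split=> z; rewrite /= in_itv.
have LA : L1 (J `&` [set z | z <= m]) (fun x => h x * f x) by exact: (L1_sub mJ mA (@subIsetl _ _ _) Lhf).
have sA : `[x, m] `<=` J `&` [set z | z <= m].
  move=> z zxm; split; first exact: Jseg zxm.
  by move: zxm; rewrite /= in_itv /= => /andP[].
have mD : measurable (J `\` `[x, y]) by apply: measurableD => //; exact: mJ.
have mAD : measurable ((J `&` [set z | z <= m]) `\` `[x, m]) by apply: measurableD.
have Vx : `|Vf x| <= e / 2.
  have -> : Vf x = - itg ((J `&` [set z | z <= m]) `\` `[x, m]) (fun x => h x * f x).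
    rewrite /Vf mulN1r; congr (- _); rewrite /tailint (itg_setD mA (mseg x m) sA LA).
    rewrite addrA (_ : prim m _ x = - itg `[x, m] (fun x => h x * f x)) ?addNr ?add0r //.
    rewrite /prim; have [mx|//] := leP m x.
    have -> : x = m by lra.
    by rewrite !itg_seg1 oppr0.
  rewrite normrN; apply: le_trans (ltW T1).
  apply: le_trans (itg_norm mAD _) _; first exact: (L1_sub mA mAD (@subDsetl _ _ _) LA).
  apply: itg_subset => //; last first.
    by apply: L1_norm; exact: (L1_sub mJ mD (@subDsetl _ _ _) Lhf).
  move=> z [[Jz zm] nz]; split=> // zxy; apply: nz; move: zxy zm.
  by rewrite /= !in_itv /= => /andP[-> _] ->.
split; first lra.
have := ACD_FTC ACD_Vf Jx Jy xy.
rewrite (@itg_ext _ _ _ (fun x => - (h x * f x))); last by move=> z _; rewrite addr0 mulN1r.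
rewrite itgN //; last exact: Lloc_hf.
move=> E; have -> : Vf y = Vf x - itg `[x, y] (fun x => h x * f x) by lra.
apply: le_trans (ler_normB _ _) _.
move: T2; rewrite h_centred sub0r normrN; lra.
Qed.

Lemma Vf_incr s t : J s -> J t -> s <= t ->
  (Vf t - Vf s) ^+ 2 <= itg `[s, t] (fun x => h x ^+ 2 * f x) * itg `[s, t] f.
Proof.
move=> Js Jt st; rewrite -(ACD_FTC ACD_Vf Js Jt st).
apply: CS => //.
- exact: contJ_L1 ch2f Js Jt.
- by case: ACD_Vf => _ _ _; apply.
- exact: contJ_L1 cf Js Jt.
- by move=> x /(Jseg Js Jt)/f0/ltW.
- move=> x u /(Jseg Js Jt)/f0/ltW fx.
  rewrite [leRHS](_ : _ = (h x + u) ^+ 2 * f x); last by ring.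
  by apply: mulr_ge0 => //; exact: sqr_ge0.
Qed.

(** Passage to the limit V z -> 0 in ka (V y - V z)^2 <= e, in epsilon form. *)
Lemma Vf_bound (ka e y : R) : 0 <= ka -> J y ->
  (forall eta, 0 < eta -> exists z, `|Vf z| <= eta /\ ka * (Vf y - Vf z) ^+ 2 <= e) ->
  ka * Vf y ^+ 2 <= e.
Proof.
move=> k0 Jy H; rewrite leNgt; apply/negP => lt.
set d := ka * Vf y ^+ 2 - e; have d0 : 0 < d by rewrite subr_gt0.
have c0 : 0 < 2 * ka * `|Vf y| + 1 by rewrite ltr_wpDl // !mulr_ge0.
have [z [z1 z2]] := H _ (divr_gt0 d0 c0).
have h1 : ka * Vf y ^+ 2 - 2 * ka * `|Vf y| * `|Vf z| <= ka * (Vf y - Vf z) ^+ 2.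
  have := mulr_ge0 k0 (sqr_ge0 (Vf z)).
  have : Vf y * Vf z <= `|Vf y| * `|Vf z| by rewrite -normrM ler_norm.
  move/(ler_wpM2l k0); rewrite sqrrB mulr2n; lra.
have k1 : 0 <= 2 * ka * `|Vf y| by rewrite !mulr_ge0.
have h2 := ler_wpM2l k1 z1.
have h3 : 2 * ka * `|Vf y| * (d / (2 * ka * `|Vf y| + 1)) < d.
  rewrite mulrA ltr_pdivrMr // [ltLHS]mulrC mulrDr mulr1; lra.
by move: d0 h3 h2; rewrite /d; lra.
Qed.

(** The boundary term l V^2 / P of the energy identity [itg_gf_seg]. *)
Definition Qf x := l.[x] * (Vf x * vf x).

(** Cauchy-Schwarz bounds (V y - V z)^2 by the integrals of h^2 f and of f over [y, z]. As l
    increases, l(y) times the latter is at most the integral of l f, which is P y - P z <= P y. Then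
    z goes to the right end. *)
Lemma Qf_right e y : J y -> m <= y ->
  (forall z, J z -> y <= z -> itg `[y, z] (fun x => h x ^+ 2 * f x) <= e) -> Qf y <= e.
Proof.
move=> Jy my He; have Py := P0 Jy.
have ly : 0 <= l.[y] by rewrite (pw_l W) mulr_ge0 ?subr_ge0 // ltW ?(pw_B W).
rewrite /Qf /vf [leLHS](_ : _ = l.[y] * Vf y ^+ 2 / P y) ?ler_pdivrMr //; last by ring.
apply: Vf_bound => // eta eta0.
have [_ [z [_ Jz _ [[_ yz] [_ Vz]]]]] := evJ_ex (evJ_and (evJ_in Jy Jy) (Vf_end eta0)).
exists z; split=> //.
have -> : (Vf y - Vf z) ^+ 2 = (Vf z - Vf y) ^+ 2 by ring.
have h1 := ler_wpM2l ly (Vf_incr Jy Jz yz).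
apply: le_trans h1 _; rewrite mulrCA.
have i0 : 0 <= itg `[y, z] (fun x => h x ^+ 2 * f x).
  by apply: itg_ge0 => x /(Jseg Jy Jz)/f0/ltW fx; apply: mulr_ge0 => //; exact: sqr_ge0.
apply: ler_pM => //; first 1 last.
- exact: He.
- rewrite -itgZ //; last exact: contJ_L1 cf Jy Jz.
  apply: le_trans (_ : - (P z - P y) <= _); last by have := P0 Jz; lra.
  rewrite -(ACD_FTC (ACD_P W) Jy Jz yz) -itgN //; last by case: (ACD_P W) => _ _ _; apply.
  apply: itg_le => //.
  + by apply: L1Z => //; exact: contJ_L1 cf Jy Jz.
  + by apply: L1N => //; case: (ACD_P W) => _ _ _; apply.
  + move=> x xyz; have Jx := Jseg Jy Jz xyz; rewrite opprK; apply: ler_wpM2r; first exact: ltW (f0 Jx).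
    rewrite !(pw_l W); apply: ler_wpM2l; first exact: ltW (pw_B W).
    by move: xyz; rewrite /= in_itv /= => /andP[? _]; lra.
- by apply: mulr_ge0 => //; apply: itg_ge0 => x /(Jseg Jy Jz)/f0/ltW.
Qed.

Lemma Qf_left e x : J x -> x <= m ->
  (forall z, J z -> z <= x -> itg `[z, x] (fun x => h x ^+ 2 * f x) <= e) -> - Qf x <= e.
Proof.
move=> Jx xm He; have Px := P0 Jx.
have lx : 0 <= - l.[x].
  by rewrite (pw_l W) -mulrN opprB mulr_ge0 ?subr_ge0 // ltW ?(pw_B W).
rewrite /Qf /vf [leLHS](_ : _ = - l.[x] * Vf x ^+ 2 / P x) ?ler_pdivrMr //; last by ring.
apply: Vf_bound => // eta eta0.
have [z [_ [Jz _ _ [[zx _] [Vz _]]]]] := evJ_ex (evJ_and (evJ_in Jx Jx) (Vf_end eta0)).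
exists z; split=> //.
have h1 := ler_wpM2l lx (Vf_incr Jz Jx zx).
apply: le_trans h1 _; rewrite mulrCA.
have i0 : 0 <= itg `[z, x] (fun x => h x ^+ 2 * f x).
  by apply: itg_ge0 => t /(Jseg Jz Jx)/f0/ltW ft; apply: mulr_ge0 => //; exact: sqr_ge0.
apply: ler_pM => //; first 1 last.
- exact: He.
- rewrite -itgZ //; last exact: contJ_L1 cf Jz Jx.
  apply: le_trans (_ : P x - P z <= _); last by have := P0 Jz; lra.
  rewrite -(ACD_FTC (ACD_P W) Jz Jx zx).
  apply: itg_le => //.
  + by apply: L1Z => //; exact: contJ_L1 cf Jz Jx.
  + by case: (ACD_P W) => _ _ _; apply.
  + move=> t tzx; have Jt := Jseg Jz Jx tzx; rewrite -mulNr; apply: ler_wpM2r; first exact: ltW (f0 Jt).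
    rewrite !(pw_l W) lerN2; apply: ler_wpM2l; first exact: ltW (pw_B W).
    by move: tzx; rewrite /= in_itv /= => /andP[_ ?]; lra.
- by apply: mulr_ge0 => //; apply: itg_ge0 => t /(Jseg Jz Jx)/f0/ltW.
Qed.

Definition gf x := (q.[x] * dvf x) ^+ 2 * f x + B * (vf x ^+ 2 * P x).

Lemma contJ_gf : contJ a w gf.
Proof.
have cq := @contJ_poly _ a w q; have cv : contJ a w vf := ACD_cont ACD_vf.
have cB : contJ a w (fun=> B) by move=> x _; exact: cst_continuous.
apply: contJ_D.
  by apply: contJ_M cf; apply: contJ_X; exact: contJ_M cq contJ_dvf.
by apply: contJ_M cB _; apply: contJ_M; [exact: contJ_X|exact: contJ_M cq cf].
Qed.

Lemma gf_ge0 x : J x -> 0 <= gf x.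
Proof.
move=> Jx; have fx := ltW (f0 Jx); have Px := ltW (P0 Jx); have B0 := ltW (pw_B W).
apply: addr_ge0; first by apply: mulr_ge0 => //; exact: sqr_ge0.
by apply: mulr_ge0 => //; apply: mulr_ge0 => //; exact: sqr_ge0.
Qed.

(** Pointwise, Qf' = B P v^2 + l^2 v^2 f - 2 l v h f, and adding h^2 f completes the square (l v -
    h)^2 = (q v')^2. *)
Lemma itg_gf_seg x y : J x -> J y -> x <= y ->
  itg `[x, y] gf = itg `[x, y] (fun x => h x ^+ 2 * f x) + (Qf y - Qf x).
Proof.
move=> Jx Jy xy.
have AQ : ACD a w Qf _ := ACD_M (ACD_poly a w l) (ACD_M ACD_Vf ACD_vf).
rewrite -(ACD_FTC AQ Jx Jy xy) -itgD //.
- apply: itg_ext => z zxy; have Jz := Jseg Jx Jy zxy.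
  have -> : (l^`()).[z] = B by rewrite (pw_lp W) derivZ derivXsubC hornerZ hornerC mulr1.
  rewrite /gf (q_dvf Jz) (Vf_vf Jz).
  have -> : P z * vf z * dvf z = f z * vf z * (q.[z] * dvf z) by ring.
  by rewrite (q_dvf Jz); ring.
- exact: contJ_L1 ch2f Jx Jy.
- by case: AQ => _ _ _; apply.
Qed.

(** The boundary terms are first bounded by the whole integral of h^2 f, which gives integrability
    with the factor 3; they are then bounded by its tails, which removes that factor. *)
Lemma L1_gf : L1 J gf /\ itg J gf <= itg J (fun x => h x ^+ 2 * f x).
Proof.
have ge0 x : J x -> 0 <= h x ^+ 2 * f x.
  by move=> /f0/ltW fx; apply: mulr_ge0 => //; exact: sqr_ge0.
have sub s t : J s -> J t -> itg `[s, t] (fun x => h x ^+ 2 * f x) <= itg J (fun x => h x ^+ 2 * f x).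
  by move=> Js Jt; apply: itg_subset => //; [exact: mJ|exact: Jseg].
have bnd x y : J x -> J y -> x <= m -> m <= y ->
    itg `[x, y] gf <= 3 * itg J (fun x => h x ^+ 2 * f x).
  move=> Jx Jy xm my; rewrite (itg_gf_seg Jx Jy (le_trans xm my)).
  have := Qf_right Jy my (fun z Jz _ => sub y z Jy Jz).
  have := Qf_left Jx xm (fun z Jz _ => sub z x Jz Jx).
  have := sub x y Jx Jy; lra.
have [Lg _] := L1_exhaust Jm (contJ_meas contJ_gf) gf_ge0
  (fun x y Jx Jy _ => contJ_L1 contJ_gf Jx Jy) bnd.
split=> //; apply/ler_addgt0Pr => e e0; have e4 : 0 < e / 4 by rewrite divr_gt0.
have [x [y [Jx Jy xy [[xm my] [T1 T2]]]]] := evJ_ex (evJ_and (evJ_in Jm Jm)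
  (evJ_and (L1_tail_diff J0 Lg e4) (L1_tail2 J0 Lh2 e4))).
have nrm s t : J s -> J t -> itg `[s, t] (fun x => `|h x ^+ 2 * f x|) = itg `[s, t] (fun x => h x ^+ 2 * f x).
  by move=> Js Jt; apply: itg_ext => z /(Jseg Js Jt) Jz; rewrite ger0_norm ?ge0.
have Qy : Qf y <= e / 4.
  apply: Qf_right => // z Jz yz; rewrite -nrm //; apply/ltW/T2 => //; by right.
have Qx : - Qf x <= e / 4.
  apply: Qf_left => // z Jz zx; rewrite -nrm //; apply/ltW/T2 => //; by left.
have := itg_gf_seg Jx Jy xy; have := sub x y Jx Jy; move: T1; rewrite ltr_norml => /andP[_].
lra.
Qed.

End Adjoint.

Section Poincare.
Context {R : realType} (a w : \bar R) (q : {poly R}) (D E : R).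
Local Notation J := (Jset a w).
Hypothesis qDE : q^`() = D *: 'X + E%:P.
Hypothesis D0 : D <= 0.
Implicit Types (f h dh : R -> R) (l : {poly R}) (B m : R).

Lemma qDD : q^`()^`() = D%:P.
Proof. by rewrite qDE derivD derivC addr0 derivZ derivX alg_polyC. Qed.

Lemma deriv_l f l B m : PW a w q f l B m -> l^`() = B%:P.
Proof. by move=> W; rewrite (pw_lp W) derivZ derivXsubC alg_polyC. Qed.

(* The adjoint step: v = vf satisfies h = l v - q v', so that orthogonality of h to
   PP 0 l, ..., PP k l becomes orthogonality of v to k polynomials at the next level. *)
Lemma poincare k f l B m h dh : PW a w q f l B m -> ACD a w h dh ->
  L1 J (fun x => h x ^+ 2 * f x) -> L1 J (fun x => dh x ^+ 2 * (q.[x] * f x)) ->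
  (forall i, (i < k)%N -> itg J (fun x => h x * (PP q i l).[x] * f x) = 0) ->
  Lam B D k * itg J (fun x => h x ^+ 2 * f x) <=
  itg J (fun x => dh x ^+ 2 * (q.[x] * f x)).
Proof.
elim: k f l B m h dh => [|k IH] f l B m h dh W Ah Lh Ldh orth.
  rewrite /Lam mul0r bin0n mul0r subr0 mul0r; apply: itg_ge0 => x Jx.
  by apply: mulr_ge0; [exact: sqr_ge0|exact: ltW (pw_P_gt0 W Jx)].
have h_c : itg J (fun x => h x * f x) = 0.
  by rewrite -(orth 0%N) //; apply: itg_ext => x _; rewrite /= hornerC mulr1.
have [m' W'] := PW_next qDE D0 W.
have B0 := pw_B W.
have ch := ACD_cont Ah; have cf := pw_cont W.
have mh := contJ_meas ch; have mf := contJ_meas cf.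
have cq := @contJ_poly _ a w q; have cP := contJ_M cq cf.
pose v := vf a w q f m h; pose dv := dvf a w q f l m h.
have Av : ACD a w v dv := ACD_vf W Ah.
have cv : contJ a w v := ACD_cont Av.
have cdv : contJ a w dv := contJ_dvf W Ah.
have qdv x : J x -> q.[x] * dv x = l.[x] * v x - h x by move=> Jx; exact (q_dvf h W Jx).
have [Lg g_le] := L1_gf W Ah Lh h_c.
have f0 x : J x -> 0 <= f x by move=> Jx; exact: ltW (pw_pos W Jx).
have P0 x : J x -> 0 <= q.[x] * f x by move=> Jx; exact: ltW (pw_P_gt0 W Jx).
have L1a : L1 J (fun x => (q.[x] * dv x) ^+ 2 * f x).
  apply: L1_dom Lg; first exact: mJ.
    by apply: contJ_meas; apply: contJ_M cf; apply: contJ_X; exact: contJ_M.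
  move=> x Jx; rewrite ger0_norm; last by apply: mulr_ge0; [exact: sqr_ge0|exact: f0].
  rewrite /gf lerDl; apply: mulr_ge0; first exact: ltW.
  by apply: mulr_ge0; [exact: sqr_ge0|exact: P0].
have L1b : L1 J (fun x => v x ^+ 2 * (q.[x] * f x)).
  have := L1Z B^-1 mJ (L1B mJ Lg L1a); apply: L1_ext => [|x Jx]; first exact: mJ.
  by rewrite /gf -/v -/dv addrAC subrr add0r mulKf // gt_eqF.
have L1c : L1 J (fun x => dv x ^+ 2 * (q.[x] * (q.[x] * f x))).
  by apply: L1_ext L1a => [|x Jx]; [exact: mJ|ring].
(* l v equals h + q v', and both summands are square integrable for f. This provides the
   integrability of the l-term in each use of [itg_vanish] below. *)
have lv_L1 (u : R -> R) : measurable_fun J u -> L1 J (fun x => u x ^+ 2 * f x) ->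
    L1 J (fun x => l.[x] * v x * u x * f x).
  move=> mu Lu.
  have m1 : measurable_fun J (fun x => q.[x] * dv x) by apply: contJ_meas; exact: contJ_M.
  have := L1D mJ (L1_mulL2 mf mh mu f0 Lh Lu) (L1_mulL2 mf m1 mu f0 L1a Lu).
  apply: L1_ext => [|x Jx]; first exact: mJ.
  by rewrite (qdv x Jx); ring.
have dV x : J x -> q.[x] * f x * dv x = (l.[x] * v x - h x) * f x.
  by move=> Jx; rewrite -(qdv x Jx); ring.
(* (q f v r)' integrates to 0 and r' is a positive multiple of s, so the integral of v s q f is a
   multiple of that of h r f. *)
have orth' i : (i < k)%N -> itg J (fun x => v x * (PP q i (l - q^`())).[x] * (q.[x] * f x)) = 0.
  move=> ik; have L0 := Lam_gt0 i B0 D0.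
  set r := PP q i.+1 l; set s := PP q i (l - q^`()).
  have rs : r^`() = Lam B D i.+1 *: s by exact: deriv_PP qDD (deriv_l W).
  have AF := ACD_M (ACD_P W) (ACD_M Av (ACD_poly a w r)).
  pose phi x := Lam B D i.+1 * (v x * s.[x] * (q.[x] * f x)) - h x * r.[x] * f x.
  have AF' : ACD a w (fun x => q.[x] * f x * (v x * r.[x])) phi.
    apply: ACD_ext AF => // x Jx.
    by rewrite rs hornerZ /phi mulrDr [_ * (dv x * _)]mulrA (dV x Jx); ring.
  have La := L1_mulL2_poly s W' (contJ_meas cv) L1b.
  have Lb := L1_mulL2_poly r W mh Lh.
  have Lphi : L1 J phi := L1B mJ (L1Z _ mJ La) Lb.
  have Lr : L1 J (fun x => r.[x] ^+ 2 * f x).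
    by apply: L1_ext (L1_poly (r ^+ 2) W) => [|x _]; [exact: mJ|rewrite horner_exp].
  have Lg' : L1 J (fun x => l.[x] * (v x * r.[x]) * f x).
    apply: L1_ext (lv_L1 _ (contJ_meas (@contJ_poly _ a w r)) Lr) => [|x _]; first exact: mJ.
    by ring.
  have := itg_vanish W AF' Lphi Lg'.
  rewrite (itgB mJ (L1Z _ mJ La) Lb) (itgZ _ mJ La) (orth i.+1) // subr0 => /eqP.
  by rewrite mulf_eq0 gt_eqF //= => /eqP.
have IHv := IH _ _ _ _ _ _ W' Av L1b L1c orth'.
pose A := itg J (fun x => h x ^+ 2 * f x).
pose Z := itg J (fun x => v x ^+ 2 * (q.[x] * f x)).
pose Edh := itg J (fun x => dh x ^+ 2 * (q.[x] * f x)).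
(* [Lam B D k.+1] is B plus [Lam (B - D) D k]: the B is the second term of [gf], the rest is the
   induction hypothesis for v. *)
have LZ : Lam B D k.+1 * Z <= A.
  apply: le_trans g_le; rewrite /gf -/v -/dv.
  rewrite (itgD mJ L1a (L1Z B mJ L1b)) (itgZ B mJ L1b) LamS mulrDl -/Z.
  have -> : itg J (fun x => (q.[x] * dv x) ^+ 2 * f x) =
            itg J (fun x => dv x ^+ 2 * (q.[x] * (q.[x] * f x))).
    by apply: itg_ext => x _; ring.
  by move: IHv; rewrite -/Z; lra.
have mdh : measurable_fun J dh by case: Ah.
have mP := contJ_meas cP.
have Lvdh : L1 J (fun x => v x * dh x * (q.[x] * f x)).
  exact: L1_mulL2 mP (contJ_meas cv) mdh P0 L1b Ldh.
(* Duality: the integral of h^2 f = - (q f v)' h becomes that of v h' q f. *)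
have AE : A = itg J (fun x => v x * dh x * (q.[x] * f x)).
  have AF := ACD_M (ACD_P W) (ACD_M Av Ah).
  pose phi x := v x * dh x * (q.[x] * f x) - h x ^+ 2 * f x.
  have AF' : ACD a w (fun x => q.[x] * f x * (v x * h x)) phi.
    apply: ACD_ext AF => // x Jx.
    by rewrite /phi mulrDr [_ * (dv x * _)]mulrA (dV x Jx); ring.
  have Lg' : L1 J (fun x => l.[x] * (v x * h x) * f x).
    by apply: L1_ext (lv_L1 _ mh Lh) => [|x _]; [exact: mJ|ring].
  have := itg_vanish W AF' (L1B mJ Lvdh Lh) Lg'.
  by rewrite (itgB mJ Lvdh Lh) => /eqP; rewrite subr_eq0 => /eqP.
have CSA : A ^+ 2 <= Z * Edh.
  rewrite AE; apply: CS => //; first exact: mJ.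
    by move=> x Jx; apply: mulr_ge0; [exact: sqr_ge0|exact: P0].
  move=> x t Jx; rewrite [leRHS](_ : _ = (v x - t * dh x) ^+ 2 * (q.[x] * f x)); last by ring.
  by apply: mulr_ge0; [exact: sqr_ge0|exact: P0].
have Edh0 : 0 <= Edh.
  by apply: itg_ge0 => x Jx; apply: mulr_ge0; [exact: sqr_ge0|exact: P0].
have A0 : 0 <= A.
  by apply: itg_ge0 => x Jx; apply: mulr_ge0; [exact: sqr_ge0|exact: f0].
have L0 := Lam_gt0 k B0 D0.
rewrite -/A -/Edh; have [A00|nA] := eqVneq A 0; first by rewrite A00 mulr0.
have {nA}A0 : 0 < A by rewrite lt_neqAle eq_sym nA.
(* Lam A^2 <= Lam Z Edh <= A Edh, after which A cancels. *)
rewrite -(ler_pM2r A0); apply: le_trans (_ : Lam B D k.+1 * (Z * Edh) <= _).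
  by rewrite -mulrA -expr2 ler_wpM2l // ltW.
by rewrite mulrA [Edh * A]mulrC; apply: ler_wpM2r.
Qed.

End Poincare.

(** * Algebra of the coefficients *)

Section Coefficients.
Context {R : realType} (d : R).
Hypothesis d0 : d <= 0.

(* Minus the eigenvalue of y |-> q y'' - (X - mu) y' on polynomials of degree k. *)
Definition lam (k : nat) : R := k%:R * (1 - (k%:R - 1) * d).

(* zeta d m1 m2 n is lamP m2 n / lamP m1 n, and bcoef d m n n is the inverse of lamP m n. *)
Definition lamP (m n : nat) : R := ((m + n) ^_ n)%:R * pd d m (m + n).

Lemma one_sub_gt0 (j : nat) : 0 < 1 - j%:R * d.
Proof.
have h : (j%:R : R) * d <= 0 by apply: mulr_ge0_le0.
lra.
Qed.

Lemma pd_gt0 lo hi : 0 < pd d lo hi.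
Proof. by apply: prodr_gt0 => j _; exact: one_sub_gt0. Qed.

Lemma pd_recr lo k : pd d lo (lo + k.+1) = pd d lo (lo + k) * (1 - (lo + k)%:R * d).
Proof. by rewrite /pd addnS big_nat_recr // leq_addr. Qed.

Lemma pd_nil lo : pd d lo (lo + 0) = 1.
Proof. by rewrite /pd addn0 big_geq. Qed.

Lemma lam0 : lam 0 = 0. Proof. by rewrite /lam mul0r. Qed.

Lemma lamS k : lam k.+1 = k.+1%:R * (1 - k%:R * d).
Proof. by rewrite /lam -[k.+1%:R - 1]/(k.+1%:R - 1%:R) -natrB // subn1. Qed.

Lemma lamS_gt0 k : 0 < lam k.+1.
Proof. by rewrite lamS mulr_gt0 // one_sub_gt0. Qed.

Lemma lam_sub k t : lam k - lam t = (k%:R - t%:R) * (1 - (k%:R + t%:R - 1) * d).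
Proof. rewrite /lam; ring. Qed.

Lemma lam_lt t k : (t < k)%N -> lam t < lam k.
Proof.
move=> tk; rewrite -subr_gt0 lam_sub mulr_gt0 ?subr_gt0 ?ltr_nat //.
case: k tk => // k _.
rewrite (_ : k.+1%:R + t%:R - 1 = (k + t)%:R :> R); first by rewrite -subr_gt0 one_sub_gt0.
by rewrite (natrD _ k t) -natr1; ring.
Qed.

Lemma lam_le t k : (t <= k)%N -> lam t <= lam k.
Proof. by rewrite leq_eqVlt => /predU1P[->//|/lam_lt/ltW]. Qed.

Lemma lamP_prod m n : lamP m n = \prod_(i < n) lam (m.+1 + i).
Proof.
elim: n => [|n IH]; first by rewrite /lamP ffactn0 pd_nil big_ord0 mulr1.
rewrite big_ord_recr /= -IH /lamP pd_recr addnS ffactSS natrM addSn lamS.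
ring.
Qed.

Lemma lamP_gt0 m n : 0 < lamP m n.
Proof. by rewrite lamP_prod prodr_gt0 // => i _; rewrite addSn lamS_gt0. Qed.

Lemma bcoef_n m n : bcoef d m n n = (lamP m n)^-1.
Proof. by rewrite /bcoef binn /lamP mul1r. Qed.

(** With Newton products N_i and L = lam (m + n + 1), one has (1 - x / L) N_i = (1 - lam i / L) N_i
    - N_(i+1) / L. This is the resulting recursion for the coefficients when n grows by one. *)
Lemma bcoef_rec m n i : (i <= n)%N ->
  bcoef d m n.+1 i.+1 = bcoef d m n i.+1 * (1 - lam i.+1 / lam (m + n).+1) +
    bcoef d m n i / lam (m + n).+1.
Proof.
move=> i_le_n.
have pNi : (0 : R) < ((m + n) ^_ i)%:R by rewrite ltr0n ffact_gt0 (leq_trans i_le_n) ?leq_addl.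
have pQ : 0 < pd d m (m + i) by exact: pd_gt0.
have p1 : 0 < 1 - (m + i)%:R * d by exact: one_sub_gt0.
have p2 : 0 < 1 - (m + n)%:R * d by exact: one_sub_gt0.
have p3 : (0 : R) < (m + n).+1%:R by [].
rewrite /bcoef pd_recr addnS ffactSS ffactnSr binS !lamS.
have := mul_bin_left n i.
(* The case i = n is apart: there m + n - i, by which the general case divides, is 0 when m = 0. *)
rewrite leq_eqVlt in i_le_n; case/predU1P: i_le_n => [e|i_lt_n] H.
  rewrite {}e in pNi pQ p1 *; rewrite bin_small ?ltnSn // add0n binn !mul0r add0r !natrM.
  move: p2 p3 pNi pQ.
  move: (1 - (m + n)%:R * d) ((m + n).+1%:R : R) (((m + n) ^_ n)%:R : R) (pd d m (m + n)).
  by move=> A2 A3 Ni Q p2 p3 pNi pQ; field; rewrite !gt_eqF.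
have p4 : (0 : R) < (m + n - i)%:R by rewrite ltr0n subn_gt0 (leq_trans i_lt_n) ?leq_addl.
have e4 : (m + n - i)%:R = m%:R + n%:R - i%:R :> R.
  by rewrite natrB ?natrD // (leq_trans (ltnW i_lt_n)) ?leq_addl.
have {H}HR : i.+1%:R * ('C(n, i.+1))%:R = (n%:R - i%:R) * ('C(n, i))%:R :> R.
  by rewrite -natrM H natrM natrB // ltnW.
rewrite natrD !natrM.
move: ('C(n, i.+1)%:R : R) ('C(n, i)%:R : R) HR => c' c HR.
move: pNi pQ; move: (((m + n) ^_ i)%:R : R) (pd d m (m + i)) => Ni Q pNi pQ.
have nz (y : R) : 0 < y -> y != 0 by move=> y0; rewrite gt_eqF.
have E : (c' + c) * (1 - (m + n)%:R * d) * (m + n - i)%:R =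
   c' * ((m + n).+1%:R * (1 - (m + n)%:R * d) - i.+1%:R * (1 - i%:R * d)) +
   c * (1 - (m + i)%:R * d) * (m + n - i)%:R.
  apply/eqP; rewrite -subr_eq0 e4; apply/eqP.
  transitivity ((m%:R + n%:R - i%:R) * d * (i.+1%:R * c' - (n%:R - i%:R) * c)); first by ring.
  by rewrite HR subrr mulr0.
move: E p1 p2 p3 p4.
move: (1 - (m + i)%:R * d) (1 - (m + n)%:R * d) ((m + n).+1%:R : R) ((m + n - i)%:R : R).
move: (i.+1%:R * (1 - i%:R * d)) => la A1 A2 A3 A4 E /nz p1 /nz p2 /nz p3 /nz p4.
move/nz: pNi => pNi; move/nz: pQ => pQ.
transitivity ((c' + c) * A2 * A4 / (Ni * Q * A1 * A4 * A3 * A2)).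
  by field; rewrite ?p1 ?p2 ?p3 ?p4 ?pNi ?pQ.
by rewrite E; field; rewrite ?p1 ?p2 ?p3 ?p4 ?pNi ?pQ.
Qed.

Lemma bcoef_0 m n : bcoef d m n 0 = 1.
Proof. by rewrite /bcoef bin0 ffactn0 pd_nil mulr1 invr1 mulr1. Qed.

Lemma lamP_recr m n : lamP m n.+1 = lamP m n * lam (m.+1 + n).
Proof. by rewrite !lamP_prod big_ord_recr. Qed.

(* Newton interpolation at the nodes lam 0, lam 1, ... of the product on the right. *)
Lemma newton_expansion m n (x : R) :
  \sum_(i < n.+1) (-1) ^+ i * bcoef d m n i * \prod_(t < i) (x - lam t) =
  \prod_(j < n) (lam (m.+1 + j) - x) / lamP m n.
Proof.
elim: n => [|n IH].
  by rewrite big_ord_recl !big_ord0 addr0 expr0 mul1r mulr1 bcoef_n mul1r.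
have L0 : lam (m.+1 + n) != 0 by rewrite gt_eqF // addSn lamS_gt0.
have P0 : lamP m n != 0 by rewrite gt_eqF ?lamP_gt0.
rewrite [in RHS]big_ord_recr /= lamP_recr.
have -> : \prod_(j < n) (lam (m.+1 + j) - x) * (lam (m.+1 + n) - x) /
   (lamP m n * lam (m.+1 + n)) = \prod_(j < n) (lam (m.+1 + j) - x) / lamP m n *
   (1 - x / lam (m.+1 + n)) by field; rewrite L0.
rewrite -{}IH mulr_suml.
set L := lam (m.+1 + n) in L0 *.
pose La i := \prod_(t < i) (x - lam t).
have LaS i : La i.+1 = La i * (x - lam i) by rewrite /La big_ord_recr.
pose u (i : nat) := (-1) ^+ i * bcoef d m n i * (1 - lam i / L) * La i.
have -> : \sum_(i < n.+1) (-1) ^+ i * bcoef d m n i * \prod_(t < i) (x - lam t) * (1 - x / L) =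
    \sum_(i < n.+1) u i + \sum_(i < n.+1) (-1) ^+ i.+1 * (bcoef d m n i / L) * La i.+1.
  rewrite -big_split /=; apply: eq_bigr => i _; rewrite -/(La i) /u LaS exprS; field.
  by rewrite L0.
rewrite big_ord_recl [bcoef d m n.+1 _]bcoef_0 /= big_ord0 !mulr1 expr0.
have -> : \sum_(i < n.+1) u i = 1 + \sum_(i < n.+1) u i.+1.
  have u0 : u 0%N = 1 by rewrite /u bcoef_0 lam0 mul0r subr0 /La big_ord0 !mulr1.
  have un : u n.+1 = 0 by rewrite /u /bcoef bin_small // mul0r mulr0 !mul0r.
  have E1 : \sum_(i < n.+2) u i = u 0%N + \sum_(i < n.+1) u i.+1 by rewrite big_ord_recl.
  have E2 : \sum_(i < n.+2) u i = \sum_(i < n.+1) u i by rewrite big_ord_recr /= un addr0.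
  by rewrite -E2 E1 u0.
rewrite -addrA -big_split /=; congr (_ + _); apply: eq_bigr => i _.
have i_n : (i <= n)%N by rewrite -ltnS.
rewrite [bcoef d m n.+1 _](bcoef_rec m i_n) -[(m + n).+1]/(m.+1 + n)%N -/L /u.
by rewrite -[\prod_(t < _) _]/(La i.+1) exprS; ring.
Qed.

Lemma prod_sub_ffact k s : (s <= k)%N ->
  \prod_(t < s) ((k%:R : R) - t%:R) = (k ^_ s)%:R.
Proof.
elim: s => [|s IH] sk; first by rewrite big_ord0 ffactn0.
by rewrite big_ord_recr /= IH 1?ltnW // ffactnSr natrM natrB // ltnW.
Qed.

(** lam k - lam t = (k - t) (1 - (k + t - 1) d), and k + t - 1 runs from k - 1 to 2 k - 2. This is
    the origin of the middle product in the denominator of a_k. *)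
Lemma prod_lam_sub k : \prod_(t < k) (lam k - lam t) = k`!%:R * pd d k.-1 (2 * k).-1%N.
Proof.
case: k => [|k]; first by rewrite big_ord0 /pd big_geq // mulr1.
under eq_bigr do rewrite lam_sub.
have -> : (2 * k.+1).-1%N = (k.+1 + k)%N by lia.
rewrite big_split prod_sub_ffact // ffactnn [k.+1.-1]/=; congr (_ * _).
rewrite /pd -[X in \prod_(X <= _ < _) _]add0n big_addn addnK big_mkord; apply: eq_bigr => t _.
by rewrite (natrD _ t k) -(natr1 k); ring.
Qed.

(** X stands for E[q^k]. The coefficient a_k is thus the one that the Newton expansion produces for
    k <= m. Induction on n: each step multiplies both sides by 1 - lam k / lam (m + n + 1). *)
Lemma acoef_id m n k (X : R) : (k <= m)%N -> X != 0 ->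
  ('C(m, k))%:R * pd d (m + k) (m + n + k) /
    (((m + n) ^_ k)%:R * X * pd d k.-1 (2 * k).-1%N * pd d m (m + n)) *
  (X * \prod_(t < k) (lam k - lam t)) =
  \prod_(j < n) (lam (m.+1 + j) - lam k) / lamP m n.
Proof.
move=> km X0; rewrite prod_lam_sub.
have nz (y : R) : 0 < y -> y != 0 by move=> y0; rewrite gt_eqF.
have p0 := nz _ (pd_gt0 k.-1 (2 * k).-1%N).
have F0 n' : ((m + n') ^_ k)%:R != 0 :> R.
  by rewrite pnatr_eq0 -lt0n ffact_gt0 (leq_trans km) ?leq_addr.
elim: n => [|n IH].
  rewrite big_ord0 lamP_prod big_ord0 divr1.
  have := bin_ffact m k; move=> /(congr1 (fun i => i%:R : R)); rewrite natrM => H.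
  have : (m ^_ k)%:R != 0 :> R by have := F0 0%N; rewrite addn0.
  rewrite -{1}H mulf_eq0 negb_or => /andP[h1 h2].
  have e1 : pd d (m + k) (m + 0 + k) = 1 by rewrite addn0 /pd big_geq.
  rewrite e1 pd_nil addn0 -H; field.
  by rewrite h1 h2 p0 X0.
have L0 := nz _ (lamS_gt0 (m + n)).
rewrite big_ord_recr /= lamP_recr addSn.
have -> : \prod_(j < n) (lam (m.+1 + j) - lam k) * (lam (m + n).+1 - lam k) /
   (lamP m n * lam (m + n).+1) = \prod_(j < n) (lam (m.+1 + j) - lam k) / lamP m n *
   ((lam (m + n).+1 - lam k) / lam (m + n).+1) by field; rewrite L0 nz // lamP_gt0.
rewrite -{}IH pd_recr lam_sub lamS.
have -> : pd d (m + k) (m + n.+1 + k) = pd d (m + k) (m + n + k) * (1 - (m + n + k)%:R * d).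
  by rewrite addnAC pd_recr addnAC.
have pm := nz _ (pd_gt0 m (m + n)).
have q2 := nz _ (one_sub_gt0 (m + n)).
have nk : (k <= m + n)%N by rewrite (leq_trans km) ?leq_addr.
have H : ((m + n.+1) ^_ k)%:R * ((m + n).+1%:R - k%:R) = (m + n).+1%:R * ((m + n) ^_ k)%:R :> R.
  by rewrite addnS -natrB ?(leqW nk) // -!natrM -ffactnSr ffactSS.
have E : ((m + n) ^_ k)%:R = ((m + n.+1) ^_ k)%:R * ((m + n).+1%:R - k%:R) / (m + n).+1%:R :> R.
  by rewrite H mulrC mulKf // pnatr_eq0.
have k0 : (m + n).+1%:R - k%:R != 0 :> R.
  by rewrite nz // subr_gt0 ltr_nat ltnS.
rewrite E.
have n1 : (m + n).+1%:R != 0 :> R by rewrite pnatr_eq0.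
have -> : 1 - ((m + n).+1%:R + k%:R - 1) * d = 1 - (m + n + k)%:R * d.
  by rewrite (natrD _ (m + n) k) -(natr1 (m + n)); ring.
move: (1 - (m + n + k)%:R * d) => y.
have := F0 n.+1; move: n1 k0 q2 pm p0.
move: ((m + n).+1%:R : R) (k%:R : R) (1 - (m + n)%:R * d) (((m + n.+1) ^_ k)%:R : R).
move: (pd d m (m + n)) (pd d k.-1 _) (k`!%:R : R) => z1 z2 z3 N1 K x2 F n1 k0 q2 pm p0 F1.
by field; rewrite F1 k0 n1 pm q2 p0 X0.
Qed.

Lemma ltr_prod_ord (n : nat) (F G : nat -> R) : (0 < n)%N ->
  (forall i, (i < n)%N -> 0 <= F i /\ F i < G i) ->
  \prod_(i < n) F i < \prod_(i < n) G i.
Proof.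
move=> n0 FG; apply: ltr_prod.
  by apply/hasP; exists (Ordinal n0) => //; rewrite mem_index_enum.
by move=> i _; have [-> ->] := FG i (ltn_ord i).
Qed.

Lemma lamP_lt m1 m2 n : (0 < n)%N -> (m1 < m2)%N -> lamP m1 n < lamP m2 n.
Proof.
move=> n0 m12; rewrite !lamP_prod.
apply: (@ltr_prod_ord n (fun i => lam (m1.+1 + i)) (fun i => lam (m2.+1 + i))) => // i _; split.
  by rewrite addSn ltW // lamS_gt0.
by rewrite lam_lt // ltn_add2r.
Qed.

(* For k > m, (-1)^n lamP m n times the coefficient of the k-th normalised squared Fourier
   coefficient of g in Var g - S_m. *)
Definition tprod (m n k : nat) : R :=
  if (m + n < k)%N then \prod_(i < n) (lam k - lam (m.+1 + i)) else 0.

Lemma tprod_prod m n k : (m < k)%N ->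
  \prod_(j < n) (lam (m.+1 + j) - lam k) = (-1) ^+ n * tprod m n k.
Proof.
move=> mk; rewrite /tprod; case: ltnP => [_|kmn].
  rewrite -[n in (-1) ^+ n](card_ord n) -prodr_const -big_split /=.
  by apply: eq_bigr => i _; rewrite mulN1r opprB.
have i0 : (k - m.+1 < n)%N by lia.
rewrite mulr0 (bigD1 (Ordinal i0)) //= subnKC // subrr mul0r //.
Qed.

Lemma tprod_ge0 m n k : 0 <= tprod m n k.
Proof.
rewrite /tprod; case: ltnP => // mnk; apply: prodr_ge0 => i _.
by rewrite subr_ge0 lam_le //; have := ltn_ord i; lia.
Qed.

Lemma tprod_le m1 m2 n k : (m1 < m2)%N -> tprod m2 n k <= tprod m1 n k.
Proof.
move=> m12; rewrite {1}/tprod; case: ltnP => h2; last exact: tprod_ge0.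
rewrite /tprod ifT; last by apply: leq_ltn_trans h2; rewrite leq_add2r ltnW.
apply: ler_prod => i _; apply/andP; split.
  by rewrite subr_ge0 lam_le //; have := ltn_ord i; lia.
by rewrite lerD2l lerN2 lam_le // leq_add2r ltnS ltnW.
Qed.

Lemma tprod_lt m1 m2 n k : (0 < n)%N -> (m1 < m2)%N -> (m1 + n < k)%N ->
  tprod m2 n k < tprod m1 n k.
Proof.
move=> n0 m12 h1; rewrite /tprod h1; case: ltnP => h2.
  apply: (@ltr_prod_ord n (fun i => lam k - lam (m2.+1 + i)) (fun i => lam k - lam (m1.+1 + i))) => // i ilt; split.
    by rewrite subr_ge0 lam_le //; lia.
  by rewrite ltrD2l ltrN2 lam_lt // ltn_add2r.
apply: prodr_gt0 => i _; rewrite subr_gt0 lam_lt //; have := ltn_ord i; lia.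
Qed.

End Coefficients.

(** * Fourier coefficients *)

Section Projection.
Context {R : realType} (a w : \bar R) (q : {poly R}) (D E : R).
Local Notation J := (Jset a w).
Hypothesis qDE : q^`() = D *: 'X + E%:P.
Hypothesis D0 : D <= 0.
Hypothesis sq : (size q <= 3)%N.
Implicit Types (f h u du : R -> R) (l p : {poly R}) (B m : R).

Lemma itg0_cont h : contJ a w h -> (forall x, J x -> 0 <= h x) -> L1 J h ->
  itg J h = 0 -> forall x, J x -> h x = 0.
Proof.
move=> ch h0 Lh ih x Jx; apply/eqP; rewrite -[_ == _]negbK; apply/negP => hx.
have {hx}hx : 0 < h x by rewrite lt_neqAle eq_sym hx h0.
have [r r0 rJ] := J_ball Jx.
have h2 : 0 < h x / 2 by rewrite divr_gt0.
have cx : h y @[y --> x] --> h x := ch x Jx.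
move/cvgrPdist_lt : cx => /(_ _ h2) /nbhs_ballP[s /= s0 sH].
pose t := Num.min r (s / 2).
have t0 : 0 < t by rewrite lt_min r0 divr_gt0.
have tr : t <= r by rewrite ge_min lexx.
have ts : t <= s / 2 by rewrite ge_min lexx orbT.
have J1 : J (x - t) by apply: rJ; rewrite ler_norml; lra.
have J2 : J (x + t) by apply: rJ; rewrite ler_norml; lra.
have sub := Jseg J1 J2.
have : itg `[x - t, x + t] (fun=> h x / 2) <= itg `[x - t, x + t] h.
  apply: itg_le => //; [exact: L1_seg_cst|exact: contJ_L1 ch J1 J2|].
  move=> y; rewrite /= in_itv /= => /andP[y1 y2].
  have : `|h x - h y| < h x / 2 by apply: sH; rewrite /ball /= ltr_norml; lra.
  by rewrite ltr_norml; lra.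
have : itg `[x - t, x + t] h <= itg J h by apply: itg_subset => //; exact: mJ.
rewrite ih itg_seg_cst; last lra.
have : 0 < h x / 2 * (x + t - (x - t)) by rewrite mulr_gt0 //; lra.
lra.
Qed.

Lemma pw_itg_gt0 f l B m : PW a w q f l B m -> 0 < itg J f.
Proof.
move=> W; have f0 x : J x -> 0 <= f x by move=> Jx; exact: ltW (pw_pos W Jx).
have Lf : L1 J f.
  by apply: L1_ext (pw_mom W 0) => [|x _]; [exact: mJ|rewrite expr0 mul1r].
rewrite lt_neqAle itg_ge0 // andbT eq_sym; apply/eqP => if0.
by have := itg0_cont (pw_cont W) f0 Lf if0 (pw_m W) => H; have := pw_pos W (pw_m W); rewrite H ltxx.
Qed.

Lemma size_deriv_le p k : (size p <= k.+1)%N -> (size (p^`())%R <= k)%N.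
Proof.
move=> sp; have [->|p0] := eqVneq p 0; first by rewrite linear0 size_poly0.
by rewrite -ltnS (leq_trans (lt_size_deriv p0)).
Qed.

Lemma size_l' l : (size l <= 2)%N -> (size (l - q^`())%R <= 2)%N.
Proof.
move=> sl; rewrite (leq_trans (size_polyD _ _)) // geq_max sl size_polyN /=.
exact: size_deriv_le.
Qed.

Lemma pw_size_l f l B m : PW0 a w q f l B m -> (size l <= 2)%N.
Proof. by move=> /pw_lp ->; rewrite (leq_trans (size_scale_leq _ _)) // size_XsubC. Qed.

Lemma size_PP k l : (size l <= 2)%N -> (size (PP q k l) <= k.+1)%N.
Proof.
elim: k l => [|k IH] l sl; first by rewrite /= size_poly1.
have sp := IH _ (size_l' sl).
have h1 i j : (i <= 2 -> j <= k.+1 -> (i + j).-1 <= k.+2)%N by lia.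
have h2 i j : (i <= 3 -> j <= k -> (i + j).-1 <= k.+2)%N by lia.
rewrite [PP q k.+1 l]/= (leq_trans (size_polyD _ _)) // geq_max size_polyN.
apply/andP; split; apply: leq_trans (size_polyMleq _ _) _; first exact: h1.
by apply: h2 => //; exact: size_deriv_le.
Qed.

Lemma ibp_PP f l B m u du k : PW a w q f l B m -> ACD a w u du ->
  L1 J (fun x => u x ^+ 2 * f x) -> L1 J (fun x => du x ^+ 2 * (q.[x] * f x)) ->
  itg J (fun x => u x * (PP q k.+1 l).[x] * f x) =
  itg J (fun x => du x * (PP q k (l - q^`())).[x] * (q.[x] * f x)).
Proof.
move=> W Au Lu Ldu; have [m' W'] := PW_next qDE D0 W.
have mu := contJ_meas (ACD_cont Au); have mdu : measurable_fun J du by case: Au.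
exact: (ibp W Au (L1_mulL2_poly _ W mu Lu) (L1_mulL2_poly _ W mu Lu) (L1_mulL2_poly _ W' mdu Ldu)).
Qed.

Lemma L1_poly2 f l B m p : PW a w q f l B m -> L1 J (fun x => p.[x] ^+ 2 * f x).
Proof.
by move=> W; apply: L1_ext (L1_poly (p ^+ 2) W) => [|x _]; [exact: mJ|rewrite horner_exp].
Qed.

Lemma L1_polyM f l B m p p' : PW a w q f l B m -> L1 J (fun x => p.[x] * p'.[x] * f x).
Proof.
by move=> W; apply: L1_ext (L1_poly (p * p') W) => [|x _]; [exact: mJ|rewrite hornerM].
Qed.

(** Each integration by parts lowers both k and the degree of p by one, until p is 0. *)
Lemma PP_orth k f l B m p : PW a w q f l B m -> (size p <= k)%N ->
  itg J (fun x => p.[x] * (PP q k l).[x] * f x) = 0.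
Proof.
elim: k f l B m p => [|k IH] f l B m p W sp.
  rewrite (@itg_ext _ _ _ (fun x => 0 * f x)).
    by rewrite itgZ ?mul0r //; [exact: mJ|
      apply: L1_ext (pw_mom W 0) => [|x _]; [exact: mJ|rewrite expr0 mul1r]].
  by move=> x _; have /eqP -> : p == 0 by [rewrite -size_poly_leq0]; rewrite horner0 !mul0r.
have [m' W'] := PW_next qDE D0 W.
rewrite (ibp_PP k W (ACD_poly a w p) (L1_poly2 p W) (L1_poly2 _ W')).
by apply: IH W' _; exact: size_deriv_le.
Qed.

Definition nrm2 f l k := itg J (fun x => (PP q k l).[x] ^+ 2 * f x).

Lemma nrm2S f l B m k : PW a w q f l B m ->
  nrm2 f l k.+1 = Lam B D k.+1 * nrm2 (fun x => q.[x] * f x) (l - q^`()) k.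
Proof.
move=> W; have [m' W'] := PW_next qDE D0 W.
rewrite /nrm2 -(itgZ _ mJ (L1_poly2 _ W')).
rewrite (@itg_ext _ _ _ (fun x => (PP q k.+1 l).[x] * (PP q k.+1 l).[x] * f x)); last first.
  by move=> x _; rewrite expr2.
rewrite (ibp_PP k W (ACD_poly a w _) (L1_poly2 _ W) (L1_poly2 _ W')).
apply: itg_ext => x _; rewrite (deriv_PP k (qDD qDE) (deriv_l W)) hornerZ expr2; ring.
Qed.

Lemma nrm2_gt0 f l B m k : PW a w q f l B m -> 0 < nrm2 f l k.
Proof.
elim: k f l B m => [|k IH] f l B m W.
  rewrite /nrm2 (@itg_ext _ _ _ f); first exact: pw_itg_gt0 W.
  by move=> x _; rewrite /= hornerC expr1n mul1r.
have [m' W'] := PW_next qDE D0 W.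
by rewrite (nrm2S k W) mulr_gt0 ?(IH _ _ _ _ W') // Lam_gt0 // (pw_B W).
Qed.

Lemma PP_orth2 f l B m i j : PW a w q f l B m -> i != j ->
  itg J (fun x => (PP q i l).[x] * (PP q j l).[x] * f x) = 0.
Proof.
move=> W; have sl := pw_size_l W; rewrite neq_ltn => /orP[ij|ji].
  by apply: (PP_orth W); rewrite (leq_trans (size_PP i sl)).
rewrite (@itg_ext _ _ _ (fun x => (PP q j l).[x] * (PP q i l).[x] * f x)).
  by apply: (PP_orth W); rewrite (leq_trans (size_PP j sl)).
by move=> x _; rewrite [_ * (PP q j l).[x]]mulrC.
Qed.

Section Bessel.
Variables (f : R -> R) (l : {poly R}) (B m : R) (u : R -> R).
Hypothesis W : PW a w q f l B m.
Hypothesis mu : measurable_fun J u.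
Hypothesis Lu : L1 J (fun x => u x ^+ 2 * f x).

(** Here g is the weight. Without normalisation the coefficient passes unchanged from one level to
    the next. *)
Definition fcoef (g : R -> R) (u : R -> R) (l : {poly R}) k :=
  itg J (fun x => u x * (PP q k l).[x] * g x).

Definition proj (K : nat) : {poly R} :=
  \sum_(s < K) (fcoef f u l s / nrm2 f l s) *: PP q s l.

Let nu0 k : nrm2 f l k != 0. Proof. by rewrite gt_eqF // (nrm2_gt0 k W). Qed.

Lemma itg_proj_PP K s : (s < K)%N ->
  itg J (fun x => (proj K).[x] * (PP q s l).[x] * f x) = fcoef f u l s.
Proof.
move=> sK.
rewrite (@itg_ext _ _ _ (fun x => \sum_(t < K) (fcoef f u l t / nrm2 f l t) *
    ((PP q t l).[x] * (PP q s l).[x] * f x))); last first.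
  move=> x _; rewrite /proj horner_sum !mulr_suml; apply: eq_bigr => t _.
  by rewrite hornerZ !mulrA.
rewrite itg_sum; [|exact: mJ|by move=> t _; exact: (L1Z _ mJ (L1_polyM _ _ W))].
rewrite (bigD1 (Ordinal sK)) //= (itgZ _ mJ (L1_polyM _ _ W)) big1 ?addr0.
  have -> : itg J (fun x => (PP q s l).[x] * (PP q s l).[x] * f x) = nrm2 f l s.
    by apply: itg_ext => x _; ring.
  by rewrite divfK.
move=> t ts; rewrite (itgZ _ mJ (L1_polyM _ _ W)) (PP_orth2 W) ?mulr0 //.
Qed.

Lemma proj_orth K s : (s < K)%N ->
  itg J (fun x => (u x - (proj K).[x]) * (PP q s l).[x] * f x) = 0.
Proof.
move=> sK; rewrite (@itg_ext _ _ _ (fun x => u x * (PP q s l).[x] * f x -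
   (proj K).[x] * (PP q s l).[x] * f x)); last by move=> x _; rewrite !mulrBl.
rewrite (itgB mJ (L1_mulL2_poly _ W mu Lu) (L1_polyM _ _ W)) itg_proj_PP //.
by rewrite -/(fcoef f u l s) subrr.
Qed.

Lemma L1_rem K : L1 J (fun x => (u x - (proj K).[x]) ^+ 2 * f x).
Proof.
have := L1D mJ (L1B mJ Lu (L1Z 2 mJ (L1_mulL2_poly (proj K) W mu Lu))) (L1_poly2 (proj K) W).
by apply: L1_ext => [|x _]; [exact: mJ|ring].
Qed.

Lemma itg_rem K : itg J (fun x => (u x - (proj K).[x]) ^+ 2 * f x) =
  itg J (fun x => u x ^+ 2 * f x) - \sum_(s < K) fcoef f u l s ^+ 2 / nrm2 f l s.
Proof.
have Lup := L1_mulL2_poly (proj K) W mu Lu.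
have Lpp := L1_poly2 (proj K) W.
have sumE (v : R -> R) : (forall p, L1 J (fun x => v x * p.[x] * f x)) ->
    (forall s, (s < K)%N -> itg J (fun x => v x * (PP q s l).[x] * f x) = fcoef f u l s) ->
    itg J (fun x => v x * (proj K).[x] * f x) = \sum_(s < K) fcoef f u l s ^+ 2 / nrm2 f l s.
  move=> Lv Ev.
  rewrite (@itg_ext _ _ _ (fun x => \sum_(t < K) (fcoef f u l t / nrm2 f l t) *
    (v x * (PP q t l).[x] * f x))); last first.
    move=> x _; rewrite /proj horner_sum mulr_sumr mulr_suml; apply: eq_bigr => t _.
    by rewrite hornerZ; ring.
  rewrite itg_sum; [|exact: mJ|by move=> t _; exact: (L1Z _ mJ (Lv _))].
  apply: eq_bigr => t _; rewrite (itgZ _ mJ (Lv _)) Ev //.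
  by rewrite expr2 mulrAC.
have E1 := sumE u (fun p => L1_mulL2_poly p W mu Lu) (fun _ _ => erefl).
have E2 := sumE (fun x => (proj K).[x]) (fun p => L1_polyM _ p W) (fun s => @itg_proj_PP K s).
rewrite (@itg_ext _ _ _ (fun x => u x ^+ 2 * f x - 2 * (u x * (proj K).[x] * f x) +
   (proj K).[x] * (proj K).[x] * f x)); last by move=> x _; ring.
rewrite (itgD mJ (L1B mJ Lu (L1Z 2 mJ Lup)) (L1_polyM _ _ W)) (itgB mJ Lu (L1Z 2 mJ Lup)).
by rewrite (itgZ 2 mJ Lup) E1 E2; ring.
Qed.

End Bessel.

(** The derivative of a remainder is therefore the remainder of the derivative for the next weight,
    which is how the Poincaré inequality comes to compare consecutive remainders. *)
Lemma deriv_proj f l B m u du K : PW a w q f l B m -> ACD a w u du ->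
  L1 J (fun x => u x ^+ 2 * f x) -> L1 J (fun x => du x ^+ 2 * (q.[x] * f x)) ->
  (proj f l u K.+1)^`() = proj (fun x => q.[x] * f x) (l - q^`()) du K.
Proof.
move=> W Au Lu Ldu; have [m' W'] := PW_next qDE D0 W.
rewrite /proj big_ord_recl derivD derivZ /= derivC scaler0 add0r linear_sum.
apply: eq_bigr => s _ /=; rewrite derivZ.
rewrite -[bump 0 s]/(s.+1).
rewrite (deriv_PP s (qDD qDE) (deriv_l W)) scalerA (nrm2S s W) /fcoef.
rewrite (ibp_PP s W Au Lu Ldu); congr (_ *: _).
have L0 := Lam_gt0 s (pw_B W) D0; have n0 := nrm2_gt0 s W'.
by field; rewrite !gt_eqF.
Qed.

End Projection.

(** * Expansions of all derivatives in the coefficients of g *)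

Section Levels.
Context {R : realType} (a w : \bar R) (q : {poly R}) (Cq d E : R).
Local Notation J := (Jset a w).
Hypothesis qC : forall x, J x -> q.[x] <= Cq * rr x.
Hypothesis qDE : q^`() = (2 * d) *: 'X + E%:P.
Hypothesis d0 : d <= 0.
Hypothesis sq : (size q <= 3)%N.

Let D := 2 * d.
Let D0 : D <= 0. Proof. by rewrite /D mulr_ge0_le0. Qed.

Variables (f : R -> R) (l : {poly R}) (m0 : R).
Hypothesis W0 : PW a w q f l 1 m0.

Fixpoint fj (j : nat) (x : R) : R := if j is j'.+1 then q.[x] * fj j' x else f x.
Fixpoint lj (j : nat) : {poly R} := if j is j'.+1 then lj j' - q^`() else l.

Lemma fjE j x : fj j x = q.[x] ^+ j * f x.
Proof. by elim: j => [|j IH] /=; rewrite ?expr0 ?mul1r // IH exprS mulrA. Qed.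

Lemma PWj j : exists m, PW a w q (fj j) (lj j) (1 - j%:R * D) m.
Proof.
elim: j => [|j [m IH]]; first by exists m0; rewrite mul0r subr0.
have [m' H] := PW_next qDE D0 IH; exists m'.
have -> : 1 - j.+1%:R * D = 1 - j%:R * D - 2 * d by rewrite -natr1 /D; ring.
exact H.
Qed.

(** Differentiating i times an eigenpolynomial of degree i + s gives one of degree s for the i-th
    weight, with eigenvalue lowered by lam i. Hence the Newton nodes lam 0, lam 1, ... *)
Lemma Lam_lam i s : Lam (1 - i%:R * D) D s = lam d (i + s) - lam d i.
Proof.
have h : ('C(s, 2))%:R * 2 = s%:R * (s%:R - 1) :> R.
  case: s => [|s]; first by rewrite bin0n !mul0r.
  have := mul_bin_diag s.+1 1; rewrite bin1 => /(congr1 (fun k => k%:R : R)).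
  by rewrite !natrM => H; rewrite mulrC -H -[s.+1%:R]natr1 /=; ring.
have -> : Lam (1 - i%:R * D) D s = s%:R * (1 - i%:R * D) - ('C(s, 2)%:R * 2) * d.
  by rewrite /Lam /D; ring.
by rewrite h /lam natrD /D; ring.
Qed.

Lemma nrm2_level i s : nrm2 a w q f l (i + s) =
  \prod_(t < i) (lam d (i + s) - lam d t) * nrm2 a w q (fj i) (lj i) s.
Proof.
elim: i s => [|i IH] s; first by rewrite big_ord0 mul1r.
have [m W] := PWj i.
rewrite big_ord_recr /= addSnnS IH -mulrA; congr (_ * _).
by rewrite (nrm2S qDE D0 s W) Lam_lam.
Qed.

Variables (G : nat -> R -> R) (n L : nat).
Hypothesis AG : forall i, (i < L)%N -> ACD a w (G i) (G i.+1).
Hypothesis n0 : (0 < n)%N.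
Hypothesis nL : (n <= L)%N.
Hypothesis LGn : L1 J (fun x => G n x ^+ 2 * fj n x).
Hypothesis LG1 : forall i, (n < i <= L)%N -> L1 J (fun x => `|G i x| * fj i x).

(** Descent from level n by [chain_L2]. *)
Lemma L2G i : (i <= n)%N -> L1 J (fun x => G i x ^+ 2 * fj i x).
Proof.
move=> i_n; have -> : i = (n - (n - i))%N by rewrite subKn.
elim: (n - i)%N => [|t IH]; first by rewrite subn0.
have [tn|nt] := ltnP t n; last first.
  by have -> : (n - t.+1 = n - t)%N by lia.
have e : (n - t = (n - t.+1).+1)%N by lia.
have [m W] := PWj (n - t.+1).
have A : ACD a w (G (n - t.+1)) (G (n - t)) by rewrite e; apply: AG; lia.
apply: (chain_L2 qC W A); move: IH; rewrite e //.
Qed.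

Lemma mG i : (i <= L)%N -> measurable_fun J (G i).
Proof.
case: i => [|i] iL; last by case: (AG iL).
by apply: contJ_meas (ACD_cont (AG _)); apply: leq_trans nL.
Qed.

(** Descent from level k > n by [chain_L1]: t levels down, the derivative can be paired with
    polynomials of degree t. *)
Lemma rrG k t : (n < k <= L)%N -> (t <= k - n)%N ->
  L1 J (fun x => rr x ^+ t * `|G (k - t) x| * fj (k - t) x).
Proof.
move=> nkL; elim: t => [|t IH] tk.
  by rewrite subn0; apply: L1_ext (LG1 nkL) => [|x _]; [exact: mJ|rewrite expr0 mul1r].
have e : (k - t = (k - t.+1).+1)%N by lia.
have [m W] := PWj (k - t.+1).
have A : ACD a w (G (k - t.+1)) (G (k - t)) by rewrite e; apply: AG; lia.
by apply: (chain_L1 qC W A); move: (IH (ltnW tk)); rewrite e.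
Qed.

Lemma pw_L1_rr i t (p : {poly R}) : (i <= L)%N -> (size p <= t.+1)%N ->
  L1 J (fun x => rr x ^+ t * `|G i x| * fj i x) ->
  L1 J (fun x => G i x * p.[x] * fj i x).
Proof.
move=> iL sp H; have [C C0 HC] := horner_growthW sp; have [m W] := PWj i.
apply: L1_dom (L1Z C mJ H); first exact: mJ.
  apply: measurable_funM; last exact: contJ_meas (pw_cont W).
  by apply: measurable_funM; [exact: mG|exact: contJ_meas (@contJ_poly _ a w p)].
move=> x Jx; have f0 := ltW (pw_pos W Jx).
rewrite !normrM (ger0_norm f0).
have -> : C * (rr x ^+ t * `|G i x| * fj i x) = `|G i x| * (C * rr x ^+ t) * fj i x by ring.
by apply: ler_wpM2r => //; apply: ler_wpM2l.
Qed.

(** Below n the integrands of the integration by parts are products of square integrable functions;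
    from n on, [rrG] started at k = i + s + 1 leaves just the powers of [rr] that the degrees s + 1
    and s require. *)
Lemma fcoef_step i s : (i < L)%N -> (i < n)%N || (i + s.+1 <= L)%N ->
  fcoef a w q (fj i) (G i) (lj i) s.+1 = fcoef a w q (fj i.+1) (G i.+1) (lj i.+1) s.
Proof.
move=> iL; have [i_n _|n_i /= isL] := ltnP i n.
  have [m W] := PWj i.
  exact (ibp_PP qDE D0 s W (AG iL) (L2G (ltnW i_n)) (L2G i_n)).
have [m W] := PWj i; have [m' W'] := PWj i.+1.
have nk : (n < i + s.+1 <= L)%N by lia.
have H1 : L1 J (fun x => rr x ^+ s.+1 * `|G i x| * fj i x).
  by have := rrG (t := s.+1) nk; rewrite addnK; apply; lia.
have H2 : L1 J (fun x => rr x ^+ s * `|G i.+1 x| * fj i.+1 x).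
  have := rrG (t := s) nk; have -> : (i + s.+1 - s = i.+1)%N by lia.
  by apply; lia.
have sl := pw_size_l W; have sl' := pw_size_l W'.
have sP := size_PP D0 sq s sl'; have sP1 := size_PP D0 sq s.+1 sl.
have h1 b c : (b <= 2 -> c <= s.+1 -> (b + c).-1 <= s.+2)%N by lia.
have slP : (size (lj i * PP q s (lj i.+1))%R <= s.+2)%N.
  by apply: leq_trans (size_polyMleq _ _) _; exact: h1.
exact (ibp W (AG iL) (pw_L1_rr (ltnW iL) sP1 H1) (pw_L1_rr (ltnW iL) slP H1) (pw_L1_rr iL sP H2)).
Qed.

Definition cG k := fcoef a w q f (G 0%N) l k.

Lemma fcoef_level i s : (i <= L)%N -> (i <= n)%N || (i + s <= L)%N ->
  fcoef a w q (fj i) (G i) (lj i) s = cG (i + s).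
Proof.
elim: i s => [//|i IH] s iL H; rewrite -fcoef_step //; last first.
  by case/orP: H => H; apply/orP; [left|right; rewrite addnS -addSn].
rewrite IH ?addnS ?addSn //; first exact: ltnW.
by case/orP: H => H; apply/orP; [left; exact: ltnW|right; rewrite -addSn].
Qed.

(** Degree below N - i at level i corresponds to degree below N for g, so a single N serves all
    levels. *)
Definition rem i N :=
  itg J (fun x => (G i x - (proj a w q (fj i) (lj i) (G i) (N - i)).[x]) ^+ 2 * fj i x).
Definition EG i := itg J (fun x => G i x ^+ 2 * fj i x).
Definition eG k := cG k ^+ 2 / nrm2 a w q f l k.

Lemma eG_ge0 k : 0 <= eG k.
Proof. by rewrite divr_ge0 ?sqr_ge0 // ltW // (nrm2_gt0 qDE D0 k W0). Qed.

Lemma rem_ge0 i N : 0 <= rem i N.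
Proof.
have [m W] := PWj i; apply: itg_ge0 => x Jx; apply: mulr_ge0; first exact: sqr_ge0.
exact: ltW (pw_pos W Jx).
Qed.

Lemma remE i N : (i <= n)%N -> rem i N =
  EG i - \sum_(k < N) \prod_(t < i) (lam d k - lam d t) * eG k.
Proof.
move=> i_n; have [m W] := PWj i.
have iL := leq_trans i_n nL.
rewrite /rem (itg_rem qDE D0 sq W (mG iL) (L2G i_n)) -/(EG i); congr (_ - _).
have term s : fcoef a w q (fj i) (G i) (lj i) s ^+ 2 / nrm2 a w q (fj i) (lj i) s =
    \prod_(t < i) (lam d (i + s) - lam d t) * eG (i + s).
  rewrite fcoef_level ?i_n // /eG nrm2_level.
  have p0 : 0 < \prod_(t < i) (lam d (i + s) - lam d t).
    by apply: prodr_gt0 => t _; rewrite subr_gt0 lam_lt // (leq_trans (ltn_ord t)) ?leq_addr.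
  have n1 := nrm2_gt0 qDE D0 s W.
  by field; rewrite !gt_eqF.
under eq_bigr do rewrite term.
rewrite -(big_mkord xpredT (fun k => \prod_(t < i) (lam d k - lam d t) * eG k)).
(* The factor t = k vanishes, so the sum may run over all k < N whatever i is. *)
have zero k : (k < i)%N -> \prod_(t < i) (lam d k - lam d t) * eG k = 0.
  by move=> ki; rewrite (bigD1 (Ordinal ki)) //= subrr !mul0r.
have [Ni|iN] := leqP N i.
  have -> : (N - i = 0)%N by apply/eqP; rewrite subn_eq0.
  rewrite big_ord0 big_nat big1 // => k /andP[_ kN]; apply: zero; exact: leq_trans Ni.
rewrite (big_cat_nat (n := i)) ?(ltnW iN) //=.
have -> : \sum_(0 <= k < i) \prod_(t < i) (lam d k - lam d t) * eG k = 0.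
  by rewrite big_nat big1 // => k /andP[_ ki]; exact: zero.
rewrite add0r.
rewrite -[X in \sum_(X <= _ < N) _]add0n big_addn big_mkord.
by apply: eq_bigr => s _; rewrite addnC.
Qed.

Lemma rem_le i N : (i <= n)%N -> rem i N <= EG i.
Proof.
move=> i_n; have [m W] := PWj i; have iL := leq_trans i_n nL.
rewrite /rem (itg_rem qDE D0 sq W (mG iL) (L2G i_n)) -/(EG i) gerBl.
by apply: sumr_ge0 => s _; rewrite divr_ge0 ?sqr_ge0 // ltW // (nrm2_gt0 qDE D0 s W).
Qed.

(** The Poincaré constant is lam N - lam i = (N - i) (1 - (N + i - 1) d), and d <= 0. *)
Lemma rem_poincare i N : (i < n)%N -> (i < N)%N ->
  (N - i)%:R * rem i N <= rem i.+1 N.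
Proof.
move=> i_n iN; have [m W] := PWj i; have [m' W'] := PWj i.+1.
have iL := leq_trans i_n nL.
have Li := L2G (ltnW i_n); have Li1 := L2G i_n.
have e : (N - i = (N - i.+1).+1)%N by lia.
have dP : (proj a w q (fj i) (lj i) (G i) (N - i))^`() =
    proj a w q (fj i.+1) (lj i.+1) (G i.+1) (N - i.+1).
  by rewrite e (deriv_proj qDE D0 (N - i.+1) W (AG iL) Li Li1).
have Ah := ACD_B (AG iL) (ACD_poly a w (proj a w q (fj i) (lj i) (G i) (N - i))).
rewrite dP in Ah.
have := poincare qDE D0 W Ah (L1_rem W (mG (ltnW iL)) Li (N - i))
  (L1_rem W' (mG iL) Li1 (N - i.+1))
  (fun s sN => proj_orth qDE D0 sq W (mG (ltnW iL)) Li sN).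
apply: le_trans; rewrite -/(rem i N); apply: ler_wpM2r; first exact: rem_ge0.
rewrite Lam_lam subnKC 1?ltnW // lam_sub natrB 1?ltnW //.
rewrite -[leLHS]mulr1; apply: ler_wpM2l; first by rewrite subr_ge0 ler_nat ltnW.
rewrite lerDl oppr_ge0; apply: mulr_ge0_le0 => //.
case: N iN {e dP Ah} => // N _; rewrite -natr1 addrAC addrK; exact: addr_ge0.
Qed.

Lemma rem_small i (e : R) : (i < n)%N -> 0 < e ->
  exists N0, forall N, (N0 <= N)%N -> rem i N <= e.
Proof.
move=> i_n e0; have [N1 HN1] := archi_nat (EG i.+1 / e).
exists (N1 + i.+1)%N => N hN.
have iN : (i < N)%N by lia.
have := le_trans (rem_poincare i_n iN) (rem_le N i_n).
have k0 : (0 : R) < (N - i)%:R by rewrite ltr0n subn_gt0.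
rewrite mulrC -ler_pdivlMr // => /le_trans; apply.
rewrite ler_pdivrMr // mulrC -ler_pdivrMr //; apply: le_trans (ltW HN1) _.
by rewrite ler_nat; lia.
Qed.

Lemma sum_rem_small n' (co : nat -> R) (e : R) : (n' <= n)%N -> 0 < e ->
  exists N0, forall N, (N0 <= N)%N -> `|\sum_(i < n') co i * rem i N| <= e.
Proof.
elim: n' e => [|n' IH] e n'n e0; first by exists 0%N => N _; rewrite big_ord0 normr0 ltW.
have e2 : 0 < e / 2 by rewrite divr_gt0.
have c0 : 0 < `|co n'| + 1 by rewrite ltr_wpDl.
have [N1 H1] := IH _ (ltnW n'n) e2; have [N2 H2] := rem_small n'n (divr_gt0 e2 c0).
exists (maxn N1 N2) => N; rewrite geq_max => /andP[h1 h2]; rewrite big_ord_recr /=.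
apply: le_trans (ler_normD _ _) _; have := H1 _ h1.
suff : `|co n' * rem n' N| <= e / 2 by lra.
have r0 := rem_ge0 n' N; rewrite normrM (ger0_norm r0).
have := H2 _ h2; rewrite ler_pdivlMr // mulrDr mulr1 mulrC; lra.
Qed.

Hypothesis f_mass : itg J f = 1.

(** [acoef], with E[q^k] read as the mass of the k-th weight. *)
Definition acf m k : R := ('C(m, k))%:R * pd d (m + k) (m + n + k) /
  (((m + n) ^_ k)%:R * itg J (fj k) * pd d k.-1 (2 * k).-1%N * pd d m (m + n)).

Definition Vabs := EG 0 - cG 0 ^+ 2.

Definition Sabs m := \sum_(1 <= i < m.+1) acf m i * cG i ^+ 2 +
  \sum_(1 <= i < n.+1) (-1) ^+ i.-1 * bcoef d m n i * EG i.

Definition rho m k := \prod_(j < n) (lam d (m.+1 + j) - lam d k) / lamP d m n.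

Lemma nrm2_0 g l' : nrm2 a w q g l' 0 = itg J g.
Proof. by apply: itg_ext => x _; rewrite /= hornerC expr1n mul1r. Qed.

Lemma rho_eG m k : (0 < k <= m)%N -> rho m k * eG k = acf m k * cG k ^+ 2.
Proof.
move=> /andP[k0 km]; have [m' W] := PWj k.
have X0 : itg J (fj k) != 0 by rewrite gt_eqF // (pw_itg_gt0 W).
rewrite /rho -(acoef_id d0 n km X0) -/(acf m k) /eG.
have := nrm2_level k 0; rewrite addn0 nrm2_0 => ->.
have p0 : \prod_(t < k) (lam d k - lam d t) != 0.
  by rewrite gt_eqF // prodr_gt0 // => t _; rewrite subr_gt0 lam_lt.
by field; rewrite p0 X0.
Qed.

(** As lam 0 = 0 and f has mass 1, the term k = 0 is the squared mean subtracted in the variance. *)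
Lemma rho_eG0 m : rho m 0 * eG 0 = cG 0 ^+ 2.
Proof.
rewrite /rho lamP_prod; under eq_bigr do rewrite lam0 subr0.
rewrite /eG nrm2_0 f_mass divr1 mulfV ?mul1r //.
by rewrite gt_eqF // prodr_gt0 // => i _; rewrite addSn lamS_gt0.
Qed.

(** Each E[q^i (g^(i))^2] is replaced by its truncated expansion and the sums are exchanged; Newton
    interpolation leaves [rho m k] before [eG k]. The terms with 0 < k <= m are those of the first
    sum of S_m and cancel. *)
Lemma VS_expansion m N : (m < N)%N ->
  Vabs - Sabs m = \sum_(k < N) (if (m < k)%N then rho m k * eG k else 0) +
    \sum_(i < n.+1) (-1) ^+ i * bcoef d m n i * rem i N.
Proof.
move=> mN.
have E1 : \sum_(i < n.+1) (-1) ^+ i * bcoef d m n i * EG i =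
    EG 0 - \sum_(1 <= i < n.+1) (-1) ^+ i.-1 * bcoef d m n i * EG i.
  rewrite -(big_mkord xpredT (fun i => (-1) ^+ i * bcoef d m n i * EG i)) big_ltn //.
  rewrite expr0 bcoef_0 !mul1r; congr (_ + _); rewrite -sumrN.
  rewrite big_nat [RHS]big_nat; apply: eq_bigr => i /andP[i0 _].
  by rewrite -{1}(prednK i0) exprS; ring.
have E2 : \sum_(i < n.+1) (-1) ^+ i * bcoef d m n i * EG i =
    \sum_(k < N) rho m k * eG k + \sum_(i < n.+1) (-1) ^+ i * bcoef d m n i * rem i N.
  have E3 (i : 'I_n.+1) : (-1) ^+ i * bcoef d m n i * EG i =
      \sum_(k < N) (-1) ^+ i * bcoef d m n i * \prod_(t < i) (lam d k - lam d t) * eG k +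
      (-1) ^+ i * bcoef d m n i * rem i N.
    have i_n : (i <= n)%N by rewrite -ltnS.
    have -> : \sum_(k < N) (-1) ^+ i * bcoef d m n i * \prod_(t < i) (lam d k - lam d t) * eG k =
        (-1) ^+ i * bcoef d m n i * \sum_(k < N) \prod_(t < i) (lam d k - lam d t) * eG k.
      by rewrite mulr_sumr; apply: eq_bigr => k _; rewrite -!mulrA.
    by rewrite (remE N i_n); ring.
  rewrite (eq_bigr _ (fun i _ => E3 i)) big_split /= exchange_big /=; congr (_ + _).
  apply: eq_bigr => k _; rewrite -mulr_suml; congr (_ * _).
  exact: newton_expansion.
have E4 : \sum_(k < N) rho m k * eG k =
    \sum_(k < N) (if (m < k)%N then rho m k * eG k else 0) +
    (cG 0 ^+ 2 + \sum_(1 <= i < m.+1) acf m i * cG i ^+ 2).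
  have -> : cG 0 ^+ 2 + \sum_(1 <= i < m.+1) acf m i * cG i ^+ 2 =
      \sum_(k < N) (if (m < k)%N then 0 else rho m k * eG k).
    rewrite -(big_mkord xpredT (fun k => if (m < k)%N then 0 else rho m k * eG k)).
    have -> : \sum_(0 <= k < N) (if (m < k)%N then 0 else rho m k * eG k) =
        \sum_(0 <= k < m.+1) (if (m < k)%N then 0 else rho m k * eG k).
      rewrite (big_cat_nat (n := m.+1)) //=.
      rewrite [X in _ + X = _]big_nat [X in _ + X = _]big1 ?addr0 //.
      by move=> k /andP[-> _].
    rewrite [RHS]big_ltn //= rho_eG0; congr (_ + _).
    rewrite big_nat [RHS]big_nat; apply: eq_bigr => k /andP[k0 km].
    have kkm : (0 < k <= m)%N by rewrite k0 -ltnS.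
    by rewrite ltnNge -(ltnS k m) km /= (rho_eG kkm).
  by rewrite -big_split; apply: eq_bigr => k _ /=; case: ifP => _; rewrite ?addr0 ?add0r.
by rewrite /Vabs /Sabs; lra.
Qed.

(** |Var g - S_m| times [lamP d m n], the sign making it nonnegative. Since [zeta] is a quotient of
    two [lamP], the inequality to prove is monotonicity of [Xabs] in m. *)
Definition Xabs m := (-1) ^+ n * lamP d m n * (Vabs - Sabs m).

Definition corem m i := (-1) ^+ n * lamP d m n * ((-1) ^+ i * bcoef d m n i).

(** [rem n N] appears with coefficient 1 because b_n is the inverse of [lamP d m n]. *)
Lemma Xabs_expansion m N : (m < N)%N ->
  Xabs m = \sum_(k < N) tprod d m n k * eG k + \sum_(i < n) corem m i * rem i N + rem n N.
Proof.
move=> mN; have P0 : lamP d m n != 0 by rewrite gt_eqF ?lamP_gt0.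
have sg : (-1) ^+ n * (-1) ^+ n = 1 :> R by rewrite -exprMn mulrNN mulr1 expr1n.
rewrite /Xabs (VS_expansion mN) mulrDr mulr_sumr -addrA; congr (_ + _).
  apply: eq_bigr => k _; case: ltnP => mk.
    rewrite /rho (tprod_prod d0 n mk) -[RHS]mul1r -[in RHS]sg.
    by move: ((-1) ^+ n) => s; field.
  rewrite /tprod ifF ?mul0r ?mulr0 //; apply/negbTE; rewrite -leqNgt.
  by rewrite (leq_trans mk) ?leq_addr.
rewrite big_ord_recr /= mulrDr mulr_sumr; congr (_ + _).
  by apply: eq_bigr => i _; rewrite /corem; ring.
rewrite bcoef_n -[RHS]mul1r -[in RHS]sg.
by move: ((-1) ^+ n) => s; field.
Qed.

Lemma corem_small m e : 0 < e -> exists N0, forall N, (N0 <= N)%N ->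
  `|\sum_(i < n) corem m i * rem i N| <= e.
Proof. exact: sum_rem_small. Qed.

Lemma Xabs_ge0 m : 0 <= Xabs m.
Proof.
apply/ler_addgt0Pr => e e0; have [N0 H] := corem_small m e0.
pose N := maxn N0 m.+1; have h1 : (N0 <= N)%N by rewrite leq_maxl.
have h2 : (m < N)%N by rewrite leq_maxr.
have := H N h1; rewrite (Xabs_expansion h2) ler_norml => /andP[h3 _].
have : 0 <= \sum_(k < N) tprod d m n k * eG k.
  by apply: sumr_ge0 => k _; rewrite mulr_ge0 ?tprod_ge0 ?eG_ge0.
have := rem_ge0 n N; lra.
Qed.

Variables (m1 m2 : nat).
Hypothesis m12 : (m1 < m2)%N.

(** [rem n N] cancels between the two expansions and the lower remainders are small for large N. *)
Lemma Xabs_diff e K : 0 < e -> exists N, (K <= N)%N /\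
  `|Xabs m1 - Xabs m2 - \sum_(k < N) (tprod d m1 n k - tprod d m2 n k) * eG k| <= e.
Proof.
move=> e0; have e2 : 0 < e / 2 by rewrite divr_gt0.
have [N1 H1] := corem_small m1 e2; have [N2 H2] := corem_small m2 e2.
pose N := (N1 + N2 + K + m2.+1)%N; exists N; split; first by rewrite /N; lia.
have l1 : (m1 < N)%N by rewrite /N; lia.
have l2 : (m2 < N)%N by rewrite /N; lia.
have := H1 N; have := H2 N.
rewrite (Xabs_expansion l1) (Xabs_expansion l2).
have -> : (N1 <= N)%N by rewrite /N; lia.
have -> : (N2 <= N)%N by rewrite /N; lia.
have -> : \sum_(k < N) (tprod d m1 n k - tprod d m2 n k) * eG k =
    \sum_(k < N) tprod d m1 n k * eG k - \sum_(k < N) tprod d m2 n k * eG k.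
  by rewrite -sumrB; apply: eq_bigr => k _; rewrite mulrBl.
move=> /(_ isT) + /(_ isT); rewrite !ler_norml => /andP[a1 a2] /andP[b1 b2].
by apply/andP; split; lra.
Qed.

Lemma Xabs_le : Xabs m2 <= Xabs m1.
Proof.
apply/ler_addgt0Pr => e e0; have [N [_]] := Xabs_diff 0 e0.
have : 0 <= \sum_(k < N) (tprod d m1 n k - tprod d m2 n k) * eG k.
  by apply: sumr_ge0 => k _; rewrite mulr_ge0 ?eG_ge0 // subr_ge0 tprod_le.
by rewrite ler_norml => ? /andP[? ?]; lra.
Qed.

(** All terms of the difference are nonnegative, so each is at most the total 0, and the factor of
    [eG k] is positive. *)
Lemma Xabs_eq_coef k : Xabs m1 = Xabs m2 -> (m1 + n < k)%N -> eG k = 0.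
Proof.
move=> X12 kn; have t0 := tprod_lt d0 n0 m12 kn.
suff : (tprod d m1 n k - tprod d m2 n k) * eG k <= 0.
  rewrite pmulr_rle0 ?subr_gt0 // => h; apply/eqP; rewrite eq_le h; exact: eG_ge0.
apply/ler_addgt0Pr => e e0; rewrite add0r; have [N [kN]] := Xabs_diff k.+1 e0.
rewrite X12 subrr sub0r normrN => h; apply: le_trans (le_trans (ler_norm _) h).
rewrite (bigD1 (Ordinal kN)) //= lerDl; apply: sumr_ge0 => j _.
by rewrite mulr_ge0 ?eG_ge0 // subr_ge0 tprod_le.
Qed.

Lemma size_proj (K : nat) (g : R -> R) (l' : {poly R}) : (size l' <= 2)%N ->
  (size (proj a w q g l' (G 0) K) <= K)%N.
Proof.
move=> sl; apply: (leq_trans (size_sum _ _ _)); apply/bigmax_leqP => s _.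
by rewrite (leq_trans (size_scale_leq _ _)) // (leq_trans (size_PP D0 sq s sl)).
Qed.

Lemma Xabs_eq_iff : Xabs m1 = Xabs m2 <->
  exists p : {poly R}, (size p <= n + m1 + 1)%N /\ forall x, J x -> G 0%N x = p.[x].
Proof.
have sl := pw_size_l W0; have L0 : (0 < L)%N by exact: leq_trans nL.
split=> [X12|[p [sp Gp]]].
  pose K := (n + m1 + 1)%N.
  exists (proj a w q f l (G 0%N) K); split; first exact: size_proj.
  (* The coefficients past K vanish, so [rem 0] is constant from K on; as it becomes arbitrarily
     small it is 0, and by continuity g equals its projection on J. *)
  have r0 N : (K <= N)%N -> rem 0 N = rem 0 K.
    move=> KN; rewrite !remE //; congr (_ - _).
    rewrite -(big_mkord xpredT (fun k => \prod_(t < 0) (lam d k - lam d t) * eG k)).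
    rewrite (big_cat_nat (n := K)) //= big_mkord.
    have -> : \sum_(K <= k < N) \prod_(t < 0) (lam d k - lam d t) * eG k = 0.
      rewrite big_nat big1 // => k /andP[Kk _]; rewrite Xabs_eq_coef ?mulr0 //.
      by move: Kk; rewrite /K addn1 addnC.
    by rewrite addr0.
  have remK : rem 0 K = 0.
    apply/eqP; rewrite eq_le rem_ge0 andbT; apply/ler_addgt0Pr => e e0; rewrite add0r.
    have [N0 H] := rem_small n0 e0; rewrite -(r0 (maxn K N0)) ?leq_maxl //.
    by apply: H; rewrite leq_maxr.
  move: remK; rewrite /rem subn0 /= => remK x Jx.
  have Lr := L1_rem W0 (mG (ltnW L0)) (L2G (leq0n n)) K.
  have cG0 := ACD_cont (AG L0).
  have ch : contJ a w (fun x => (G 0%N x - (proj a w q f l (G 0%N) K).[x]) ^+ 2 * f x).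
    apply: contJ_M (pw_cont W0); apply: contJ_X; apply: contJ_B cG0 _; exact: contJ_poly.
  have ge0 y : J y -> 0 <= (G 0%N y - (proj a w q f l (G 0%N) K).[y]) ^+ 2 * f y.
    by move=> Jy; apply: mulr_ge0; [exact: sqr_ge0|exact: ltW (pw_pos W0 Jy)].
  have := itg0_cont ch ge0 Lr remK Jx => /eqP.
  by rewrite mulf_eq0 sqrf_eq0 (gt_eqF (pw_pos W0 Jx)) orbF subr_eq0 => /eqP.
have e0k k : (m1 + n < k)%N -> eG k = 0.
  move=> kn; rewrite /eG (_ : cG k = 0) ?expr0n ?mul0r //.
  rewrite /cG /fcoef (@itg_ext _ _ _ (fun x => p.[x] * (PP q k l).[x] * f x)).
    by apply: (PP_orth qDE D0 W0); apply: leq_trans sp _; rewrite addn1 addnC.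
  by move=> x Jx; rewrite Gp.
apply/eqP; rewrite -subr_eq0 -normr_le0; apply/ler_addgt0Pr => e e0; rewrite add0r.
have [N [_]] := Xabs_diff 0 e0; rewrite big1 ?subr0 // => k _.
have [km|mk] := leqP k (m1 + n); last by rewrite e0k ?mulr0.
rewrite /tprod !ifF ?subrr ?mul0r //; apply/negbTE; rewrite -leqNgt //.
by rewrite (leq_trans km) // leq_add2r ltnW.
Qed.

End Levels.

(** * The integrated Pearson family *)

Section PearsonWeight.
Context {R : realType}.
Variables (f : R -> R) (mu d b c : R) (a w : \bar R).
Notation leb := (@lebesgue_measure R).
Local Notation J := (Jset a w).
Hypothesis hIP : IP f mu d b c.
Hypothesis hS : support_is f a w.
Hypothesis d0 : d <= 0.

Definition qp : {poly R} := d *: 'X^2 + b *: 'X + c%:P.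

Lemma qpE x : qp.[x] = qpoly d b c x.
Proof. by rewrite /qp /qpoly !(hornerD, hornerZ, hornerXn, hornerX, hornerC). Qed.

Lemma qp_deriv : qp^`() = (2 * d) *: 'X + b%:P.
Proof.
rewrite /qp !derivD derivC !derivZ derivXn derivX addr0 alg_polyC expr1; congr (_ + _).
by rewrite -scaler_nat scalerA mulrC.
Qed.

Lemma qp_size : (size qp <= 3)%N.
Proof.
rewrite /qp (leq_trans (size_polyD _ _)) // geq_max (leq_trans (size_polyD _ _)) /=.
  by rewrite (leq_trans (size_polyC_leq1 _)).
rewrite geq_max (leq_trans (size_scale_leq _ _)) ?size_polyXn //=.
by rewrite (leq_trans (size_scale_leq _ _)) ?size_polyX.
Qed.

Lemma qp_growth x : qp.[x] <= (`|b| + `|c|) * rr x.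
Proof.
rewrite qpE /qpoly.
have h1 : d * x ^+ 2 <= 0 by rewrite mulr_le0_ge0 ?sqr_ge0.
have h2 : b * x <= `|b| * rr x.
  by apply: le_trans (ler_norm _) _; rewrite normrM ler_wpM2l // rr_ge_norm.
have h3 : c <= `|c| * rr x.
  by apply: le_trans (ler_norm c) _; rewrite -[leLHS]mulr1 ler_wpM2l // rr_ge1.
by lra.
Qed.

Let f_ge0 x : 0 <= f x. Proof. by case: hIP => -[_ []]. Qed.
Let f_pos x : J x -> 0 < f x. Proof. by case: hS => _ /(_ x)[_]. Qed.
Let f_out x : ~ J x -> f x = 0.
Proof.
case: hS => _ /(_ x)[H _] nJ; apply/eqP; rewrite eq_le f_ge0 andbT leNgt.
by apply/negP => /H.
Qed.
Let Lf : L1 setT f. Proof. by case: hIP => -[_ [_ []]]. Qed.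
Let Ltf : L1 setT (fun t => t * f t). Proof. by case: hIP => _ []. Qed.

Let phi t := (mu - t) * f t.

Let Lphi : L1 setT phi.
Proof.
have := L1B measurableT (L1Z mu measurableT Lf) Ltf.
by apply: L1_ext => // x _; rewrite /phi mulrBl.
Qed.

Let phi_tot : itg setT phi = 0.
Proof.
have [[_ [_ [_ f1]]] [_ [fmu _]]] := hIP.
rewrite (@itg_ext _ _ _ (fun x => mu * f x - x * f x)); last by move=> x _; rewrite /phi mulrBl.
rewrite (itgB measurableT (L1Z mu measurableT Lf) Ltf) (itgZ mu measurableT Lf).
move: f1 fmu => /= f1 fmu.
have -> : itg setT f = 1 by exact f1.
have -> : itg setT (fun x => x * f x) = mu by exact fmu.
by rewrite mulr1 subrr.
Qed.

Let leE (x : R) : [set t | t <= x] = [set` Interval -oo%O (BRight x)].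
Proof. by apply/seteqP; split=> t; rewrite /= in_itv. Qed.

Let mle (x : R) : measurable [set t | t <= x].
Proof. by rewrite leE; exact: measurable_itv. Qed.

Let PE x : itg [set t | t <= x] phi = qp.[x] * f x.
Proof. by case: hIP => _ [_ [_ [_ H]]]; rewrite qpE -H. Qed.

Let mgt (x : R) : measurable (setT `\` [set t | t <= x]).
Proof. exact: measurableD. Qed.

(** phi has total integral 0 because mu is the mean, so P is also given by the right tail. *)
Let PE' x : qp.[x] * f x = itg (setT `\` [set t | t <= x]) (fun t => - phi t).
Proof.
have Lr : L1 (setT `\` [set t | t <= x]) phi by exact: L1_sub Lphi.
rewrite itgN // -PE; have := itg_setD measurableT (mle x) (@subsetT _ _) Lphi.
rewrite phi_tot => /eqP; rewrite eq_sym addr_eq0 => /eqP ->; by [].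
Qed.

Lemma itg_J A h : measurable A -> L1 A h -> (forall x, ~ J x -> h x = 0) ->
  itg A h = itg (A `&` J) h.
Proof.
move=> mA Lh h0; have mAJ : measurable (A `&` J) by apply: measurableI => //; exact: mJ.
have mD : measurable (A `\` (A `&` J)) by exact: measurableD.
rewrite (itg_setD mA mAJ (@subIsetl _ _ _) Lh).
rewrite [X in _ + X](@itg_ext _ _ _ (fun x => 0 * h x)).
  by rewrite (itgZ 0 mD (L1_sub mA mD (@subDsetl _ _ _) Lh)) mul0r addr0.
by move=> x [Ax nAJ]; rewrite mul0r h0 // => Jx; apply: nAJ.
Qed.

Let phi_out x : ~ J x -> phi x = 0.
Proof. by move=> nJ; rewrite /phi f_out ?mulr0. Qed.

Lemma mass_J : itg J f = 1.
Proof.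
have [[_ [_ [_ f1]]] _] := hIP.
by rewrite -(setTI J) -(itg_J measurableT Lf f_out); exact f1.
Qed.

Lemma J_neq0 : J !=set0.
Proof.
have [//|nJ] := pselect (J !=set0); exfalso.
have := mass_J; rewrite (_ : J = set0); last first.
  by apply/seteqP; split=> x //= Jx; apply: nJ; exists x.
by rewrite Rintegral_set0 => /esym/eqP; rewrite oner_eq0.
Qed.

Let P_ge0 x : 0 <= qp.[x] * f x.
Proof.
have [xmu|mux] := leP x mu.
  rewrite -PE; apply: itg_ge0 => t /= tx; rewrite /phi mulr_ge0 // subr_ge0.
  exact: le_trans tx xmu.
rewrite PE'; apply: itg_ge0 => t [_ /= /negP]; rewrite -ltNge => xt.
by rewrite /phi -mulNr opprB mulr_ge0 // subr_ge0 ltW // (lt_trans mux).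
Qed.

Let P_mono x y : x <= y -> y <= mu -> qp.[x] * f x <= qp.[y] * f y.
Proof.
move=> xy ymu; rewrite -!PE; apply: itg_subset => //.
- by move=> t /= tx; exact: le_trans tx xy.
- exact: L1_sub Lphi.
- move=> t /= ty; rewrite /phi mulr_ge0 // subr_ge0; exact: le_trans ty ymu.
Qed.

Let P_anti x y : x <= y -> mu <= x -> qp.[y] * f y <= qp.[x] * f x.
Proof.
move=> xy mux; rewrite !PE'; apply: itg_subset => //.
- by move=> t [_ /= nt]; split=> //= tx; apply: nt; exact: le_trans tx xy.
- by apply: L1N => //; exact: L1_sub Lphi.
- move=> t [_ /= /negP]; rewrite -ltNge => xt.
  by rewrite /phi -mulNr opprB mulr_ge0 // subr_ge0 ltW // (le_lt_trans mux).
Qed.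

(** A quadratic vanishing at x - r, x and x + r has zero coefficients. *)
Let q_nonzero x r : 0 < r -> ~ (forall y, `|y - x| <= r -> qp.[y] = 0).
Proof.
move=> r0 H; have [_ [_ [_ [abc _]]]] := hIP.
have h1 : qp.[x] = 0 by apply: H; rewrite subrr normr0 ltW.
have h2 : qp.[x + r] = 0 by apply: H; rewrite ler_norml; apply/andP; split; lra.
have h3 : qp.[x - r] = 0 by apply: H; rewrite ler_norml; apply/andP; split; lra.
move: h1 h2 h3; rewrite !qpE /qpoly => h1 h2 h3.
have d00 : d = 0.
  have : d * r ^+ 2 = 0 by move: h1 h2 h3; rewrite sqrrD sqrrB; lra.
  by move/eqP; rewrite mulf_eq0 sqrf_eq0 (gt_eqF r0) orbF => /eqP.
have b00 : b = 0.
  have : b * r = 0 by move: h1 h2; rewrite d00 !mul0r !add0r; lra.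
  by move/eqP; rewrite mulf_eq0 (gt_eqF r0) orbF => /eqP.
have c00 : c = 0 by move: h1; rewrite d00 b00 !mul0r !add0r.
by move: abc; rewrite d00 b00 c00 !normr0 !addr0 ltxx.
Qed.

(** If q x = 0, monotonicity of P makes P vanish on the side of x away from mu. As f > 0 on J, q
    would then vanish on an interval. *)
Lemma qp_gt0 x : J x -> 0 < qp.[x].
Proof.
move=> Jx; have fx := f_pos Jx; have [r r0 rJ] := J_ball Jx.
rewrite lt_neqAle; apply/andP; split; last by rewrite -(pmulr_lge0 _ fx) P_ge0.
rewrite eq_sym; apply/negP => /eqP qx.
have zero y : J y -> qp.[y] * f y <= qp.[x] * f x -> qp.[y] = 0.
  move=> Jy; rewrite qx mul0r => h; have := P_ge0 y => h'.
  have /eqP : qp.[y] * f y = 0 by apply/eqP; rewrite eq_le h h'.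
  by rewrite mulf_eq0 (gt_eqF (f_pos Jy)) orbF => /eqP.
have r2 : 0 < r / 2 by rewrite divr_gt0.
have [xmu|mux] := leP x mu.
  apply: (q_nonzero (x := x - r / 2) r2) => y; rewrite ler_norml => /andP[h1 h2].
  by apply: zero; [apply: rJ; rewrite ler_norml; lra|apply: P_mono => //; lra].
apply: (q_nonzero (x := x + r / 2) r2) => y; rewrite ler_norml => /andP[h1 h2].
by apply: zero; [apply: rJ; rewrite ler_norml; lra|apply: P_anti; [lra|exact: ltW]].
Qed.

Let Pdiff x y : x <= y -> qp.[y] * f y - qp.[x] * f x = itg `[x, y] phi.
Proof.
move=> xy; rewrite -!PE !leE Rintegral_itvB ?bnd_simp //; last exact: L1_sub Lphi.
by rewrite Rintegral_itv_obnd_cbnd //; exact: L1_sub Lphi.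
Qed.

(** f = P / q on J, where P is an integral and q > 0. *)
Lemma f_contJ : contJ a w f.
Proof.
have [x0 Jx0] := J_neq0.
have Llp : Lloc a w phi by move=> x y _ _; exact: L1_sub Lphi.
have cp : contJ a w (prim x0 phi) := AC_cont (AC_prim Jx0 Llp).
have cP : contJ a w (fun x => (qp.[x])^-1 * (prim x0 phi x + qp.[x0] * f x0)).
  apply: contJ_M; first by apply: contJ_V; [move=> x Jx; rewrite gt_eqF ?qp_gt0|exact: contJ_poly].
  by apply: contJ_D cp _ => x _; exact: cst_continuous.
apply: contJ_ext cP => x Jx; have qx := qp_gt0 Jx.
suff -> : prim x0 phi x = qp.[x] * f x - qp.[x0] * f x0 by rewrite subrK mulKf // gt_eqF.
rewrite /prim; have [x0x|xx0] := leP x0 x; first by rewrite Pdiff.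
by rewrite -Pdiff ?opprB // ltW.
Qed.

Let phi_cont : contJ a w phi.
Proof.
have cm : contJ a w (fun x => (mu%:P - 'X).[x]) by exact: contJ_poly.
have := contJ_M cm f_contJ; apply: contJ_ext => x _.
by rewrite hornerD hornerN hornerC hornerX.
Qed.

Lemma P_deriv x : J x ->
  is_derive x 1 (fun y => qp.[y] * f y) (- (('X - mu%:P).[x] * f x)).
Proof.
move=> Jx.
have L : leb.-integrable [set` Interval -oo%O (BRight (x + 1))] (EFin \o phi) by exact: L1_sub Lphi.
have x1 : x < x + 1 by rewrite ltrDl.
have [|dF Fx] := continuous_FTC1 x1 L _ (phi_cont Jx); first by rewrite /= ltNyr.
have -> : - (('X - mu%:P).[x] * f x) = phi x.
  by rewrite hornerXsubC /phi -mulNr opprB.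
have -> : (fun y => qp.[y] * f y) = (fun y => itg [set` Interval -oo%O (BRight y)] phi).
  apply/funext => y; by rewrite -PE leE.
by apply: DeriveDef; [exact: dF|rewrite -derive1E].
Qed.

(** The left end uses the left tail integral of phi and the right end uses [PE']. *)
Lemma P_end e : 0 < e -> evJ a w (fun x y => qp.[x] * f x <= e /\ qp.[y] * f y <= e).
Proof.
move=> e0; have LJ : L1 J phi by apply: (L1_sub measurableT mJ _ Lphi).
have := L1_tail J_neq0 LJ e0; apply: evJ_impl => x y Jx Jy xy T.
have mD : measurable (J `\` `[x, y]) by apply: measurableD => //; exact: mJ.
have LD : L1 (J `\` `[x, y]) (fun t => `|phi t|).
  by apply: L1_norm; exact: (L1_sub mJ mD (@subDsetl _ _ _) LJ).
split; apply: le_trans (ltW T).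
  rewrite -PE leE -Rintegral_itv_bndo_bndc; last exact: L1_sub Lphi.
  have L' : L1 `]-oo, x[ phi by exact: L1_sub Lphi.
  have mI : measurable (`]-oo, x[%classic `&` J) by apply: measurableI => //; exact: mJ.
  rewrite (itg_J _ L' phi_out) //.
  apply: le_trans (ler_norm _) _.
  apply: le_trans (itg_norm mI (L1_sub measurableT mI (@subsetT _ _) Lphi)) _.
  apply: itg_subset => // t [/=]; rewrite in_itv /= => tx Jt; split=> //.
  by rewrite /= in_itv /= => /andP[xt _]; have := lt_le_trans tx xt; rewrite ltxx.
have L' : L1 (setT `\` [set t | t <= y]) phi by exact: L1_sub Lphi.
have mI : measurable ((setT `\` [set t | t <= y]) `&` J) by apply: measurableI => //; exact: mJ.
rewrite PE' itgN // (itg_J _ L' phi_out) //.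
apply: le_trans (ler_norm _) _; rewrite normrN.
apply: le_trans (itg_norm mI (L1_sub measurableT mI (@subsetT _ _) Lphi)) _.
apply: itg_subset => // t [[_ /= nt] Jt]; split=> //.
by rewrite /= in_itv /= => /andP[_ ty]; exact: nt.
Qed.

(** Otherwise P would be monotone on J while tending to 0 at both ends, although it is positive
    there. *)
Lemma mu_J : J mu.
Proof.
apply: contrapT => nJ; have [x0 Jx0] := J_neq0.
have P0 : 0 < qp.[x0] * f x0 by rewrite mulr_gt0 ?qp_gt0 ?f_pos.
have P2 : 0 < qp.[x0] * f x0 / 2 by rewrite divr_gt0.
have [x [y [Jx Jy _ [[xx0 x0y] [h1 h2]]]]] := evJ_ex (evJ_and (evJ_in Jx0 Jx0) (P_end P2)).
have [mu0|mu0] := leP mu x0.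
  have mx : mu <= x.
    by rewrite leNgt; apply/negP => xm; apply: nJ; exact: Jconv Jx Jx0 (ltW xm) mu0.
  have := P_anti xx0 mx; lra.
have ym : y <= mu.
  by rewrite leNgt; apply/negP => my; apply: nJ; exact: Jconv Jx0 Jy (ltW mu0) (ltW my).
have := P_mono x0y ym; lra.
Qed.

Lemma PW_base : PW a w qp f ('X - mu%:P) 1 mu.
Proof.
have W : PW0 a w qp f ('X - mu%:P) 1 mu.
  split=> //; [exact: qp_gt0|exact: f_contJ|exact: P_deriv|by rewrite scale1r|exact: mu_J|exact: P_end].
split=> //; apply: (moments (fun x _ => qp_growth x) W).
  exact: (L1_sub measurableT mJ (@subsetT _ _) Lf).
apply: (L1_dom (k := fun x => f x + `|x * f x|)).
- exact: mJ.
- apply: contJ_meas; apply: contJ_M f_contJ => x _; exact: isD_cont (isD_rr x).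
- move=> x _; have r0 := rr_gt0 x.
  rewrite normrM (gtr0_norm r0) normrM (ger0_norm (f_ge0 x)) -[X in X + _]mul1r -mulrDl.
  by apply: ler_wpM2r => //; exact: rr_le.
- apply: (L1D mJ); first exact: (L1_sub measurableT mJ (@subsetT _ _) Lf).
  exact: (L1_sub measurableT mJ (@subsetT _ _) (L1_norm Ltf)).
Qed.

End PearsonWeight.

(** * Functions of the class H and the comparison for finite M *)

Section DerivativeClass.
Context {R : realType}.
Variables (f : R -> R) (mu d b c : R) (a w : \bar R).
Local Notation J := (Jset a w).
Local Notation q := (qp d b c).
Hypothesis hIP : IP f mu d b c.
Hypothesis hS : support_is f a w.
Hypothesis d0 : d <= 0.
Variables (M n : nat) (g : R -> R) (Dg : nat -> R -> R).
Hypothesis n0 : (0 < n)%N.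
Hypothesis H : inH f a w d b c M n g Dg.

Lemma inH_L1n : L1 J (fun x => Dg n x ^+ 2 * fj q f n x).
Proof.
case: H => _ [_ [_ [_ [_ [_ [h _]]]]]].
by apply: L1_ext h => [|x _]; [exact: mJ|rewrite fjE qpE; ring].
Qed.

Lemma inH_L1 i : (n < i <= maxn M n)%N -> L1 J (fun x => `|Dg i x| * fj q f i x).
Proof.
move=> /andP[ni iM]; case: H => _ [_ [_ [_ [_ [_ [_ h]]]]]].
have := h i; rewrite ni /= => /(_ _) h'.
have iM' : (i <= M)%N by move: iM; rewrite leq_max (leqNgt i n) ni orbF.
by apply: L1_ext (h' iM') => [|x _]; [exact: mJ|rewrite fjE qpE; ring].
Qed.

Lemma fj_cont i : contJ a w (fj q f i).
Proof.
have [m W] := PWj (qp_deriv d b c) d0 (PW_base hIP hS d0) i; exact: pw_cont W.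
Qed.

Lemma fj_gt0 i x : J x -> 0 < fj q f i x.
Proof.
have [m W] := PWj (qp_deriv d b c) d0 (PW_base hIP hS d0) i; exact (fun Jx => pw_pos W Jx).
Qed.

(** The weight is continuous and positive, so its inverse is bounded on compact segments. *)
Lemma Lloc_unweight i (h : R -> R) : L1 J (fun x => h x * fj q f i x) -> Lloc a w h.
Proof.
move=> Lh x y Jx Jy.
have f0 z : J z -> fj q f i z != 0 by move=> Jz; rewrite gt_eqF // fj_gt0.
have L s t : J s -> J t -> L1 `[s, t] (fun x => h x * fj q f i x).
  by move=> Js Jt; apply: L1_sub Lh => //; [exact: mJ|exact: Jseg].
apply: L1_ext (Lloc_contM (contJ_V f0 (@fj_cont i)) (L1_meas Lh) L Jx Jy) => // z zxy.
by rewrite mulrC mulfK // f0 //; exact: Jseg zxy.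
Qed.

(** The top derivative is that of order n if M <= n, where |y| <= 1 + y^2 is used, and otherwise
    that of order M, which has a weighted first moment. *)
Lemma Lloc_top : Lloc a w (Dg (maxn M n)).
Proof.
have mL : measurable_fun J (Dg (maxn M n)) by case: H => _ [_ [_ [_ [_ []]]]].
case: (leqP M n) mL => [_|nM] mL x y Jx Jy; have mxy := measurable_funS (@mJ R a w) (Jseg Jx Jy) mL.
  apply: (L1_dom (k := fun z => 1 + Dg n z ^+ 2)) => //.
  - move=> z _; rewrite -(real_normK (num_real (Dg n z))).
    have := sqr_ge0 (`|Dg n z| - 1); have := normr_ge0 (Dg n z).
    rewrite sqrrB1; lra.
  - by apply: L1D => //; [exact: L1_seg_cst|exact: (Lloc_unweight inH_L1n)].
have h : (n < M <= maxn M n)%N by rewrite nM leq_maxl.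
by apply: L1_dom (Lloc_unweight (inH_L1 h) Jx Jy) => // z _; rewrite normr_id.
Qed.

Lemma inH_cont i : (i < maxn M n)%N -> contJ a w (Dg i).
Proof.
case: H => _ [_ [hd [hAC _]]] iL.
have [iL1|] := ltnP i.+1 (maxn M n).
  by move=> x Jx; exact: isD_cont (hd i iL1 x Jx).
move=> Li; have -> : i = (maxn M n).-1 by lia.
exact: AC_cont.
Qed.

Lemma inH_ACD i : (i < maxn M n)%N -> ACD a w (Dg i) (Dg i.+1).
Proof.
move=> iL; have [_ [_ [hd [hAC [hae [hm _]]]]]] := H.
have [iL1|Li] := ltnP i.+1 (maxn M n).
  exact: ACD_C1 (hd i iL1) (inH_cont iL1).
have e : i.+1 = maxn M n by lia.
have e' : i = (maxn M n).-1 by rewrite -e.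
rewrite e {}e'; split => //.
exact: Lloc_top.
Qed.

Local Notation lw := ('X - mu%:P).

Lemma Var_Vabs : Var f a w g = Vabs a w q f lw Dg.
Proof.
have [_ [Dg0 _]] := H.
rewrite /Var /Vabs /Ex /EG /cG /fcoef; congr (_ - _ ^+ 2); apply: itg_ext => x Jx /=.
  by rewrite Dg0.
by rewrite hornerC mulr1 Dg0.
Qed.

Lemma Smn_Sabs m : (m <= maxn M n)%N -> Smn f a w d b c m n Dg = Sabs a w q d f lw Dg n m.
Proof.
move=> mL; rewrite /Smn /Sabs; congr (_ + _); rewrite big_nat [RHS]big_nat.
  apply: eq_bigr => i /andP[i0 im]; congr (_ * _ ^+ 2).
    rewrite /acoef /acf (_ : Ex f a w _ = itg J (fj q f i)) //.
    by apply: itg_ext => x _; rewrite fjE qpE.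
  have iL : (i <= maxn M n)%N by apply: leq_trans mL; rewrite -ltnS.
  have nL : (n <= maxn M n)%N by rewrite leq_maxr.
  (* E[q^i g^(i)] is the coefficient of index 0 at level i, since [PP] at 0 is the constant 1; it is
     therefore the i-th coefficient of g. *)
  have cE := fcoef_level (fun x _ => qp_growth b c d0 x) (qp_deriv d b c) d0 (qp_size d b c)
    (PW_base hIP hS d0) inH_ACD n0 nL inH_L1n inH_L1 iL (s := 0%N).
  have {}cE := cE _; rewrite addn0 in cE; rewrite -cE ?iL ?orbT //.
  by apply: itg_ext => x _; rewrite /= hornerC mulr1 fjE qpE; ring.
apply: eq_bigr => i _; congr (_ * _).
by apply: itg_ext => x _; rewrite fjE qpE; ring.
Qed.

Lemma comparison m1 m2 : (m1 < m2)%N -> (m2 <= maxn M n)%N ->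
  let V := Var f a w g in
  let z := zeta d m1 m2 n in
  [/\ 1 < z,
      z * `|V - Smn f a w d b c m2 n Dg| <= `|V - Smn f a w d b c m1 n Dg| &
      (`|V - Smn f a w d b c m1 n Dg| = z * `|V - Smn f a w d b c m2 n Dg| <->
       exists p : {poly R}, (size p <= n + m1 + 1)%N /\
         forall x, J x -> g x = p.[x])].
Proof.
move=> m12 m2L V z; have W := PW_base hIP hS d0.
have nL : (n <= maxn M n)%N by rewrite leq_maxr.
have mass := mass_J hIP hS.
rewrite /V Var_Vabs !Smn_Sabs ?(leq_trans (ltnW m12)) //.
have P1 := lamP_gt0 d0 m1 n; have P2 := lamP_gt0 d0 m2 n.
have zE : z = lamP d m2 n / lamP d m1 n by [].
have nrmX m : `|Vabs a w q f lw Dg - Sabs a w q d f lw Dg n m| =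
    Xabs a w q d f lw Dg n m / lamP d m n.
  have Pm := lamP_gt0 d0 m n.
  have X0 := Xabs_ge0 (fun x _ => qp_growth b c d0 x) (qp_deriv d b c) d0 (qp_size d b c)
    W inH_ACD n0 nL
    inH_L1n inH_L1 mass m.
  by rewrite -(ger0_norm X0) /Xabs -mulrA normrMsign normrM (gtr0_norm Pm) mulrC mulKf ?gt_eqF.
have le12 := Xabs_le (fun x _ => qp_growth b c d0 x) (qp_deriv d b c) d0 (qp_size d b c)
    W inH_ACD n0 nL
    inH_L1n inH_L1 mass m12.
have iff12 := Xabs_eq_iff (fun x _ => qp_growth b c d0 x) (qp_deriv d b c) d0 (qp_size d b c)
    W inH_ACD n0 nL
    inH_L1n inH_L1 mass m12.
have zX : z * `|Vabs a w q f lw Dg - Sabs a w q d f lw Dg n m2| =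
    Xabs a w q d f lw Dg n m2 / lamP d m1 n.
  by rewrite nrmX zE; field; rewrite !gt_eqF.
have [_ [Dg0 _]] := H.
split.
- by rewrite zE ltr_pdivlMr // mul1r lamP_lt.
- by rewrite zX nrmX ler_pM2r ?invr_gt0.
- rewrite zX nrmX; split=> [/(mulIf _)|[p [sp gp]]].
    rewrite invr_eq0 gt_eqF // => /(_ isT)/iff12[p [sp gp]].
    by exists p; split=> // x Jx; rewrite -gp // Dg0.
  by congr (_ / _); apply/iff12; exists p; split=> // x Jx; rewrite Dg0 // gp.
Qed.

End DerivativeClass.

Theorem theorem3p1 (R : realType) (f : R -> R) (mu d b c : R) (a w : \bar R)
    (n : nat) (M : option nat) (g : R -> R) (Dg : nat -> R -> R) :
  IP f mu d b c -> support_is f a w -> d <= 0 -> (0 < n)%N ->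
  leM n M -> inHM f a w d b c M n g Dg ->
  forall m1 m2 : nat, (m1 < m2)%N -> leM m2 M ->
  let V := Var f a w g in
  let z := zeta d m1 m2 n in
  [/\ 1 < z,
      z * `|V - Smn f a w d b c m2 n Dg| <= `|V - Smn f a w d b c m1 n Dg| &
      (`|V - Smn f a w d b c m1 n Dg| = z * `|V - Smn f a w d b c m2 n Dg| <->
       exists p : {poly R}, (size p <= n + m1 + 1)%N /\
         forall x, Jset a w x -> g x = p.[x])].
Proof.
move=> hIP hS d0 n0 nM hH m1 m2 m12 m2M.
case: M nM hH m2M => [M'|] /= _ hH m2M.
  by apply: (comparison hIP hS d0 n0 hH m12); rewrite leq_max m2M.
(* For infinite M, membership in the class of order m2 suffices. *)
by apply: (comparison hIP hS d0 n0 (hH m2) m12); rewrite leq_maxl.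
Qed.
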